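(* Let $N\ge 1$, $1<p<\infty$, $s\in(0,1)$, $A>0$, and let $\Omega\subset\mathbb{R}^N$ be open and bounded. Let $H:\mathbb{R}^N\times\mathbb{R}^N\times\mathbb{R}\to\mathbb{R}$ be a Carathéodory function (measurable in $(x,y)$, continuous in $\xi$), convex in $\xi$, with $H(x,y,\xi)\ge A\left(\frac{|\xi|}{|x-y|^s}\right)^p$, and let $u_0\in W^{s,p}(\mathbb{R}^N)$ with $u_0|_\Omega\in L^2(\Omega)$ and $\iint_{\mathbb{R}^N\times\mathbb{R}^N}\frac{H(x,y,u_0(x)-u_0(y))}{|x-y|^N}\,dx\,dy<\infty$. If $\xi\mapsto H(x,y,\xi)$ is strictly convex, then there is at most one variational solution (in the sense defined in the context) with Cauchy–Dirichlet data $u_0$.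
   Context: $W^{s,p}(\mathbb{R}^N)=\{\psi\in L^p(\mathbb{R}^N):[\psi]_{W^{s,p}(\mathbb{R}^N)}<\infty\}$ with $[\psi]_{W^{s,p}(\mathbb{R}^N)}^p=\iint_{\mathbb{R}^N\times\mathbb{R}^N}\frac{|\psi(x)-\psi(y)|^p}{|x-y|^{N+ps}}\,dx\,dy$ and norm $\|\psi\|_{L^p}+[\psi]_{W^{s,p}}$. $W^{s,p}_0(\Omega)$ is the subspace of functions in $W^{s,p}(\mathbb{R}^N)$ vanishing (a.e.) outside $\Omega$. $u_0$ is regarded also as a time-independent function. Variational solution (of the formal problem $\partial_t u+\mathrm{P.V.}\int_{\mathbb{R}^N}\frac{D_\xi H(x,y,u(x,t)-u(y,t))}{|x-y|^N}\,dy=0$ in $\Omega\times(0,\infty)$, $u=u_0$ on $((\mathbb{R}^N\setminus\Omega)\times(0,\infty))\cup(\Omega\times\{0\})$): a function $u:\mathbb{R}^N\times(0,\infty)\to\mathbb{R}$ such that for every $T>0$: $u\in L^p(0,T;W^{s,p}(\mathbb{R}^N))\cap C([0,T];L^2(\Omega))$, $u-u_0\in L^p(0,T;W^{s,p}_0(\Omega))$, and for every comparison function $v\in L^p(0,T;W^{s,p}(\mathbb{R}^N))$ with $\partial_t v\in L^2(\Omega\times(0,T))$, $v-u_0\in L^p(0,T;W_0^{s,p}(\Omega))$ (and $v(\cdot,0)\in L^2(\Omega)$, so that all terms are meaningful), $$\int_0^T\iint_{\mathbb{R}^N\times\mathbb{R}^N}\frac{H(x,y,u(x,t)-u(y,t))}{|x-y|^N}\,dx\,dy\,dt\le\int_0^T\iint_{\mathbb{R}^N\times\mathbb{R}^N}\frac{H(x,y,v(x,t)-v(y,t))}{|x-y|^N}\,dx\,dy\,dt$$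 $$+\int_0^T\int_\Omega\partial_t v\,(v-u)\,dx\,dt+\tfrac12\|v(\cdot,0)-u_0\|_{L^2(\Omega)}^2-\tfrac12\|v(\cdot,T)-u(\cdot,T)\|_{L^2(\Omega)}^2,$$ where the integrals of the nonnegative function $H$ are taken in $[0,\infty]$. *)

(* Defs.v *)
From HB Require Import structures.
From mathcomp Require Import all_boot all_order all_algebra.
From mathcomp Require Import all_classical all_reals all_analysis.

Set Implicit Arguments.
Unset Strict Implicit.
Unset Printing Implicit Defensive.
Import Order.TTheory GRing.Theory Num.Theory.
Import numFieldNormedType.Exports.

Local Open Scope classical_set_scope.
Local Open Scope ring_scope.

Definition rV_display : measure_display.
Proof. exact: default_measure_display. Qed.

Section rV_measurable.
Context {R : realType} {n : nat}.

Definition rV_coord (i : 'I_n) (v : 'rV[R]_n) : measurableTypeR R := v ord0 i.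

Let rV_set0 : g_sigma_preimage rV_coord set0.
Proof. exact: sigma_algebra0. Qed.

Let rV_setC A : g_sigma_preimage rV_coord A -> g_sigma_preimage rV_coord (~` A).
Proof. exact: sigma_algebraC. Qed.

Let rV_bigcup (F : _^nat) : (forall i, g_sigma_preimage rV_coord (F i)) ->
  g_sigma_preimage rV_coord (\bigcup_i (F i)).
Proof. exact: sigma_algebra_bigcup. Qed.

(* The product of the Borel sigma-algebras of the coordinates. *)
HB.instance Definition _ := @isMeasurable.Build rV_display
  'rV[R]_n (g_sigma_preimage rV_coord) rV_set0 rV_setC rV_bigcup.

Lemma measurable_rV_coord (i : 'I_n) : measurable_fun [set: 'rV[R]_n] (rV_coord i).
Proof.
move=> _ Y mY; rewrite setTI; apply: sub_sigma_algebra => /=.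
rewrite -bigcup_seq/=; exists i => /=; first by rewrite mem_index_enum.
by exists Y => //; rewrite setTI.
Qed.

Lemma measurable_fun_rVP d (T : measurableType d) (f : T -> 'rV[R]_n) :
  (forall i, measurable_fun [set: T] (rV_coord i \o f)) ->
  measurable_fun [set: T] f.
Proof.
move=> mf.
have H : g_sigma_preimage (fun i => rV_coord i \o f) `<=` measurable.
  apply: smallest_sub; first exact: sigma_algebra_measurable.
  rewrite -bigcup_seq => A [i _ [B mB <-]].
  exact: mf.
move=> _ A mA; apply: H; rewrite g_sigma_preimage_comp; by exists A.
Qed.

End rV_measurable.

Section lebesgue_rV.
Context {R : realType}.

Definition rV_cons n (z : measurableTypeR R * 'rV[R]_n) : 'rV[R]_n.+1 :=
  \row_i (if unlift ord0 i is Some j then z.2 ord0 j else z.1).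

Definition rV_uncons n (v : 'rV[R]_n.+1) : measurableTypeR R * 'rV[R]_n :=
  (v ord0 ord0, \row_j v ord0 (lift ord0 j)).

Lemma rV_consK n : cancel (@rV_cons n) (@rV_uncons n).
Proof.
move=> [a v]; rewrite /rV_uncons /rV_cons mxE unlift_none/=; congr pair.
by apply/rowP => j; rewrite !mxE liftK.
Qed.

Lemma measurable_rV_cons n : measurable_fun [set: _] (@rV_cons n).
Proof.
apply: measurable_fun_rVP => i.
rewrite (_ : _ \o _ = fun z : measurableTypeR R * 'rV[R]_n =>
  if unlift ord0 i is Some j then rV_coord j z.2 else z.1); last first.
  by apply/funext => z; rewrite /rV_coord/= mxE.
case: unliftP => [j _|_]; last exact: measurable_fst.
by apply: measurableT_comp; [exact: measurable_rV_coord|exact: measurable_snd].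
Qed.

Lemma measurable_rV_uncons n : measurable_fun [set: _] (@rV_uncons n).
Proof.
apply/measurable_fun_pair; first exact: (measurable_rV_coord ord0).
apply: measurable_fun_rVP => i.
rewrite (_ : _ \o _ = rV_coord (lift ord0 i)); first exact: measurable_rV_coord.
by apply/funext => z; rewrite /rV_coord/= mxE.
Qed.

Section succ.
Context {n : nat}.
Variable m : {sigma_finite_measure set 'rV[R]_n -> \bar R}.

Definition lebesgue_rVS : set 'rV[R]_n.+1 -> \bar R :=
  pushforward (@lebesgue_measure R \x m)%E (@rV_cons n).

Let measurable_pre A : measurable A -> measurable (@rV_cons n @^-1` A).
Proof.
by move=> mA; rewrite -[X in measurable X]setTI; exact: measurable_rV_cons.
Qed.

Let lebesgue_rVS0 : lebesgue_rVS set0 = 0%E.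
Proof. by rewrite /lebesgue_rVS /pushforward preimage_set0 measure0. Qed.

Let lebesgue_rVS_ge0 A : (0 <= lebesgue_rVS A)%E.
Proof. by rewrite /lebesgue_rVS /pushforward measure_ge0. Qed.

Let lebesgue_rVS_sigma_additive : semi_sigma_additive lebesgue_rVS.
Proof.
move=> F mF tF mUF; rewrite /lebesgue_rVS /pushforward preimage_bigcup.
apply: measure_semi_sigma_additive.
- by move=> k; exact: measurable_pre.
- apply/trivIsetP => /= i j _ _ ij; rewrite -preimage_setI.
  by move/trivIsetP : tF => /(_ _ _ _ _ ij) ->//; rewrite preimage_set0.
- by rewrite -preimage_bigcup; exact: measurable_pre.
Qed.

HB.instance Definition _ := isMeasure.Build _ _ _ lebesgue_rVS
  lebesgue_rVS0 lebesgue_rVS_ge0 lebesgue_rVS_sigma_additive.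

Let lebesgue_rVS_sigma_finite : sigma_finite setT lebesgue_rVS.
Proof.
have /sigma_finiteP[F [TF ndF Foo]] := sigma_finiteT (@lebesgue_measure R).
have /sigma_finiteP[G [TG ndG Goo]] := sigma_finiteT m.
exists (fun k => @rV_uncons n @^-1` (F k `*` G k)).
  rewrite -preimage_bigcup (_ : \bigcup_i _ = setT) ?preimage_setT//.
  apply/seteqP; split=> // -[x y] _.
  have [i _ Fx] : (\bigcup_i F i) x by rewrite -TF.
  have [j _ Gy] : (\bigcup_i G i) y by rewrite -TG.
  exists (maxn i j) => //; split.
  - by move: x Fx; exact/subsetPset/ndF/leq_maxl.
  - by move: y Gy; exact/subsetPset/ndG/leq_maxr.
move=> k; have [mF Fk] := Foo k; have [mG Gk] := Goo k; split.
  rewrite -[X in measurable X]setTI; apply: measurable_rV_uncons => //.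
  exact: measurableX.
rewrite /lebesgue_rVS /pushforward -comp_preimage.
rewrite (_ : _ \o _ = id) ?preimage_id; last by apply/funext; exact: rV_consK.
by rewrite product_measure1E// lte_mul_pinfty// ge0_fin_numE.
Qed.

HB.instance Definition _ := Measure_isSigmaFinite.Build _ _ _ lebesgue_rVS
  lebesgue_rVS_sigma_finite.

End succ.

(* Lebesgue measure on R^n, as the n-fold product of the one on R. *)
Fixpoint lebesgue_rV n : {sigma_finite_measure set 'rV[R]_n -> \bar R} :=
  if n is k.+1 then lebesgue_rVS (lebesgue_rV k) else \d_(0 : 'rV[R]_0).

Lemma lebesgue_rV_box n (A : 'I_n -> set (measurableTypeR R)) :
  (forall i, measurable (A i)) ->
  lebesgue_rV n [set v | forall i, A i (v ord0 i)] =
  (\prod_(i < n) lebesgue_measure (A i))%E.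
Proof.
elim: n A => [|n IHn] A mA.
  by rewrite big_ord0 /= diracE mem_set// => -[].
rewrite big_ord_recl /= /lebesgue_rVS /pushforward.
rewrite (_ : _ @^-1` _ = A ord0 `*`
    [set v : 'rV[R]_n | forall i, A (lift ord0 i) (v ord0 i)]); last first.
  apply/seteqP; split=> -[a v] /=.
    move=> Av; split=> [|i].
      by move: (Av ord0); rewrite mxE unlift_none.
    by move: (Av (lift ord0 i)); rewrite mxE liftK.
  by move=> [Aa Av] i; rewrite mxE; case: unliftP => [j ->|->].
rewrite product_measure1E//=; first by rewrite -IHn.
rewrite (_ : [set _ | _] = \bigcap_(i in [set: 'I_n])
   (rV_coord i @^-1` A (lift ord0 i))); last first.
  by apply/seteqP; split=> v Av i; [move=> _; exact: Av|exact: (Av i I)].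
apply: fin_bigcap_measurable => // i _.
by rewrite -[X in measurable X]setTI; exact: measurable_rV_coord.
Qed.

End lebesgue_rV.

Arguments lebesgue_rV {R} n.

(* Measurability with respect to the completion of mu. *)
Definition ae_measurable d (T : measurableType d) (R : realType)
    (mu : {measure set T -> \bar R}) (D : set T) (f : T -> R) : Prop :=
  exists2 g : T -> R, measurable_fun D g & f = g %[ae mu in D].

Definition sqnormL2 d (T : measurableType d) (R : realType)
    (mu : {measure set T -> \bar R}) (D : set T) (f : T -> R) : \bar R :=
  (\int[mu]_(x in D) (f x ^+ 2)%:E)%E.

Definition L2 d (T : measurableType d) (R : realType)
    (mu : {measure set T -> \bar R}) (D : set T) : set (T -> R) :=
  [set f | ae_measurable mu D f /\ (sqnormL2 mu D f < +oo)%E].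

Definition strictly_convex (R : realType) (f : R -> R) : Prop :=
  forall a b t : R, a != b -> 0 < t -> t < 1 ->
    f (t * a + (1 - t) * b) < t * f a + (1 - t) * f b.

(* C^infty, expressed through iterated derivatives in arbitrary directions. *)
Definition smooth (R : realType) (V : normedModType R) (f : V -> R) : Prop :=
  forall vs : seq V, let D := foldr (fun v g => 'D_v g) f vs in
    continuous D /\ forall x v, derivable D x v.

Section fractional_sobolev.
Context {R : realType} {N : nat}.
Implicit Types (s p T : R) (Omega : set 'rV[R]_N) (psi : 'rV[R]_N -> R).

(* The library's norm on 'rV[R]_N is the sup norm. *)
Definition enorm (x : 'rV[R]_N) : R := Num.sqrt (\sum_i x ord0 i ^+ 2).

(* On the diagonal, which is a null set, x / 0 = 0 makes the integrand 0. *)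
Definition Wsp_seminorm s p psi : \bar R :=
  ((\int[lebesgue_rV N \x lebesgue_rV N]_z
     (`|psi z.1 - psi z.2| `^ p / enorm (z.1 - z.2) `^ (N%:R + p * s))%:E)
   `^ p^-1)%E.

Definition Wsp_norm s p psi : \bar R :=
  ('N[lebesgue_rV N]_p%:E[EFin \o psi] + Wsp_seminorm s p psi)%E.

Definition Wsp s p : set ('rV[R]_N -> R) :=
  [set psi | [/\ ae_measurable (lebesgue_rV N) setT psi,
                 ('N[lebesgue_rV N]_p%:E[EFin \o psi] < +oo)%E &
                 (Wsp_seminorm s p psi < +oo)%E]].

Definition Wsp0 s p Omega : set ('rV[R]_N -> R) :=
  [set psi | Wsp s p psi /\
     {ae lebesgue_rV N, forall x, ~ Omega x -> psi x = 0}].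

Definition simple_in (X : set ('rV[R]_N -> R)) (f : 'rV[R]_N -> R -> R) : Prop :=
  exists (n : nat) (A : 'I_n -> set (measurableTypeR R))
         (psi : 'I_n -> 'rV[R]_N -> R),
    (forall i, measurable (A i) /\ X (psi i)) /\
    (forall x t, f x t = \sum_(i < n) \1_(A i) t * psi i x).

(* The Bochner space L^p(0,T;X), for a subspace X of W^{s,p}(R^N): strong
   measurability is the almost everywhere approximation by X-valued simple
   functions. Elements are given as jointly measurable functions of (x, t). *)
Definition LpX s p T (X : set ('rV[R]_N -> R)) (f : 'rV[R]_N -> R -> R) : Prop :=
  [/\ ae_measurable (lebesgue_rV N \x @lebesgue_measure R)%E
        (setT `*` `]0, T[) (fun z => f z.1 z.2),
      {ae @lebesgue_measure R, forall t, t \in `]0, T[ -> X (f^~ t)},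
      exists2 F : nat -> 'rV[R]_N -> R -> R, forall k, simple_in X (F k) &
        {ae @lebesgue_measure R, forall t, t \in `]0, T[ ->
          Wsp_norm s p (fun x => F k x t - f x t) @[k --> \oo] --> 0%E} &
      (\int[@lebesgue_measure R]_(t in `]0%R, T[) (Wsp_norm s p (f^~ t) `^ p)
         < +oo)%E].

Definition continuousL2 Omega T (w : R -> 'rV[R]_N -> R) : Prop :=
  (forall t, t \in `[0, T] -> L2 (lebesgue_rV N) Omega (w t)) /\
  (forall t0, t0 \in `[0, T] ->
    sqnormL2 (lebesgue_rV N) Omega (fun x => w t x - w t0 x)
      @[t --> within `[0, T] (nbhs t0)] --> 0%E).

(* f is only determined almost everywhere, so that its traces f(.,0) and f(.,T)
   are those of its representative w in C([0,T];L^2(Omega)), which is unique.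
   For v in L^p(0,T;W^{s,p}) with time derivative in L^2(Omega x (0,T)), such a
   w exists exactly when the initial trace of v is in L^2(Omega). *)
Definition continuous_repr Omega T (f : 'rV[R]_N -> R -> R)
    (w : R -> 'rV[R]_N -> R) : Prop :=
  continuousL2 Omega T w /\
  {ae @lebesgue_measure R, forall t, t \in `]0, T[ ->
    {ae lebesgue_rV N, forall x, Omega x -> w t x = f x t}}.

Definition test_function Omega T (phi : 'rV[R]_N * R -> R) : Prop :=
  smooth phi /\
  exists K : set ('rV[R]_N * R),
    [/\ compact K, K `<=` Omega `*` `]0, T[ & forall z, ~ K z -> phi z = 0].

Definition weak_time_derivative Omega T (v g : 'rV[R]_N -> R -> R) : Prop :=
  forall phi, test_function Omega T phi ->
    (\int[lebesgue_rV N \x @lebesgue_measure R]_(z in Omega `*` `]0%R, T[)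
       (v z.1 z.2 * 'D_(0, 1) phi z)%:E =
     - \int[lebesgue_rV N \x @lebesgue_measure R]_(z in Omega `*` `]0%R, T[)
         (g z.1 z.2 * phi z)%:E)%E.

Definition energy (H : 'rV[R]_N -> 'rV[R]_N -> R -> R) psi : \bar R :=
  (\int[lebesgue_rV N \x lebesgue_rV N]_z
     (H z.1 z.2 (psi z.1 - psi z.2) / enorm (z.1 - z.2) ^+ N)%:E)%E.

Definition comparison_function s p Omega T (u0 : 'rV[R]_N -> R)
    (v g : 'rV[R]_N -> R -> R) (w : R -> 'rV[R]_N -> R) : Prop :=
  [/\ LpX s p T (Wsp s p) v,
      LpX s p T (Wsp0 s p Omega) (fun x t => v x t - u0 x),
      weak_time_derivative Omega T v g,
      L2 (lebesgue_rV N \x @lebesgue_measure R)%E (Omega `*` `]0, T[)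
        (fun z => g z.1 z.2) &
      continuous_repr Omega T v w].

Definition variational_solution s p Omega
    (H : 'rV[R]_N -> 'rV[R]_N -> R -> R) (u0 : 'rV[R]_N -> R)
    (u : 'rV[R]_N -> R -> R) : Prop :=
  forall T, 0 < T ->
  [/\ LpX s p T (Wsp s p) u,
      LpX s p T (Wsp0 s p Omega) (fun x t => u x t - u0 x) &
      exists2 wu, continuous_repr Omega T u wu &
      forall v dtv wv, comparison_function s p Omega T u0 v dtv wv ->
      (\int[@lebesgue_measure R]_(t in `]0%R, T[) energy H (u^~ t) <=
       \int[@lebesgue_measure R]_(t in `]0%R, T[) energy H (v^~ t)
       + \int[lebesgue_rV N \x @lebesgue_measure R]_(z in Omega `*` `]0%R, T[)
           (dtv z.1 z.2 * (v z.1 z.2 - u z.1 z.2))%:E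
       + 2^-1%:E * sqnormL2 (lebesgue_rV N) Omega (fun x => wv 0%R x - u0 x)%R
       - 2^-1%:E * sqnormL2 (lebesgue_rV N) Omega (fun x => wv T x - wu T x)%R)%E].

End fractional_sobolev.

(* Main.v *)
Require Import Defs.
From mathcomp Require Import all_boot all_order all_algebra.
From mathcomp Require Import all_classical all_reals all_analysis.
From mathcomp Require Import measurable_realfun lebesgue_integral_fubini.
From mathcomp Require Import ring lra.

(** Let u1 and u2 be two solutions, and let w = (u1 + u2) / 2. If w could be
    used as the comparison function for both, the two inequalities would add up
    to I(u1) + I(u2) <= 2 I(w), where I(v) is the energy of v integrated over
    ]0, T[: the two time terms cancel, because (w - u1) + (w - u2) = 0, the
    initial term vanishes and the final terms are nonpositive. By convexity this
    is an equality, and by strict convexity the differences u1(x) - u1(y) and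
    u2(x) - u2(y) agree almost everywhere for almost every time. Then u1 - u2
    does not depend on x; it vanishes outside the bounded set Omega, so it is 0
    ([regular_representatives_eq]).

    However, w need not have a time derivative in L^2, so it is approximated.
    Mollifying in time would call for some control of the energy along the
    mollification near time 0. Instead, ]0, T[ is cut into n slabs of length
    tau, and the comparison function is the piecewise linear interpolant in time
    of nodes V_0, ..., V_n, where V_0 = u0 and V_(i+1) = w(t_i) for a time t_i
    chosen in the i-th slab. By convexity the energy of the interpolant is at
    most the trapezoidal sum of the energies of the nodes
    ([interpolant_energy_le]), and its time term only involves the nodes and
    the averages Phi_i of w over the slabs ([integral_interpolant_dt]). Let
    Phi_n be the final trace of w. A function is somewhere at most its average,
    so t_i can be chosen with
      <V_(i+1), Phi_(i+1) - Phi_i> + tau E(V_(i+1))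
        <= <Phi_i, Phi_(i+1) - Phi_i> + (integral of E(w) over the i-th slab)
    ([good_sample_exists]). This one choice controls the energy and the time
    term together: summation by parts ([telescoping_energy_estimate]) turns
    these inequalities into
      I(u1) + I(u2) <= 2 I(w) + tau E(u0),
    and tau tends to 0 ([midpoint_energy_ge]).

    The rest makes these computations legitimate. The integrand H is
    measurable up to null sets only, for each value of its last argument; it is
    replaced by a jointly measurable density ([energy_density_of]). The
    solutions are replaced by Borel representatives
    ([regular_representative_exists]). The interpolants are combinations of
    ramps in time, for which strong measurability in W^{s,p} and the weak time
    derivative are computed by hand ([bounded_path_ramp],
    [time_regular_ramp]). *)

Set Implicit Arguments.
Unset Strict Implicit.
Unset Printing Implicit Defensive.
Import Order.TTheory GRing.Theory Num.Theory.
Import numFieldNormedType.Exports.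
Local Open Scope classical_set_scope.
Local Open Scope ring_scope.

(** * Integrals and null sets *)

Section measure_generalities.
Context d (T : measurableType d) (R : realType).
Variable mu : {measure set T -> \bar R}.
Local Open Scope ereal_scope.

Import HBNNSimple.

(** The integral of a nonnegative function is the supremum over the simple
    functions below it, whether or not it is measurable. This matters because
    the energy of a solution need not be a measurable function of time, nor its
    integrand a measurable function of (x, y). *)
Lemma le_integral_nonmeasurable (D : set T) (f g : T -> \bar R) :
  (forall x, D x -> 0 <= f x) -> (forall x, D x -> f x <= g x) ->
  \int[mu]_(x in D) f x <= \int[mu]_(x in D) g x.
Proof.
move=> f0 fg.
have g0 x : D x -> 0 <= g x by move=> Dx; exact: le_trans (f0 _ Dx) (fg _ Dx).
rewrite (integral_mkcond D f) (integral_mkcond D g).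
rewrite !ge0_integralTE; last 2 first.
- by apply: erestrict_ge0.
- by apply: erestrict_ge0.
apply: le_ereal_sup => _ [h /= hf <-]; exists h => //= x.
apply: (le_trans (hf x)); rewrite !patchE; case: ifPn => // xD.
by apply: fg; exact/set_mem.
Qed.

(** A simple function below f becomes one below g, with the same integral, when
    it is set to 0 on the exceptional null set. *)
Let ge0_le_ae_integral (f g : T -> \bar R) :
  (forall x, 0 <= f x) -> (forall x, 0 <= g x) ->
  (\forall x \ae mu, f x = g x) -> \int[mu]_x f x <= \int[mu]_x g x.
Proof.
move=> f0 g0 [M [mM M0 sM]].
rewrite !ge0_integralTE//; apply: ge_ereal_sup => _ [h /= hf <-].
have mMC : measurable (~` M) by exact: measurableC.
pose h' : {nnsfun T >-> R} := mul_nnsfun h (indic_nnsfun R mMC).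
have -> : sintegral mu h = sintegral mu h'.
  rewrite -!integralT_nnsfun; apply: ge0_ae_eq_integral => //.
  - exact/measurable_EFinP.
  - exact/measurable_EFinP.
  - by move=> x _; rewrite lee_fin.
  - by move=> x _; rewrite lee_fin.
  exists M; split => // x /= xM; apply: contrapT => Mx; apply: xM => _.
  by rewrite /= /mindic indicE mem_set//= mulr1.
apply: ereal_sup_ubound; exists h' => //= x.
rewrite /mindic indicE; have [xM|xM] := boolP (x \in ~` M).
  rewrite mulr1; have <- : f x = g x; last exact: hf.
  by apply: contrapT => fgx; move/set_mem : xM; apply; exact: sM.
by rewrite mulr0.
Qed.

Lemma ae_eq_integral_nonmeasurable (D : set T) (f g : T -> \bar R) :
  (\forall x \ae mu, D x -> f x = g x) ->
  \int[mu]_(x in D) f x = \int[mu]_(x in D) g x.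
Proof.
move=> fg.
have H (f1 g1 : T -> \bar R) : (forall x, 0 <= f1 x) -> (forall x, 0 <= g1 x) ->
  (\forall x \ae mu, D x -> f1 x = g1 x) ->
  \int[mu]_(x in D) f1 x = \int[mu]_(x in D) g1 x.
  move=> f0 g0 E; rewrite [LHS]integral_mkcond [RHS]integral_mkcond.
  apply/eqP; rewrite eq_le; apply/andP; split; apply: ge0_le_ae_integral.
  - exact: erestrict_ge0.
  - exact: erestrict_ge0.
  - by apply: filterS E => x Ex; rewrite !patchE; case: ifPn => // /set_mem /Ex.
  - exact: erestrict_ge0.
  - exact: erestrict_ge0.
  - by apply: filterS E => x Ex; rewrite !patchE; case: ifPn => // /set_mem /Ex.
rewrite [LHS]integralE [RHS]integralE; congr (_ - _); apply: H => //.
- by apply: filterS fg => x E Dx; rewrite !funeposE E.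
- by apply: filterS fg => x E Dx; rewrite !funenegE E.
Qed.

Lemma ae_le_integral_nonmeasurable (D : set T) (f g : T -> \bar R) :
  (forall x, D x -> 0 <= f x) -> (forall x, D x -> 0 <= g x) ->
  (\forall x \ae mu, D x -> f x <= g x) ->
  \int[mu]_(x in D) f x <= \int[mu]_(x in D) g x.
Proof.
move=> f0 g0 fg.
rewrite (@ae_eq_integral_nonmeasurable D f (fun x => mine (f x) (g x))); last first.
  by apply: filterS fg => x h Dx; rewrite min_l// h.
apply: le_integral_nonmeasurable => x Dx; last by rewrite ge_min lexx orbT.
by rewrite le_min f0// g0.
Qed.

Lemma ae_eq0_integral (D : set T) (f : T -> \bar R) :
  measurable D -> measurable_fun D f -> (forall x, D x -> 0 <= f x) ->
  \int[mu]_(x in D) f x = 0 -> \forall x \ae mu, D x -> f x = 0.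
Proof.
move=> mD mf f0 if0; apply/ae_eq_integral_abs => //.
by rewrite -[RHS]if0; apply: eq_integral => x /set_mem Dx; rewrite gee0_abs// f0.
Qed.

Lemma integrable_ae_lty (D : set T) (f : T -> \bar R) :
  measurable D -> measurable_fun D f -> (forall x, D x -> 0 <= f x) ->
  \int[mu]_(x in D) f x < +oo -> \forall x \ae mu, D x -> f x < +oo.
Proof.
move=> mD mf f0 foo.
have fi : mu.-integrable D f.
  apply/integrableP; split => //; apply: le_lt_trans foo.
  rewrite le_eqVlt; apply/orP; left; apply/eqP.
  by apply: eq_integral => x /set_mem Dx; rewrite gee0_abs// f0.
have := integrable_ae mD fi; apply: filterS => x fx Dx.
by have := fx Dx; rewrite fin_numElt => /andP[].
Qed.

Lemma ae_exists (D : set T) (P : T -> Prop) :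
  measurable D -> 0 < mu D -> (\forall x \ae mu, D x -> P x) ->
  exists2 x, D x & P x.
Proof.
move=> mD D0 [M [mM M0 sM]]; apply: contrapT => /forall2NP H.
have : mu D <= mu M.
  apply: le_measure; rewrite ?inE// => x Dx; apply: sM => /= DP.
  by have [//|] := H x; apply; exact: DP.
by rewrite M0 leNgt D0.
Qed.

(** Mean value principle: f cannot exceed almost everywhere a constant that is
    at least its average. *)
Lemma ae_ereal_le_exists (D : set T) (f : T -> \bar R) (c : R) (P : T -> Prop) :
  measurable D -> 0 < mu D -> mu D < +oo -> mu.-integrable D f ->
  \int[mu]_(x in D) f x <= c%:E * mu D ->
  (\forall x \ae mu, D x -> P x) ->
  exists x, [/\ D x, P x & f x <= c%:E].
Proof.
move=> mD D0 Doo fi fc aeP; apply: contrapT => H.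
have mf := measurable_int _ fi.
have gt : \forall x \ae mu, D x -> c%:E < f x.
  apply: filterS aeP => x DP Dx; rewrite ltNge; apply/negP => fxc.
  by apply: H; exists x; split => //; exact: DP.
have mc : measurable_fun D (fun=> c%:E) by exact: measurable_cst.
have ic : mu.-integrable D (fun=> c%:E).
  apply/integrableP; split => //=.
  by rewrite integral_cst//= lte_mul_pinfty// ?lee_fin.
pose g x := f x - c%:E.
have mg : measurable_fun D g by exact: emeasurable_funB.
(* h is a version of g that is nonnegative everywhere. *)
pose h x := maxe (g x) 0.
have mh : measurable_fun D h by exact: measurable_maxe.
have gh : \forall x \ae mu, D x -> g x = h x.
  apply: filterS gt => x cf Dx; rewrite /h /g /maxe.
  by rewrite ltNge sube_ge0// (ltW (cf Dx)).
have ig0 : \int[mu]_(x in D) g x <= 0.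
  by rewrite integralB// integral_cst// sube_le0.
have ih0 : \int[mu]_(x in D) h x = 0.
  rewrite -(ae_eq_integral_nonmeasurable gh); apply/eqP; rewrite eq_le ig0/=.
  rewrite (ae_eq_integral_nonmeasurable gh); apply: integral_ge0 => x _.
  by rewrite /h le_max lexx orbT.
have /ae_eq0_integral : \int[mu]_(x in D) h x = 0 by [].
move=> /(_ mD mh) h0.
have {}h0 : \forall x \ae mu, D x -> h x = 0.
  by apply: h0 => x _; rewrite /h le_max lexx orbT.
have [x Dx [/(_ Dx) E1 [/(_ Dx) E2 /(_ Dx) E3]]] : exists2 x, D x &
   (D x -> h x = 0) /\ (D x -> g x = h x) /\ (D x -> c%:E < f x).
  apply: ae_exists => //.
  by apply: filterS3 h0 gh gt => x ? ? ? _; split.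
by move: E3; rewrite -sube_gt0 -/(g x) E2 E1 ltxx.
Qed.

End measure_generalities.

(** The difference g - f is nonnegative with integral 0; finiteness of the
    integrals excludes that both functions are infinite on a non-null set. *)
Lemma ae_eq_of_integral_le d (T : measurableType d) (R : realType)
    (mu : {measure set T -> \bar R}) (D : set T) (f g : T -> \bar R) : measurable D ->
  measurable_fun D f -> measurable_fun D g -> (forall x, D x -> 0 <= f x)%E ->
  (forall x, D x -> f x <= g x)%E -> (\int[mu]_(x in D) g x < +oo)%E ->
  (\int[mu]_(x in D) g x <= \int[mu]_(x in D) f x)%E ->
  \forall x \ae mu, D x -> f x = g x.
Proof.
move=> mD mf mg f0 fg goo gf.
have g0 x : D x -> (0 <= g x)%E by move=> Dx; apply: le_trans (f0 x Dx) (fg x Dx).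
have ig : mu.-integrable D g.
  apply/integrableP; split => //.
  by under eq_integral => x /set_mem Dx do rewrite gee0_abs ?g0//.
have if_ : mu.-integrable D f.
  by apply: le_integrable ig => // x Dx; rewrite !gee0_abs ?f0 ?g0// fg.
have ae0 : \forall x \ae mu, D x -> f x \is a fin_num /\ g x \is a fin_num.
  by apply: filterS2 (integrable_ae mD if_) (integrable_ae mD ig) => x h1 h2 Dx; split; [exact: h1|exact: h2].
have h0 : (\int[mu]_(x in D) `|g x - f x| = 0)%E.
  have -> : (\int[mu]_(x in D) `|g x - f x| = \int[mu]_(x in D) (g x - f x))%E.
    apply: ae_eq_integral_nonmeasurable; apply: filterS ae0 => x h Dx.
    by rewrite gee0_abs// suber_ge0 ?fg// (h Dx).1.
  apply/eqP; rewrite eq_le integralB//; apply/andP; split.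
    by rewrite leeBlDr ?add0e// integrable_fin_num.
  rewrite suber_ge0 ?integrable_fin_num//; exact: le_integral_nonmeasurable.
have h := (ae_eq_integral_abs mu mD (emeasurable_funB mg mf)).1 h0.
apply: filterS2 ae0 h => x h1 h2 Dx; have [ff gf'] := h1 Dx.
have := h2 Dx; rewrite -(fineK ff) -(fineK gf') -EFinB.
by move=> /= [] /eqP; rewrite subr_eq0 => /eqP ->.
Qed.

Section product_generalities.
Context d1 d2 (T1 : measurableType d1) (T2 : measurableType d2) (R : realType).
Variable m1 : {sigma_finite_measure set T1 -> \bar R}.
Variable m2 : {sigma_finite_measure set T2 -> \bar R}.
Local Open Scope ereal_scope.

Lemma ae_prod_section2 (P : T1 * T2 -> Prop) :
  {ae (m1 \x m2), forall z, P z} -> {ae m2, forall y, {ae m1, forall x, P (x, y)}}.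
Proof.
move=> [M [mM M0 sM]].
have E : \int[m2]_y m1 (ysection M y) = 0.
  rewrite -[RHS]M0 (@product_measure_unique _ _ _ _ _ m1 m2 (m1 \x^ m2)%E)//.
  by move=> A B mA mB; exact: product_measure2E.
have := ae_eq0_integral measurableT _ _ E.
move=> /(_ (measurable_fun_ysection m1 mM)) H.
have {}H : \forall y \ae m2, setT y -> m1 (ysection M y) = 0.
  by apply: H => y _; exact: measure_ge0.
apply: filterS H => y /(_ I) My; exists (ysection M y); split => //.
  exact: measurable_ysection.
by move=> x /= nP; rewrite /ysection/= inE; exact: sM.
Qed.

(** Measurability of M is what allows its measure to be computed by slices; it
    cannot be read off the slices. *)
Lemma measurable_prod_null (M : set (T1 * T2)) : measurable M ->
  (\forall y \ae m2, m1 (ysection M y) = 0) -> (m1 \x m2) M = 0.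
Proof.
move=> mM H.
have -> : (m1 \x m2) M = (m1 \x^ m2) M.
  by apply: product_measure_unique => // A B mA mB; exact: product_measure2E.
rewrite /product_measure2/= -[RHS](integral0 m2 setT).
by apply: ae_eq_integral_nonmeasurable; apply: filterS H => y Hy _.
Qed.

Lemma ae_prod_fst (P : T1 -> Prop) :
  {ae m1, forall x, P x} -> {ae (m1 \x m2), forall z, P z.1}.
Proof.
move=> [M [mM M0 sM]]; exists (M `*` setT); split.
- exact: measurableX.
- rewrite [LHS](product_measure1E m1 m2 mM (@measurableT _ T2)).
  by transitivity (0 * m2 setT); [congr (_ * _)|rewrite mul0e].
- by move=> [x y]/= nP; split => //; exact: sM.
Qed.

Lemma ae_prod_snd (P : T2 -> Prop) :
  {ae m2, forall x, P x} -> {ae (m1 \x m2), forall z, P z.2}.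
Proof.
move=> [M [mM M0 sM]]; exists (setT `*` M); split.
- exact: measurableX.
- rewrite [LHS](product_measure1E m1 m2 (@measurableT _ T1) mM).
  by transitivity (m1 setT * 0); [congr (_ * _)|rewrite mule0].
- by move=> [x y]/= nP; split => //; exact: sM.
Qed.

Lemma patch_setX (A : set T1) (B : set T2) (f : T1 * T2 -> \bar R) x y :
  (f \_ (A `*` B)) (x, y) = ((fun y => f (x, y)) \_ B) y * (\1_A x)%:E.
Proof.
rewrite !patchE indicE in_setX/=; case: (x \in A); case: (y \in B) => /=;
  by rewrite ?mule1 ?mule0 ?mul0e.
Qed.

(** The following lemmas transfer the Fubini and Tonelli theorems from the whole
    product space to rectangles, by extending functions by 0. *)
Lemma tonelli_setX1 (A : set T1) (B : set T2) (f : T1 * T2 -> \bar R) :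
  measurable A -> measurable B ->
  measurable_fun (A `*` B) f -> (forall z, (A `*` B) z -> 0 <= f z) ->
  \int[m1 \x m2]_(z in A `*` B) f z =
  \int[m1]_(x in A) \int[m2]_(y in B) f (x, y).
Proof.
move=> mA mB mf f0; rewrite integral_mkcond fubini_tonelli1; last 2 first.
- by apply/(measurable_restrictT _ _).1 => //; exact: measurableX.
- exact: erestrict_ge0.
rewrite [RHS]integral_mkcond; apply: eq_integral => x _.
rewrite /fubini_F patchE; case: ifPn => xA.
  rewrite [RHS]integral_mkcond; apply: eq_integral => y _.
  by rewrite patch_setX indicE xA mule1.
rewrite -[RHS](integral0 m2 setT); apply: eq_integral => y _.
by rewrite patch_setX indicE (negbTE xA) mule0.
Qed.

Lemma tonelli_setX2 (A : set T1) (B : set T2) (f : T1 * T2 -> \bar R) :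
  measurable A -> measurable B ->
  measurable_fun (A `*` B) f -> (forall z, (A `*` B) z -> 0 <= f z) ->
  \int[m1 \x m2]_(z in A `*` B) f z =
  \int[m2]_(y in B) \int[m1]_(x in A) f (x, y).
Proof.
move=> mA mB mf f0; rewrite integral_mkcond fubini_tonelli2; last 2 first.
- by apply/(measurable_restrictT _ _).1 => //; exact: measurableX.
- exact: erestrict_ge0.
rewrite [RHS]integral_mkcond; apply: eq_integral => y _.
rewrite /fubini_G patchE; case: ifPn => yB.
  rewrite [RHS]integral_mkcond; apply: eq_integral => x _.
  by rewrite !patchE in_setX/= yB andbT.
rewrite -[RHS](integral0 m1 setT); apply: eq_integral => x _.
by rewrite patchE in_setX/= (negbTE yB) andbF.
Qed.

Lemma fubini_setX1 (A : set T1) (B : set T2) (f : T1 * T2 -> \bar R) :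
  measurable A -> measurable B -> (m1 \x m2).-integrable (A `*` B) f ->
  \int[m1 \x m2]_(z in A `*` B) f z =
  \int[m1]_(x in A) \int[m2]_(y in B) f (x, y).
Proof.
move=> mA mB fi; rewrite integral_mkcond -integral12_prod_meas1; last first.
  by apply/(integrable_mkcond _ _).1 => //; exact: measurableX.
rewrite [RHS]integral_mkcond; apply: eq_integral => x _.
rewrite /fubini_F patchE; case: ifPn => xA.
  rewrite [RHS]integral_mkcond; apply: eq_integral => y _.
  by rewrite patch_setX indicE xA mule1.
rewrite -[RHS](integral0 m2 setT); apply: eq_integral => y _.
by rewrite patch_setX indicE (negbTE xA) mule0.
Qed.

Lemma fubini_setX2 (A : set T1) (B : set T2) (f : T1 * T2 -> \bar R) :
  measurable A -> measurable B -> (m1 \x m2).-integrable (A `*` B) f ->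
  \int[m1 \x m2]_(z in A `*` B) f z =
  \int[m2]_(y in B) \int[m1]_(x in A) f (x, y).
Proof.
move=> mA mB fi; rewrite integral_mkcond -integral21_prod_meas1; last first.
  by apply/(integrable_mkcond _ _).1 => //; exact: measurableX.
rewrite [RHS]integral_mkcond; apply: eq_integral => y _.
rewrite /fubini_G patchE; case: ifPn => yB.
  rewrite [RHS]integral_mkcond; apply: eq_integral => x _.
  by rewrite !patchE in_setX/= yB andbT.
rewrite -[RHS](integral0 m1 setT); apply: eq_integral => x _.
by rewrite patchE in_setX/= (negbTE yB) andbF.
Qed.

Lemma integrable_setX_fubini1 (A : set T1) (B : set T2) (f : T1 * T2 -> \bar R) :
  measurable A -> measurable B -> (m1 \x m2).-integrable (A `*` B) f ->
  m1.-integrable A (fun x => \int[m2]_(y in B) f (x, y)) /\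
  {ae m1, forall x, A x -> m2.-integrable B (fun y => f (x, y))}.
Proof.
move=> mA mB fi.
have fi' : (m1 \x m2).-integrable setT (f \_ (A `*` B)).
  by apply/(integrable_mkcond _ _).1 => //; exact: measurableX.
split.
  apply/(integrable_mkcond _ _).2 => //.
  apply: eq_integrable (integrable_fubini_F fi') => // x _.
  rewrite /fubini_F patchE; case: ifPn => xA.
    rewrite [RHS]integral_mkcond; apply: eq_integral => y _.
    by rewrite patch_setX indicE xA mule1.
  rewrite -[RHS](integral0 m2 setT); apply: eq_integral => y _.
  by rewrite patch_setX indicE (negbTE xA) mule0.
apply: filterS (ae_integrable1 fi') => x fx Ax.
apply/(integrable_mkcond _ _).2 => //.
apply: eq_integrable fx => // y _.
by rewrite patch_setX indicE mem_set// mule1.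
Qed.

Lemma integrable_setX_fubini2 (A : set T1) (B : set T2) (f : T1 * T2 -> \bar R) :
  measurable A -> measurable B -> (m1 \x m2).-integrable (A `*` B) f ->
  m2.-integrable B (fun y => \int[m1]_(x in A) f (x, y)).
Proof.
move=> mA mB fi.
have fi' : (m1 \x m2).-integrable setT (f \_ (A `*` B)).
  by apply/(integrable_mkcond _ _).1 => //; exact: measurableX.
apply/(integrable_mkcond _ _).2 => //.
have iG : m2.-integrable setT (fubini_G m1 (f \_ (A `*` B))).
  have mf' := measurable_int _ fi'.
  apply/integrableP; split; first exact: (measurable_fubini_G fi').
  apply: le_lt_trans ((integrable21ltyP m1 m2 mf').1 fi').
  apply: le_integral_nonmeasurable => // y _.
  apply: le_abse_integral => //; apply: measurableT_comp => //.
apply: eq_integrable iG => // y _.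
rewrite /fubini_G patchE; case: ifPn => yB.
  rewrite [RHS]integral_mkcond; apply: eq_integral => x _.
  by rewrite !patchE in_setX/= yB andbT.
rewrite -[RHS](integral0 m1 setT); apply: eq_integral => x _.
by rewrite patchE in_setX/= (negbTE yB) andbF.
Qed.

End product_generalities.

(** * Square-integrable functions and summation by parts *)

(** Honest measurability, as opposed to the almost everywhere notion of [L2],
    is needed to apply integrability lemmas to products and sections. *)
Definition square_integrable d (T : measurableType d) (R : realType)
    (mu : {measure set T -> \bar R}) (D : set T) (f : T -> R) : Prop :=
  measurable_fun D f /\ mu.-integrable D (fun x => (f x ^+ 2)%:E).

Definition inner_product d (T : measurableType d) (R : realType)
    (mu : {measure set T -> \bar R}) (D : set T) (f g : T -> R) : R :=
  \int[mu]_(x in D) (f x * g x).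

Section square_integrable.
Context d (T : measurableType d) (R : realType).
Variables (mu : {measure set T -> \bar R}) (D : set T).
Hypothesis mD : measurable D.
Local Notation L := (square_integrable mu D).
Local Notation "<| f , g |>" := (inner_product mu D f g).

Lemma square_integrableM f g : L f -> L g ->
  mu.-integrable D (fun x => (f x * g x)%:E).
Proof.
move=> [mf f2] [mg g2].
have := integrableD mD f2 g2; apply: le_integrable => //.
- by apply/measurable_EFinP; exact: measurable_funM.
- move=> x Dx; rewrite lee_fin normrM.
  rewrite [leRHS]ger0_norm ?addr_ge0 ?sqr_ge0//.
  rewrite -[f x ^+ 2]real_normK ?num_real// -[g x ^+ 2]real_normK ?num_real//.
  have := sqr_ge0 (`|f x| - `|g x|).
  have := mulr_ge0 (normr_ge0 (f x)) (normr_ge0 (g x)); nra.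
Qed.

Lemma square_integrableD f g : L f -> L g -> L (fun x => f x + g x).
Proof.
move=> Lf Lg; have fg := square_integrableM Lf Lg.
case: Lf Lg => mf f2 [mg g2]; split; first exact: measurable_funD.
have := integrableD mD (integrableD mD f2 (integrableZl mD 2 fg)) g2.
apply: eq_integrable => // x _ /=.
by rewrite -EFinM -!EFinD; congr EFin; ring.
Qed.

Lemma square_integrableZ k f : L f -> L (fun x => k * f x).
Proof.
move=> [mf f2]; split; first exact: measurable_funM.
have := integrableZl mD (k ^+ 2) f2.
by apply: eq_integrable => // x _ /=; rewrite -EFinM exprMn.
Qed.

Lemma square_integrableB f g : L f -> L g -> L (fun x => f x - g x).
Proof.
move=> Lf /(square_integrableZ (-1)) Lg.
have := square_integrableD Lf Lg.
by under [X in L X -> _]eq_fun do rewrite mulN1r.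
Qed.

Lemma inner_productC f g : <|f, g|> = <|g, f|>.
Proof. by apply: eq_Rintegral => x _; rewrite mulrC. Qed.

Lemma inner_productDl f g h : L f -> L g -> L h ->
  <|fun x => f x + g x, h|> = <|f, h|> + <|g, h|>.
Proof.
move=> Lf Lg Lh; rewrite /inner_product -RintegralD//; last 2 first.
- exact: square_integrableM.
- exact: square_integrableM.
by apply: eq_Rintegral => x _; rewrite mulrDl.
Qed.

Lemma inner_productZl k f g : L f -> L g ->
  <|fun x => k * f x, g|> = k * <|f, g|>.
Proof.
move=> Lf Lg; rewrite /inner_product -RintegralZl//; last first.
  exact: square_integrableM.
by apply: eq_Rintegral => x _; rewrite mulrA.
Qed.

Lemma inner_productBl f g h : L f -> L g -> L h ->
  <|fun x => f x - g x, h|> = <|f, h|> - <|g, h|>.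
Proof.
move=> Lf Lg Lh; rewrite /inner_product -RintegralB//; last 2 first.
- exact: square_integrableM.
- exact: square_integrableM.
by apply: eq_Rintegral => x _; rewrite mulrBl.
Qed.

Lemma inner_productBr f g h : L f -> L g -> L h ->
  <|h, fun x => f x - g x|> = <|h, f|> - <|h, g|>.
Proof.
by move=> *; rewrite inner_productC inner_productBl//; congr (_ - _);
  exact: inner_productC.
Qed.

Lemma inner_product_ge0 f : 0 <= <|f, f|>.
Proof. by apply: Rintegral_ge0 => x _; rewrite -expr2 sqr_ge0. Qed.

Lemma inner_product_subsq f g : L f -> L g ->
  2 * <|f, g|> <= <|f, f|> + <|g, g|>.
Proof.
move=> Lf Lg; have LB := square_integrableB Lf Lg.
have := inner_product_ge0 (fun x => f x - g x).
rewrite inner_productBl// !inner_productBr// [<|g, f|>]inner_productC; lra.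
Qed.

Lemma EFin_inner_product f g : L f -> L g ->
  (<|f, g|>%:E = \int[mu]_(x in D) (f x * g x)%:E)%E.
Proof.
move=> Lf Lg; rewrite /inner_product /Rintegral fineK//.
by apply: integrable_fin_num => //; exact: square_integrableM.
Qed.

End square_integrable.

Section abel.
Context d (T : measurableType d) (R : realType).
Variables (mu : {measure set T -> \bar R}) (D : set T).
Hypothesis mD : measurable D.
Local Notation L := (square_integrable mu D).
Local Notation "<| f , g |>" := (inner_product mu D f g).

(** Summation by parts. Adding one step to the invariant [main] leaves the pairing
    <v_(i+1), Phi_(i+1) - Phi_i>. The hypothesis on the sample bounds it through
    <Phi_i, Phi_(i+1)> - <Phi_i, Phi_i>, which is at most half the increment of
    <Phi_i, Phi_i>. The boundary terms combine into the squares of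
    v_n - Phi_n and v_0 - Phi_0. *)
Lemma telescoping_energy_estimate (n : nat) (tau : R) (v Phi : nat -> T -> R)
    (e eps : nat -> R) :
  (forall i, (i <= n)%N -> L (v i)) -> (forall i, (i <= n)%N -> L (Phi i)) ->
  (forall i, (i < n)%N ->
    <|v i.+1, fun x => Phi i.+1 x - Phi i x|> + tau * e i.+1 <=
    <|Phi i, fun x => Phi i.+1 x - Phi i x|> + eps i) ->
  0 <= tau -> (forall i, 0 <= e i) ->
  \sum_(i < n) tau * (e i + e i.+1) / 2
  + \sum_(i < n) (<|v i.+1, v i.+1|> / 2 - <|v i, v i|> / 2
                   - <|fun x => v i.+1 x - v i x, Phi i|>)
  - <|fun x => v n x - Phi n x, fun x => v n x - Phi n x|> / 2 <=
  tau / 2 * e 0%N + \sum_(i < n) eps i.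
Proof.
move=> Lv LPhi sample tau0 e0.
have main m : (m <= n)%N ->
  \sum_(i < m) tau * (e i + e i.+1) / 2
  + \sum_(i < m) (<|v i.+1, v i.+1|> / 2 - <|v i, v i|> / 2
                   - <|fun x => v i.+1 x - v i x, Phi i|>)
   <= tau / 2 * e 0%N - tau / 2 * e m + \sum_(i < m) eps i
   + (<|v m, v m|> / 2 - <|v m, Phi m|>) - (<|v 0%N, v 0%N|> / 2 - <|v 0%N, Phi 0%N|>)
   + (<|Phi m, Phi m|> / 2 - <|Phi 0%N, Phi 0%N|> / 2).
  elim: m => [_|m IH mn]; first by rewrite !big_ord0; lra.
  have {}IH := IH (ltnW mn).
  have := sample m mn.
  have Lm := Lv _ (ltnW mn). have Lm1 := Lv _ mn.
  have Pm := LPhi _ (ltnW mn). have Pm1 := LPhi _ mn.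
  rewrite !big_ord_recr/= !inner_productBr// inner_productBl//.
  have := inner_product_subsq mD Pm Pm1.
  lra.
(* The discarded terms are tau / 2 * e n and half the squared norm of
   v 0 - Phi 0. *)
have {main} := main n (leqnn n).
have Ln := Lv _ (leqnn n). have Pn := LPhi _ (leqnn n).
have L0 := Lv _ (leq0n n). have P0 := LPhi _ (leq0n n).
have LB := square_integrableB mD Ln Pn.
rewrite [<|fun x => v n x - Phi n x, _|>](_ : _ = <|v n, v n|> - 2 * <|v n, Phi n|> + <|Phi n, Phi n|>); last first.
  rewrite inner_productBl// !inner_productBr//.
  rewrite [<|Phi n, v n|>]inner_productC; lra.
have := inner_product_subsq mD L0 P0.
have := mulr_ge0 tau0 (e0 n).
lra.
Qed.

End abel.

(** * The fractional Sobolev space as a vector space *)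

Section ae_measurable_theory.
Context d (T : measurableType d) (R : realType).
Variables (mu : {measure set T -> \bar R}) (D : set T).
Implicit Types f g : T -> R.

Lemma measurable_ae_measurable f : measurable_fun D f -> ae_measurable mu D f.
Proof. by move=> mf; exists f => //; apply: aeW => x. Qed.

Lemma ae_measurableD f g : ae_measurable mu D f -> ae_measurable mu D g ->
  ae_measurable mu D (fun x => f x + g x).
Proof.
move=> [f' mf ff] [g' mg gg]; exists (fun x => f' x + g' x).
  exact: measurable_funD.
by apply: filterS2 ff gg => x fx gx Dx; rewrite fx// gx.
Qed.

Lemma ae_measurableM f g : ae_measurable mu D f -> ae_measurable mu D g ->
  ae_measurable mu D (fun x => f x * g x).
Proof.
move=> [f' mf ff] [g' mg gg]; exists (fun x => f' x * g' x).
  exact: measurable_funM.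
by apply: filterS2 ff gg => x fx gx Dx; rewrite fx// gx.
Qed.

Lemma ae_measurableZ k f : ae_measurable mu D f ->
  ae_measurable mu D (fun x => k * f x).
Proof.
by move=> mf; apply: ae_measurableM => //; exact: measurable_ae_measurable.
Qed.

End ae_measurable_theory.

Section Lnorm_ae.
Context d (T : measurableType d) (R : realType).
Variables (mu : {measure set T -> \bar R}) (p : R).
Hypothesis p1 : 1 <= p.
Implicit Types f g : T -> R.
Local Open Scope ereal_scope.

Let p0 : (0 < p)%R. Proof. exact: lt_le_trans p1. Qed.

Lemma Lnorm_ae_eq f g : (\forall x \ae mu, f x = g x) ->
  'N[mu]_p%:E[EFin \o f] = 'N[mu]_p%:E[EFin \o g].
Proof.
move=> fg; rewrite unlock; apply: (congr1 (fun a => a `^ p^-1)).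
by apply: ae_eq_integral_nonmeasurable; apply: filterS fg => x /= ->.
Qed.

Lemma Lnorm_ae_triangle f g : ae_measurable mu setT f -> ae_measurable mu setT g ->
  'N[mu]_p%:E[EFin \o (fun x => f x + g x)%R] <=
  'N[mu]_p%:E[EFin \o f] + 'N[mu]_p%:E[EFin \o g].
Proof.
move=> [f' mf ff] [g' mg gg].
have E1 : \forall x \ae mu, (f x + g x = f' x + g' x)%R.
  by apply: filterS2 ff gg => x fx gx; rewrite fx// gx.
rewrite (Lnorm_ae_eq E1) (@Lnorm_ae_eq f f'); last first.
  by apply: filterS ff => x; exact.
rewrite (@Lnorm_ae_eq g g'); last by apply: filterS gg => x; exact.
exact: minkowski_EFin.
Qed.

Lemma Lnorm_ae_scale k f : ae_measurable mu setT f ->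
  'N[mu]_p%:E[EFin \o (fun x => k * f x)%R] = `|k|%:E * 'N[mu]_p%:E[EFin \o f].
Proof.
move=> [f' mf ff].
have E1 : \forall x \ae mu, (k * f x = k * f' x)%R.
  by apply: filterS ff => x fx; rewrite fx.
rewrite (Lnorm_ae_eq E1) (@Lnorm_ae_eq f f'); last first.
  by apply: filterS ff => x; exact.
rewrite unlock.
under eq_integral do rewrite /= normrM powRM// EFinM.
rewrite ge0_integralZl//; last first.
  apply/measurable_EFinP.
  apply: (@measurableT_comp _ _ _ _ _ _ (@powR R ^~ p)) => //.
  exact: measurableT_comp.
rewrite poweRM ?lee_fin ?powR_ge0//; last first.
  by apply: integral_ge0 => x _; rewrite lee_fin powR_ge0.
by rewrite poweR_EFin -powRrM mulfV ?gt_eqF// powRr1.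
Qed.

End Lnorm_ae.

Section Wsp_theory.
Context {R : realType} {N : nat}.
Variables (s p : R).
Hypothesis p1 : 1 < p.
Implicit Types psi phi : 'rV[R]_N -> R.
Local Notation mu := (@lebesgue_rV R N).
Local Notation mu2 := (lebesgue_rV N \x lebesgue_rV N)%E.

Let p0 : 0 < p. Proof. exact: lt_trans p1. Qed.

Lemma enorm_ge0 (x : 'rV[R]_N) : 0 <= enorm x.
Proof. exact: sqrtr_ge0. Qed.

Lemma measurable_enormB :
  measurable_fun [set: 'rV[R]_N * 'rV[R]_N] (fun z => enorm (z.1 - z.2)).
Proof.
have -> : (fun z : 'rV[R]_N * 'rV[R]_N => enorm (z.1 - z.2)) =
    (fun z => (\sum_i (z.1 - z.2) ord0 i ^+ 2) `^ 2^-1).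
  by apply/funext => z; rewrite powR12_sqrt// sumr_ge0// => i _; exact: sqr_ge0.
apply: (@measurableT_comp _ _ _ _ _ _ (@powR R ^~ 2^-1)) => //.
apply: measurable_sum => i.
under eq_fun do rewrite !mxE.
apply: measurable_funX; apply: measurable_funB.
- exact: (measurableT_comp (@measurable_rV_coord R N i) measurable_fst).
- exact: (measurableT_comp (@measurable_rV_coord R N i) measurable_snd).
Qed.

Lemma measurable_powR_inv d (T' : measurableType d) (f : T' -> R) q :
  measurable_fun [set: T'] f ->
  measurable_fun [set: T'] (fun x => (f x `^ q)^-1).
Proof.
move=> mf; under eq_fun do rewrite -powRN.
exact: (@measurableT_comp _ _ _ _ _ _ (@powR R ^~ (- q))).
Qed.

(** The Gagliardo seminorm of psi is the L^p norm of this function on R^N x R^N,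
    so that it inherits its triangle inequality from Minkowski. *)
Definition difference_quotient psi (z : 'rV[R]_N * 'rV[R]_N) : R :=
  (enorm (z.1 - z.2) `^ ((N%:R + p * s) / p))^-1 * (psi z.1 - psi z.2).

Lemma Wsp_seminormE psi :
  Wsp_seminorm s p psi = 'N[mu2]_p%:E[EFin \o difference_quotient psi]%E.
Proof.
rewrite unlock /Wsp_seminorm; apply: (congr1 (fun a => a `^ p^-1)%E); apply: eq_integral => z _.
rewrite /= /difference_quotient normrM powRM// mulrC; congr (_ * _)%:E.
rewrite ger0_norm ?invr_ge0 ?powR_ge0// -!powRN -powRrM.
by rewrite mulNr mulrAC -mulrA divff ?gt_eqF// mulr1 powRN.
Qed.

Lemma ae_mu2_fst (P : 'rV[R]_N -> Prop) :
  {ae mu, forall x, P x} -> {ae mu2, forall z, P z.1 /\ P z.2}.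
Proof.
move=> aeP; apply: filterS2 (ae_prod_fst (lebesgue_rV N) aeP)
  (ae_prod_snd (lebesgue_rV N) aeP) => z; by split.
Qed.

Lemma ae_measurable_difference psi : ae_measurable mu setT psi ->
  ae_measurable mu2 setT (fun z => psi z.1 - psi z.2).
Proof.
move=> [f mf pf]; exists (fun z => f z.1 - f z.2).
  apply: measurable_funB.
  - exact: (measurableT_comp mf measurable_fst).
  - exact: (measurableT_comp mf measurable_snd).
have : {ae mu, forall x, psi x = f x} by apply: filterS pf => x; exact.
by move=> /ae_mu2_fst; apply: filterS => z [-> ->].
Qed.

Lemma ae_measurable_difference_quotient psi : ae_measurable mu setT psi ->
  ae_measurable mu2 setT (difference_quotient psi).
Proof.
move=> mpsi; apply: ae_measurableM; last exact: ae_measurable_difference.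
apply: measurable_ae_measurable; apply: measurable_powR_inv => //.
exact: measurable_enormB.
Qed.

Lemma Wsp_seminorm_ae_eq psi phi : {ae mu, forall x, psi x = phi x} ->
  Wsp_seminorm s p psi = Wsp_seminorm s p phi.
Proof.
move=> /ae_mu2_fst H; rewrite !Wsp_seminormE; apply: Lnorm_ae_eq.
by apply: filterS H => z [E1 E2]; rewrite /difference_quotient E1 E2.
Qed.

Lemma Wsp_norm_ae_eq psi phi : {ae mu, forall x, psi x = phi x} ->
  Wsp_norm s p psi = Wsp_norm s p phi.
Proof.
move=> H; rewrite /Wsp_norm (Wsp_seminorm_ae_eq H); congr (_ + _)%E.
exact: Lnorm_ae_eq.
Qed.

Lemma Wsp_norm_ge0 psi : (0 <= Wsp_norm s p psi)%E.
Proof. by rewrite adde_ge0// ?Lnorm_ge0// poweR_ge0. Qed.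

Lemma Wsp_norm_triangle psi phi :
  ae_measurable mu setT psi -> ae_measurable mu setT phi ->
  (Wsp_norm s p (fun x => psi x + phi x)%R <= Wsp_norm s p psi + Wsp_norm s p phi)%E.
Proof.
move=> mpsi mphi; rewrite /Wsp_norm addeACA; apply: leeD.
  by apply: Lnorm_ae_triangle => //; exact: ltW.
rewrite !Wsp_seminormE.
have := Lnorm_ae_triangle (ltW p1) (ae_measurable_difference_quotient mpsi)
  (ae_measurable_difference_quotient mphi).
apply: le_trans; rewrite le_eqVlt; apply/orP; left; apply/eqP.
congr ('N[_]_ _[_])%E; apply/funext => z /=.
by rewrite /difference_quotient; congr EFin; ring.
Qed.

Lemma Wsp_norm_scale k psi : ae_measurable mu setT psi ->
  (Wsp_norm s p (fun x => k * psi x)%R = `|k|%:E * Wsp_norm s p psi)%E.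
Proof.
move=> mpsi; rewrite /Wsp_norm ge0_muleDr ?Lnorm_ge0 ?poweR_ge0//; congr (_ + _)%E.
  by apply: Lnorm_ae_scale => //; exact: ltW.
rewrite !Wsp_seminormE -Lnorm_ae_scale ?ltW//; last first.
  exact: ae_measurable_difference_quotient.
congr ('N[_]_ _[_])%E; apply/funext => z /=.
by rewrite /difference_quotient; congr EFin; ring.
Qed.

Lemma Wsp_ae_measurable psi : Wsp s p psi -> ae_measurable mu setT psi.
Proof. by case. Qed.

Lemma WspE psi : Wsp s p psi <->
  ae_measurable mu setT psi /\ (Wsp_norm s p psi < +oo)%E.
Proof.
split=> [[m1 m2 m3]|[m1 m2]]; first by split => //; exact: lte_add_pinfty.
split => //.
- by apply: le_lt_trans m2; rewrite leeDl// poweR_ge0.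
- by apply: le_lt_trans m2; rewrite leeDr// Lnorm_ge0.
Qed.

Lemma WspD psi phi : Wsp s p psi -> Wsp s p phi -> Wsp s p (fun x => psi x + phi x).
Proof.
move=> /WspE[m1 n1] /WspE[m2 n2]; apply/WspE; split; first exact: ae_measurableD.
move: (Wsp_norm_triangle m1 m2) n1 n2.
move: (Wsp_norm _ _ _) (Wsp_norm _ _ _) (Wsp_norm _ _ _) => a b c abc b1 c1.
by apply: (le_lt_trans abc); exact: lte_add_pinfty.
Qed.

Lemma WspZ k psi : Wsp s p psi -> Wsp s p (fun x => k * psi x).
Proof.
move=> /WspE[m1 n1]; apply/WspE; split; first exact: ae_measurableZ.
by rewrite Wsp_norm_scale// lte_mul_pinfty.
Qed.

Lemma Wsp_ae_eq psi phi : {ae mu, forall x, psi x = phi x} ->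
  Wsp s p psi -> Wsp s p phi.
Proof.
move=> H /WspE[[f mf pf] n]; apply/WspE; split; last by rewrite -(Wsp_norm_ae_eq H).
by exists f => //; apply: filterS2 pf H => x + <-.
Qed.

Variable Omega : set 'rV[R]_N.

Lemma Wsp0D psi phi : Wsp0 s p Omega psi -> Wsp0 s p Omega phi ->
  Wsp0 s p Omega (fun x => psi x + phi x).
Proof.
move=> [W1 z1] [W2 z2]; split; first exact: WspD.
by apply: filterS2 z1 z2 => x E1 E2 Ox; rewrite E1// E2// addr0.
Qed.

Lemma Wsp0Z k psi : Wsp0 s p Omega psi -> Wsp0 s p Omega (fun x => k * psi x).
Proof.
move=> [W1 z1]; split; first exact: WspZ.
by apply: filterS z1 => x E1 Ox; rewrite E1// mulr0.
Qed.

Lemma Wsp0_ae_eq psi phi : {ae mu, forall x, psi x = phi x} ->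
  Wsp0 s p Omega psi -> Wsp0 s p Omega phi.
Proof.
move=> H [W1 z1]; split; first exact: Wsp_ae_eq W1.
by apply: filterS2 H z1 => x <-.
Qed.

End Wsp_theory.

(** * Lebesgue measure on R^N *)

Section space_topology.
Context {R : realType} {N : nat}.
Local Notation E := 'rV[R]_N.
Local Notation mu := (@lebesgue_rV R N).
Local Notation mu2 := (lebesgue_rV N \x lebesgue_rV N)%E.
Local Notation MR := (measurableTypeR R).

Lemma measurable_rV_forall (A : 'I_N -> set MR) : (forall i, measurable (A i)) ->
  measurable [set v : E | forall i, A i (v ord0 i)].
Proof.
move=> mA; rewrite (_ : [set _ | _] = \bigcap_(i in [set: 'I_N])
   (rV_coord i @^-1` A i)); last first.
  by apply/seteqP; split=> v Av i; [move=> _; exact: Av|exact: (Av i I)].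
apply: fin_bigcap_measurable => // i _.
by rewrite -[X in measurable X]setTI; exact: measurable_rV_coord.
Qed.

Lemma measurable_rV_ball (x : E) (e : R) : measurable (ball x e).
Proof.
have [e0|e0] := ltP 0 e; last first.
  rewrite (_ : ball x e = set0)//; apply/seteqP; split => // y [e1 _].
  by move: e0; rewrite leNgt e1.
rewrite (_ : ball x e = [set v : E | forall i, [set y : MR | ball (x ord0 i) e y] (v ord0 i)]).
  apply: (measurable_rV_forall (A := fun i => ball (x ord0 i) e)) => i.
  exact: (measurable_ball (x ord0 i) e).
apply/seteqP; split => [y [_ h] i|y h]; first exact: h.
by split => // i j; rewrite (ord1 i); exact: h.
Qed.

Let ratv (q : 'rV[rat]_N) : E := map_mx ratr q.

(** The sigma-algebra of R^N x R is generated by rectangles. An open set is the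
    union of the countably many balls of rational centre and radius that it
    contains, and a ball for the sup norm is a rectangle. *)
Lemma open_rVR_measurable (U : set (E * R)) : open U ->
  measurable (U : set (E * MR)).
Proof.
move=> oU.
pose B (i : 'rV[rat]_N * rat * rat) : set (E * MR) :=
  ball (ratv i.1.1) (ratr i.2) `*` (ball (ratr i.1.2 : R) (ratr i.2) : set MR).
pose F i := if asbool (B i `<=` U) then B i else set0.
have -> : (U : set (E * MR)) = \bigcup_i F i.
  apply/seteqP; split => [[x t] Uxt|z [i _]]; last first.
    by rewrite /F; case: asboolP => // BU; exact: BU.
  have /nbhs_ballP[e /= e0 eU] : nbhs (x, t) U by exact: open_nbhs_nbhs.
  have e20 : 0 < e / 2 by rewrite divr_gt0.
  have [r /itvP re] := rat_in_itvoo e20.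
  have r0 : (0 : R) < ratr r by rewrite re.
  have r2 : (ratr r : R) + ratr r <= e by rewrite [e]splitr lerD// ltW// re.
  have near y : exists q : rat, ball (ratr q : R) (ratr r) y.
    have /rat_in_itvoo[q /itvP qy] : y < y + ratr r by rewrite ltrDl.
    have y1 : y < ratr q by rewrite qy.
    have y2 : ratr q < y + ratr r by rewrite qy.
    by exists q; rewrite -ball_normE/= ger0_norm; lra.
  have [q qx] := choice (fun i => near (x ord0 i)).
  have [a ta] := near t.
  exists ((\row_i q i, a), r) => //; rewrite /F.
  have Bxt : B ((\row_i q i, a), r) (x, t).
    split => //=; split => // i j; rewrite (ord1 i) !mxE; exact: qx.
  case: asboolP => // nB; exfalso; apply: nB => z Bz; apply: eU.
  apply: (le_ball r2); apply: (@ball_triangle _ _ ((ratv (\row_i q i), ratr a) : E * R)).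
    by apply: ball_sym; case: Bxt; split.
  by case: Bz; split.
apply: countable_bigcupT_measurable; first exact: countableP.
move=> i; rewrite /F; case: asboolP => // _; apply: measurableX.
  exact: measurable_rV_ball.
exact: measurable_ball.
Qed.

(** U is a slice of the open cylinder over U. *)
Lemma open_rV_measurable (U : set E) : open U -> measurable U.
Proof.
move=> oU.
have oU' : open ((U `*` setT) : set (E * R)).
  rewrite (_ : _ `*` _ = fst @^-1` U); last first.
    by apply/seteqP; split => -[x y]//= [].
  by apply: open_comp => // z _; exact: cvg_fst.
have := measurable_ysection (0 : MR) (open_rVR_measurable oU').
rewrite (_ : ysection _ _ = U)//; apply/seteqP; split => x.
  by rewrite /ysection/= inE => -[].
by move=> Ux; rewrite /ysection/= inE.
Qed.

Lemma continuous_rVR_measurable (f : E * R -> R) : continuous f ->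
  measurable_fun [set: E * MR] f.
Proof.
move=> cf; apply: (measurability _ (RGenOpens.measurableE R)).
move=> _ [_ [a [b ->] <-]]; rewrite setTI; apply: open_rVR_measurable.
apply: open_comp => [z _|]; first exact: cf.
exact: interval_open.
Qed.

Lemma rV_coord_le_norm (x : E) i : `|x ord0 i| <= `|x|.
Proof.
have /mapP[j Hj ->] : `|x ord0 i| \in [seq `|x y.1 y.2| | y : 'I_1 * 'I_N].
  by apply/mapP; exists (ord0, i) => //=; rewrite mem_enum.
by rewrite [leRHS]/Num.Def.normr /= mx_normrE; apply/bigmax_geP; right => /=; exists j.
Qed.

Lemma bounded_set_box (Omega : set E) : bounded_set Omega ->
  exists2 M : R, 0 < M & forall x, Omega x -> forall i, `|x ord0 i| <= M.
Proof.
move=> [M [_ HM]]; exists (`|M| + 1); first by rewrite ltr_wpDl.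
move=> x Ox i; apply: le_trans (rV_coord_le_norm x i) _.
by apply: HM => //; rewrite (le_lt_trans (ler_norm M))// ltrDl.
Qed.

Lemma lebesgue_rV_cube (a b : R) : a <= b ->
  mu [set v : E | forall i, v ord0 i \in `[a, b]] = ((b - a) ^+ N)%:E.
Proof.
move=> ab.
rewrite (@lebesgue_rV_box R N (fun=> [set` `[a, b]])); last by move=> i; exact: measurable_itv.
transitivity (\prod_(i < N) (b - a)%:E)%E; last first.
  by rewrite prodEFin prodr_const card_ord.
apply: eq_bigr => i _; rewrite lebesgue_measure_itv/= lte_fin.
case: ltgtP ab => // -> _; by rewrite subrr.
Qed.

Lemma bounded_open_finite_measure (Omega : set E) : open Omega -> bounded_set Omega ->
  (mu Omega < +oo)%E.
Proof.
move=> oO /bounded_set_box[M M0 HM].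
have MM : - M <= M by rewrite (le_trans _ (ltW M0))// oppr_le0 ltW.
apply: (@le_lt_trans _ _ (((M - - M) ^+ N)%:E)); last exact: ltry.
rewrite -(lebesgue_rV_cube MM); apply: le_measure; rewrite ?inE.
- exact: open_rV_measurable.
- by apply: (measurable_rV_forall (A := fun=> [set` `[- M, M]])) => i; exact: measurable_itv.
- by move=> x /HM Hx i; rewrite in_itv/= -ler_norml; exact: Hx.
Qed.

Hypothesis N0 : (0 < N)%N.

(** The complement of a bounded set contains a cube of positive measure. *)
Lemma ae_exists_outside_bounded (Omega : set E) (P : E -> Prop) :
  bounded_set Omega -> {ae mu, forall x, P x} -> exists2 x, ~ Omega x & P x.
Proof.
move=> /bounded_set_box[M M0 HM] aeP.
have MM : M + 1 <= M + 2 by rewrite lerD2l ler1n.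
(* Any coordinate of a point of this cube exceeds the bound M on Omega. *)
pose D := [set v : E | forall i, v ord0 i \in `[M + 1, M + 2]].
have [x Dx Px] : exists2 x, D x & P x.
  apply: (@ae_exists _ _ _ mu).
  - by apply: (measurable_rV_forall (A := fun=> [set` `[M + 1, M + 2]])) => i; exact: measurable_itv.
  - by rewrite [ltRHS](lebesgue_rV_cube MM) lte_fin exprn_gt0//; lra.
  - by apply: filterS aeP.
exists x => // /HM /(_ (Ordinal N0)).
have := Dx (Ordinal N0); rewrite in_itv/= => /andP[x1 _] x2.
have := le_trans x1 (le_trans (ler_norm _) x2); lra.
Qed.

Lemma lebesgue_rV_set1 (x : E) : mu [set x] = 0%E.
Proof.
rewrite (_ : [set x] = [set v : E | forall i, [set (x ord0 i : MR)] (v ord0 i)]); last first.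
  by apply/seteqP; split => [y -> //|y h]; apply/rowP => i; exact: h.
rewrite (@lebesgue_rV_box R N (fun i => [set (x ord0 i : MR)])); last by move=> i; exact: measurable_set1.
apply/eqP; rewrite -[X in X == _]/(_ : \bar R).
rewrite (bigD1 (Ordinal N0))//= lebesgue_measure_set1 mul0e; exact: eqxx.
Qed.

(** The slices of the diagonal are single points. *)
Lemma ae_off_diagonal : {ae mu2, forall z : E * E, z.1 != z.2}.
Proof.
pose D := [set z : E * E | z.1 = z.2].
have mD : measurable D.
  rewrite (_ : D = \bigcap_(i in [set: 'I_N])
     ((fun z : E * E => z.1 ord0 i - z.2 ord0 i) @^-1` [set 0])); last first.
    apply/seteqP; split => [z Dz i _|z h]; first by rewrite /= Dz subrr.
    by apply/rowP => i; apply/eqP; rewrite -subr_eq0; apply/eqP; exact: h.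
  apply: fin_bigcap_measurable => // i _; rewrite -[X in measurable X]setTI.
  have : measurable_fun [set: E * E] (fun z => z.1 ord0 i - z.2 ord0 i).
    apply: measurable_funB.
    - exact: (measurableT_comp (@measurable_rV_coord R N i) measurable_fst).
    - exact: (measurableT_comp (@measurable_rV_coord R N i) measurable_snd).
  by apply => //; exact: measurable_set1.
exists D; split => //.
  apply: measurable_prod_null => //; apply: aeW => y.
  rewrite (_ : ysection D y = [set y]) ?lebesgue_rV_set1//.
  by apply/seteqP; split => x; rewrite /ysection/= ?inE//= => ->; rewrite inE.
by move=> z /= /negP; rewrite negbK => /eqP.
Qed.

End space_topology.

(** * Strong measurability of functions built from ramps in time *)

Definition ramp (R : realType) (b t : R) : R := Num.max 0 (t - b).

Section staircase.
Context {R : realType}.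

(** The left-hand sum counts the integers j < k below y, which is the least
    integer above y up to truncation at 0. *)
Lemma count_below_approx (k : nat) (y : R) : y <= k%:R ->
  `|\sum_(j < k) (j%:R < y)%R%:R - Num.max 0 y| <= 1.
Proof.
elim: k => [|k IH] yk.
  by rewrite big_ord0 max_l// subr0 normr0 ler01.
have [yk'|ky] := leP y k%:R.
  by rewrite big_ord_recr/= ltNge yk'/= addr0; exact: IH.
rewrite (eq_bigr (fun=> 1)); last first.
  move=> j _; rewrite (le_lt_trans _ ky)// ler_nat -ltnS; exact: ltn_ord.
rewrite sumr_const card_ord.
have y0 : 0 <= y by apply: le_trans (ltW ky).
rewrite max_r// ger0_norm ?subr_ge0//.
by rewrite -natr1; lra.
Qed.

(** A ramp is a uniform limit of step functions with equidistant jumps; these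
    are the time coefficients of the simple functions in the Bochner space. *)
Lemma ramp_staircase (T b t : R) (k : nat) : 0 < T -> 0 <= b -> t <= T ->
  `|\sum_(j < k.+1) (b + j%:R * (T / k.+1%:R) < t)%R%:R * (T / k.+1%:R) - ramp b t|
    <= T / k.+1%:R.
Proof.
move=> T0 b0 tT; set h := T / k.+1%:R.
have h0 : 0 < h by rewrite divr_gt0.
have yk : (t - b) / h <= k.+1%:R.
  by rewrite ler_pdivrMr// /h mulrC divfK ?pnatr_eq0//; lra.
have := count_below_approx yk.
rewrite -(ler_pM2r h0) mul1r -[X in _ * X <= _](gtr0_norm h0) -normrM mulrBl.
rewrite mulr_suml.
have -> : Num.max 0 ((t - b) / h) * h = ramp b t.
  rewrite /ramp maxr_pMl ?ltW// mul0r divfK// gt_eqF//.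
congr (`|_ - _| <= _); apply: eq_bigr => j _; congr (_%:R * _).
by rewrite ltr_pdivlMr// ltrBrDl.
Qed.

Lemma ramp_ge0 (b t : R) : 0 <= ramp b t.
Proof. by rewrite le_max lexx. Qed.

Lemma ramp_le (T b t : R) : 0 <= T -> 0 <= b -> t <= T -> ramp b t <= T.
Proof. by move=> T0 b0 tT; rewrite ge_max T0/=; lra. Qed.

Lemma continuous_ramp (b : R) : continuous (ramp b).
Proof.
rewrite (_ : ramp b = fun t => (t - b + `|t - b|) / 2); last first.
  by apply/funext => t; rewrite /ramp maxr_absE add0r sub0r normrN.
move=> t; apply: cvgM; last exact: cvg_cst.
have H : t' - b @[t' --> t] --> t - b by apply: cvgB; [exact: cvg_id|exact: cvg_cst].
by apply: cvgD => //; exact: cvg_norm.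
Qed.

Lemma measurable_ramp (b : R) : measurable_fun [set: R] (ramp b).
Proof. by apply: continuous_measurable_fun; exact: continuous_ramp. Qed.

End staircase.

Section bounded_path.
Local Opaque Wsp_norm.
Context {R : realType} {N : nat}.
Local Notation E := 'rV[R]_N.
Local Notation mu := (@lebesgue_rV R N).
Local Notation MR := (measurableTypeR R).
Local Notation leb := (@lebesgue_measure R).
Variables (s p T : R).
Hypotheses (p1 : 1 < p) (T0 : 0 < T).
Variable X : set (E -> R).
Hypothesis XW : X `<=` Wsp s p.
Hypothesis XD : forall f g, X f -> X g -> X (fun x => f x + g x).
Hypothesis XZ : forall k f, X f -> X (fun x => k * f x).

(** A form of membership in the Bochner space L^p(0,T;X) that is stable under
    sums at no cost: every statement holds for all times, and the norm is
    bounded instead of having an integrable power. *)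
Definition bounded_path (f : E -> R -> R) : Prop :=
  [/\ ae_measurable (lebesgue_rV N \x @lebesgue_measure R)%E
        (setT `*` `]0, T[) (fun z => f z.1 z.2),
      forall t, t \in `]0, T[ -> X (f^~ t),
      exists2 F : nat -> E -> R -> R, forall k, simple_in X (F k) &
        forall t, t \in `]0, T[ ->
          Wsp_norm s p (fun x => F k x t - f x t) @[k --> \oo] --> 0%E &
      exists C : R, forall t, t \in `]0, T[ -> (Wsp_norm s p (f^~ t) <= C%:E)%E].

Lemma bounded_path_LpX f : bounded_path f -> LpX s p T X f.
Proof.
move=> [m1 m2 [F F1 F2] [C HC]]; split => //.
- exact: aeW.
- by exists F => //; exact: aeW.
apply: (@le_lt_trans _ _ (\int[leb]_(t in `]0%R, T[) ((C%:E `^ p)))%E).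
  apply: le_integral_nonmeasurable => [t _|t Tt]; first exact: poweR_ge0.
  have := HC t Tt; move: (Wsp_norm_ge0 s p (f^~ t)).
  move: (Wsp_norm _ _ _) => a a0 aC.
  have C0 := le_trans a0 aC.
  by apply: gt0_ler_poweR => //; rewrite ?in_itv/= ?a0 ?C0 ?leey//; apply: ltW; apply: lt_trans p1.
rewrite poweR_EFin integral_cst//= lebesgue_measure_itv/= lte_fin T0.
by rewrite -EFinD -EFinM ltry.
Qed.

Lemma simple_in_section F t : (exists f, X f) -> simple_in X F -> X (F^~ t).
Proof.
move=> [f0 Xf0] [n [A [psi [H HF]]]].
rewrite (_ : F^~ t = fun x => \sum_(i < n) \1_(A i) t * psi i x); last first.
  by apply/funext => x; rewrite HF.
elim: n A psi H {HF} => [|n IH] A psi H.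
  rewrite (_ : (fun=> _) = fun x => 0 * f0 x); first exact: XZ.
  by apply/funext => x; rewrite big_ord0 mul0r.
rewrite (_ : (fun=> _) = fun x => (\sum_(i < n) \1_(A (widen_ord (leqnSn n) i)) t *
    psi (widen_ord (leqnSn n) i) x) + \1_(A ord_max) t * psi ord_max x); last first.
  by apply/funext => x; rewrite big_ord_recr.
apply: XD; first by apply: (IH (fun i => A (widen_ord (leqnSn n) i))) => i; exact: H.
by apply: XZ; have [] := H ord_max.
Qed.

Lemma simple_inD F G : simple_in X F -> simple_in X G ->
  simple_in X (fun x t => F x t + G x t).
Proof.
move=> [n [A [psi [H HF]]]] [m [B [phi [K KG]]]].
exists (n + m)%N, (fun i => match fintype.split i with inl j => A j | inr j => B j end),
  (fun i => match fintype.split i with inl j => psi j | inr j => phi j end).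
split=> [i|x t]; first by case: splitP => j _.
rewrite HF KG big_split_ord/=; congr (_ + _); apply: eq_bigr => i _.
  by have -> : fintype.split (lshift m i) = inl i by exact: (unsplitK (inl i)).
by have -> : fintype.split (rshift n i) = inr i by exact: (unsplitK (inr i)).
Qed.

Lemma simple_inZ k F : simple_in X F -> simple_in X (fun x t => k * F x t).
Proof.
move=> [n [A [psi [H HF]]]]; exists n, A, (fun i x => k * psi i x).
split=> [i|x t]; first by have [mA Xi] := H i; split => //; exact: XZ.
by rewrite HF mulr_sumr; apply: eq_bigr => i _; ring.
Qed.

Let XB f g : X f -> X g -> X (fun x => f x - g x).
Proof.
move=> Xf /(XZ (-1)) Xg; have := XD Xf Xg.
by under [Y in X Y -> _]eq_fun do rewrite mulN1r.
Qed.

Lemma half_time_in : T / 2 \in `]0, T[.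
Proof. by rewrite in_itv/= divr_gt0//= ltr_pdivrMr// mulrDr mulr1 ltrDl. Qed.

Lemma bounded_pathD f g : bounded_path f -> bounded_path g ->
  bounded_path (fun x t => f x t + g x t).
Proof.
move=> [f1 f2 [F F1 F2] [C HC]] [g1 g2 [G G1 G2] [C' HC']].
have XN : exists f, X f by exists (f^~ (T / 2)); apply: f2; exact: half_time_in.
have am h : X h -> ae_measurable mu setT h by move=> /XW /Wsp_ae_measurable.
split.
- exact: ae_measurableD.
- by move=> t Tt; apply: XD; [exact: f2|exact: g2].
- exists (fun k x t => F k x t + G k x t); first by move=> k; exact: simple_inD.
  move=> t Tt.
  have H : (Wsp_norm s p (fun x => F k x t - f x t)%R +
      Wsp_norm s p (fun x => G k x t - g x t)%R)%E @[k --> \oo] --> (0 : \bar R)%E.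
    by rewrite -[X in _ --> X]adde0; apply: cvgeD => //; [exact: F2|exact: G2].
  apply: squeeze_cvge H; [|exact: cvg_cst].
  apply: nearW => k; rewrite Wsp_norm_ge0/=.
  rewrite (_ : (fun x => _) = fun x => (F k x t - f x t) + (G k x t - g x t)).
    apply: Wsp_norm_triangle => //; apply: am; apply: XB => //.
    - exact: simple_in_section.
    - exact: f2.
    - exact: simple_in_section.
    - exact: g2.
  by apply/funext => x; ring.
- exists (C + C') => t Tt; rewrite EFinD.
  apply: le_trans (leeD (HC t Tt) (HC' t Tt)).
  by apply: Wsp_norm_triangle => //; apply: am; [exact: f2|exact: g2].
Qed.

Lemma bounded_pathZ k f : bounded_path f -> bounded_path (fun x t => k * f x t).
Proof.
move=> [f1 f2 [F F1 F2] [C HC]].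
have XN : exists f, X f by exists (f^~ (T / 2)); apply: f2; exact: half_time_in.
have am h : X h -> ae_measurable mu setT h by move=> /XW /Wsp_ae_measurable.
split.
- exact: ae_measurableZ.
- by move=> t Tt; apply: XZ; exact: f2.
- exists (fun j x t => k * F j x t); first by move=> j; exact: simple_inZ.
  move=> t Tt.
  rewrite (_ : (fun _ => _) = fun j =>
      (`|k|%:E * Wsp_norm s p (fun x => F j x t - f x t)%R)%E).
    rewrite -[X in _ --> X](mule0 `|k|%:E); apply: cvgeZl => //; exact: F2.
  apply/funext => j.
  have aj : ae_measurable mu setT (fun x => F j x t - f x t).
    by apply: am; apply: XB; [exact: simple_in_section|exact: f2].
  rewrite -[RHS](Wsp_norm_scale _ p1 _ aj).
  by congr (Wsp_norm _ _ _); apply/funext => x; ring.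
- exists (`|k| * C) => t Tt; rewrite Wsp_norm_scale//; last by apply: am; exact: f2.
  by rewrite EFinM lee_wpmul2l ?lee_fin// HC.
Qed.

Lemma bounded_path_sum n (f : 'I_n.+1 -> E -> R -> R) :
  (forall i, bounded_path (f i)) ->
  bounded_path (fun x t => \sum_(i < n.+1) f i x t).
Proof.
elim: n f => [|n IH] f H.
  rewrite (_ : (fun _ => _) = f ord0); first exact: H.
  by apply/funext => x; apply/funext => t; rewrite big_ord1.
under eq_fun do under eq_fun do rewrite big_ord_recr/=.
apply: bounded_pathD; last exact: H.
by apply: IH => i; exact: H.
Qed.

Lemma ae_measurable_fst chi (D : set MR) : ae_measurable mu setT chi ->
  ae_measurable (lebesgue_rV N \x @lebesgue_measure R)%E
        (setT `*` D) (fun z => chi z.1).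
Proof.
move=> [f mf cf]; exists (fun z => f z.1).
  apply: measurable_funTS; exact: (measurableT_comp mf measurable_fst).
have {}cf : {ae mu, forall x, chi x = f x} by apply: filterS cf => x; exact.
by apply: filterS (ae_prod_fst leb cf) => z.
Qed.

Lemma Wsp_fin chi : X chi ->
  exists2 C : R, 0 <= C & Wsp_norm s p chi = C%:E.
Proof.
move=> /XW/WspE[_ n]; exists (fine (Wsp_norm s p chi)).
  by rewrite fine_ge0// Wsp_norm_ge0.
by rewrite fineK// ge0_fin_numE// Wsp_norm_ge0.
Qed.

Lemma bounded_path_cst chi : X chi -> bounded_path (fun x _ => chi x).
Proof.
move=> Xc.
have am h : X h -> ae_measurable mu setT h by move=> /XW /Wsp_ae_measurable.
split.
- by apply: ae_measurable_fst; exact: am.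
- by [].
- exists (fun _ x _ => chi x).
    move=> _; exists 1%N, (fun=> setT), (fun=> chi); split => // x t.
    by rewrite big_ord1 indicE mem_set// mul1r.
  move=> t _.
  rewrite (_ : (fun _ => _) = fun=> 0%E); first exact: cvg_cst.
  apply/funext => k; rewrite (_ : (fun x => _) = fun x => 0 * chi x).
    by rewrite Wsp_norm_scale ?normr0 ?mul0e//; exact: am.
  by apply/funext => x; ring.
- have [C _ ->] := Wsp_fin Xc; by exists C.
Qed.

Lemma bounded_path_ramp chi b : 0 <= b -> X chi ->
  bounded_path (fun x t => ramp b t * chi x).
Proof.
move=> b0 Xc.
have am h : X h -> ae_measurable mu setT h by move=> /XW /Wsp_ae_measurable.
have [C C0 HC] := Wsp_fin Xc.
split.
- apply: ae_measurableM; last by apply: ae_measurable_fst; exact: am.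
  apply: measurable_ae_measurable; apply: measurable_funTS.
  exact: (measurableT_comp (measurable_ramp b) measurable_snd).
- by move=> t _; exact: XZ.
- exists (fun k x t => \sum_(j < k.+1)
      \1_(`]b + j%:R * (T / k.+1%:R), +oo[%classic : set R) t * (T / k.+1%:R * chi x)).
    move=> k; exists k.+1, (fun j => `]b + j%:R * (T / k.+1%:R), +oo[%classic),
      (fun j x => T / k.+1%:R * chi x); split => // i; split; last exact: XZ.
    exact: measurable_itv.
  move=> t Tt.
  have tT : t <= T by move: Tt; rewrite in_itv/= => /andP[_ /ltW].
  have H : ((T * C) * (k.+1%:R^-1 : R))%:E @[k --> \oo] --> 0%E.
    apply/fine_cvgP; split; first exact: nearW.
    rewrite -[X in _ --> X](mulr0 (T * C)).
    by apply: cvgM; [exact: cvg_cst|exact: cvg_harmonic].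
  apply: squeeze_cvge H; [|exact: cvg_cst].
  apply: nearW => k; rewrite Wsp_norm_ge0/=.
  rewrite (_ : (fun x => _) = fun x =>
    (\sum_(j < k.+1) (b + j%:R * (T / k.+1%:R) < t)%R%:R * (T / k.+1%:R) - ramp b t) * chi x).
    rewrite Wsp_norm_scale//; last exact: am.
    rewrite HC -EFinM lee_fin mulrAC; apply: ler_wpM2r => //.
    exact: ramp_staircase.
  apply/funext => x; rewrite mulrBl mulr_suml; congr (_ - _).
  apply: eq_bigr => j _; rewrite -[RHS]mulrA; congr (_ * _).
  by rewrite indicE mem_setE in_itv/= andbT.
- exists (T * C) => t Tt.
  rewrite Wsp_norm_scale//; last exact: am.
  rewrite HC -EFinM lee_fin; apply: ler_wpM2r => //.
  rewrite ger0_norm ?ramp_ge0//; apply: ramp_le => //; first exact: ltW.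
  by move: Tt; rewrite in_itv/= => /andP[_ /ltW].
Qed.

End bounded_path.

(** * Squared norms and integration by parts against a ramp *)

Section square_integrable_bounded.
Context d (T : measurableType d) (R : realType).
Variables (mu : {measure set T -> \bar R}) (D : set T).
Hypothesis mD : measurable D.

Lemma square_integrable_mul_bounded (h f : T -> R) (C : R) :
  measurable_fun D h -> (forall x, D x -> `|h x| <= C) ->
  square_integrable mu D f -> square_integrable mu D (fun x => h x * f x).
Proof.
move=> mh hC [mf f2]; split; first exact: measurable_funM.
have := integrableZl mD (C ^+ 2) f2; apply: le_integrable => //.
- by apply/measurable_EFinP; apply: measurable_funX; exact: measurable_funM.
- move=> x Dx; rewrite -EFinM lee_fin exprMn [leLHS]normrM [leRHS]normrM ler_wpM2r// !normrX.
  by rewrite lerXn2r// ?nnegrE// (le_trans (hC x Dx))// ler_norm.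
Qed.

Lemma square_integrable_cst (C : R) : (mu D < +oo)%E ->
  square_integrable mu D (fun=> C).
Proof.
move=> D1; split; first exact: measurable_cst.
apply/integrableP; split => //.
by rewrite integral_cst//= lte_mul_pinfty// ?lee_fin.
Qed.

Lemma square_integrable_bounded (h : T -> R) (C : R) : (mu D < +oo)%E ->
  measurable_fun D h -> (forall x, D x -> `|h x| <= C) ->
  square_integrable mu D h.
Proof.
move=> D1 mh hC.
have := square_integrable_mul_bounded mh hC (square_integrable_cst 1 D1).
by under [X in square_integrable _ _ X -> _]eq_fun do rewrite mulr1.
Qed.

Lemma sqnormL2E (f : T -> R) : square_integrable mu D f ->
  sqnormL2 mu D f = (inner_product mu D f f)%:E.
Proof.
by move=> Lf; rewrite EFin_inner_product// /sqnormL2; apply: eq_integral => x _;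
  rewrite expr2.
Qed.

Lemma square_integrable_L2 (f : T -> R) : square_integrable mu D f -> L2 mu D f.
Proof.
move=> Lf; split; first by case: Lf => mf _; exact: measurable_ae_measurable.
by rewrite sqnormL2E// ltry.
Qed.

Lemma L2_square_integrable (f : T -> R) : measurable_fun D f -> L2 mu D f ->
  square_integrable mu D f.
Proof.
move=> mf [_ f2]; split => //; apply/integrableP; split.
  by apply/measurable_EFinP; exact: measurable_funX.
apply: le_lt_trans f2; rewrite le_eqVlt; apply/orP; left; apply/eqP.
by apply: eq_integral => x _; rewrite gee0_abs// lee_fin sqr_ge0.
Qed.

Lemma sqnormL2_ge0 (f : T -> R) : (0 <= sqnormL2 mu D f)%E.
Proof. by apply: integral_ge0 => x _; rewrite lee_fin sqr_ge0. Qed.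

Lemma ae_eq_sqnormL2 (f g : T -> R) : (\forall x \ae mu, D x -> f x = g x) ->
  sqnormL2 mu D f = sqnormL2 mu D g.
Proof.
move=> fg; apply: ae_eq_integral_nonmeasurable.
by apply: filterS fg => x E Dx; rewrite E.
Qed.

Lemma sqnormL2Z k (f : T -> R) : measurable_fun D f ->
  sqnormL2 mu D (fun x => k * f x) = ((k ^+ 2)%:E * sqnormL2 mu D f)%E.
Proof.
move=> mf; rewrite /sqnormL2 -ge0_integralZl//.
- by apply: eq_integral => x _; rewrite exprMn.
- by apply/measurable_EFinP; exact: measurable_funX.
- by move=> x _; rewrite lee_fin sqr_ge0.
- by rewrite lee_fin sqr_ge0.
Qed.

Lemma sqnormL2D_le (f g : T -> R) : measurable_fun D f -> measurable_fun D g ->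
  (sqnormL2 mu D (fun x => f x + g x)%R <=
   2%:E * sqnormL2 mu D f + 2%:E * sqnormL2 mu D g)%E.
Proof.
move=> mf mg.
have m2 (h : T -> R) : measurable_fun D h -> measurable_fun D (fun x => (h x ^+ 2)%:E).
  by move=> mh; apply/measurable_EFinP; exact: measurable_funX.
rewrite /sqnormL2 -!ge0_integralZl//; do ?exact: m2.
- rewrite -ge0_integralD//; last 4 first.
  - by move=> x _; rewrite mule_ge0// lee_fin ?sqr_ge0.
  - by apply: measurable_funeM; exact: m2.
  - by move=> x _; rewrite mule_ge0// lee_fin ?sqr_ge0.
  - by apply: measurable_funeM; exact: m2.
  apply: le_integral_nonmeasurable => x _; first by rewrite lee_fin sqr_ge0.
  rewrite -!EFinM -EFinD lee_fin.
  have := sqr_ge0 (f x - g x); nra.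
- by move=> x _; rewrite lee_fin sqr_ge0.
- by move=> x _; rewrite lee_fin sqr_ge0.
Qed.

End square_integrable_bounded.

Section product_square_integrable.
Context d1 d2 (T1 : measurableType d1) (T2 : measurableType d2) (R : realType).
Variable m1 : {sigma_finite_measure set T1 -> \bar R}.
Variable m2 : {sigma_finite_measure set T2 -> \bar R}.
Variables (A : set T1) (B : set T2).
Hypotheses (mA : measurable A) (mB : measurable B).

Lemma measurable_fun_fst (chi : T1 -> R) : measurable_fun A chi ->
  measurable_fun (A `*` B) (fun z => chi z.1).
Proof.
move=> mc; apply: (measurable_comp mA _ mc).
  by move=> _ [z [Az _] <-].
by apply: measurable_funTS; exact: measurable_fst.
Qed.

(** By Tonelli, the integral of chi(x)^2 over A x B is a finite multiple of that
    over A. *)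
Lemma square_integrable_prod_fst (chi : T1 -> R) : (m2 B < +oo)%E ->
  square_integrable m1 A chi -> square_integrable (m1 \x m2)%E (A `*` B) (fun z => chi z.1).
Proof.
move=> B1 [mchi /integrableP[m2' i2]].
have mc := measurable_fun_fst mchi.
have mc2 : measurable_fun (A `*` B) (fun z : T1 * T2 => `|(chi z.1 ^+ 2)%:E|)%E.
  by apply: measurableT_comp => //; apply/measurable_EFinP; exact: measurable_funX.
split => //; apply/integrableP; split.
  by apply/measurable_EFinP; exact: measurable_funX.
rewrite tonelli_setX1//.
rewrite (eq_integral (fun x => `|(chi x ^+ 2)%:E| * m2 B)%E); last first.
  by move=> x _; rewrite -integral_cst.
rewrite ge0_integralZr//; last exact: measurableT_comp.
apply: lte_mul_pinfty => //; first exact: integral_ge0.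
by rewrite ge0_fin_numE//; exact: integral_ge0.
Qed.

End product_square_integrable.

(** Here psi stands for the section in time of a test function at a fixed x, up
    to a constant factor. *)
Section by_parts.
Context {R : realType}.
Local Notation leb := (@lebesgue_measure R).
Variable T : R.
Hypothesis T0 : 0 < T.
Variables psi dpsi : R -> R.
Hypothesis dpsiE : forall t, is_derive t (1 : R) psi (dpsi t).
Hypothesis cdpsi : continuous dpsi.
Hypothesis psiT : psi T = 0.

Let cpsi : continuous psi.
Proof.
move=> t; apply: differentiable_continuous; apply/derivable1_diffP.
by have [] := dpsiE t.
Qed.

Let psi' : derive1 psi = dpsi.
Proof. by apply/funext => t; rewrite derive1E; apply: derive_val. Qed.

Let psi_oo a b : derivable_oo_LRcontinuous psi a b.
Proof.
split => [t _||]; first by have [] := dpsiE t.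
- by apply: cvg_at_right_filter; exact: cpsi.
- by apply: cvg_at_left_filter; exact: cpsi.
Qed.

Lemma integral_derivative0 : psi 0 = 0 ->
  (\int[leb]_(t in `]0%R, T[) (dpsi t)%:E = 0)%E.
Proof.
move=> psi0.
rewrite -(@integral_itv_bndoo _ 0 T _ true false); last first.
  apply/measurable_EFinP; apply: measurable_funTS; exact: continuous_measurable_fun.
rewrite (@continuous_FTC2 _ dpsi psi)//.
- by rewrite psi0 psiT subee.
- by apply: continuous_subspaceT; exact: cdpsi.
- by move=> t _; rewrite psi'.
Qed.

(** Both sides only see times after b, where the ramp is t - b. *)
Lemma ramp_by_parts (b : R) : 0 <= b ->
  (\int[leb]_(t in `]0%R, T[) (ramp b t * dpsi t)%:E =
   - \int[leb]_(t in `]0%R, T[) ((b < t)%R%:R * psi t)%:E)%E.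
Proof.
move=> b0; have [bT|Tb] := ltP b T; last first.
  rewrite integral0_eq; last first.
    move=> t; rewrite /= in_itv/= => /andP[_ tT]; rewrite /ramp max_l ?mul0r//.
    by rewrite subr_le0 (le_trans (ltW tT)).
  rewrite integral0_eq ?oppe0// => t; rewrite /= in_itv/= => /andP[_ tT].
  by rewrite ltNge (le_trans (ltW tT))//= mul0r.
have restrict (f : R -> R) : (forall t, t <= b -> f t = 0) -> measurable_fun setT f ->
    (\int[leb]_(t in `]0%R, T[) (f t)%:E = \int[leb]_(t in `[b, T]) (f t)%:E)%E.
  move=> f0 mf.
  rewrite -(@integral_itv_bndoo _ 0 T _ true false); last first.
    by apply/measurable_EFinP; exact: measurable_funTS.
  rewrite [LHS]integral_mkcond [RHS]integral_mkcond; apply: eq_integral => t _.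
  rewrite !patchE !mem_setE !in_itv/=.
  have [tb|bt] := leP t b; first by rewrite f0//; do 2!case: ifP.
  by rewrite (ltW (le_lt_trans b0 bt)) (ltW bt).
have mpsi : measurable_fun setT psi by exact: continuous_measurable_fun.
have mdpsi : measurable_fun setT dpsi by exact: continuous_measurable_fun.
rewrite restrict; last 2 first.
- by move=> t tb; rewrite /ramp max_l ?mul0r// subr_le0.
- by apply: measurable_funM => //; exact: measurable_ramp.
rewrite [in RHS]restrict; last 2 first.
- by move=> t tb; rewrite ltNge tb mul0r.
- apply: measurable_funM => //.
  rewrite (_ : (fun x => _) = \1_(`]b, +oo[%classic : set R)).
    exact: measurable_indic.
  by apply/funext => t; rewrite indicE mem_setE in_itv/= andbT.
transitivity (\int[leb]_(t in `[b, T]) ((t - b) * dpsi t)%:E)%E.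
  apply: eq_integral => t; rewrite mem_setE in_itv/= => /andP[bt _].
  by rewrite /ramp max_r// subr_ge0.
have cid : continuous (fun t : R => t - b).
  by move=> t; apply: cvgB; [exact: cvg_id|exact: cvg_cst].
have did (t : R) : is_derive t 1 (fun t : R => t - b) (1 : R).
  have := is_deriveB (is_derive_id t 1) (is_derive_cst b t 1).
  by rewrite subr0.
rewrite (@integration_by_parts _ (fun t => t - b) psi (fun=> 1) dpsi)//.
- rewrite psiT mulr0 subrr mul0r subr0 add0e; congr (- _)%E.
  rewrite -(integral_itv_obnd_cbnd (r := b)); last first.
    by apply/measurable_EFinP/measurable_funTS; apply: measurable_funM.
  rewrite -[RHS](integral_itv_obnd_cbnd (r := b)); last first.
    apply/measurable_EFinP/measurable_funTS; apply: measurable_funM => //.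
    rewrite (_ : (fun x => _) = \1_(`]b, +oo[%classic : set R)).
      exact: measurable_indic.
    by apply/funext => t; rewrite indicE mem_setE in_itv/= andbT.
  apply: eq_integral => t; rewrite mem_setE in_itv/= => /andP[bt _].
  by rewrite bt.
- by apply: continuous_subspaceT => t; exact: cvg_cst.
- split => [t _||]; first by have [] := did t.
  - by apply: cvg_at_right_filter; exact: cid.
  - by apply: cvg_at_left_filter; exact: cid.
- by move=> t _; rewrite derive1E; apply: derive_val.
- by apply: continuous_subspaceT; exact: cdpsi.
- by move=> t _; rewrite psi'.
Qed.

End by_parts.

(** * Weak time derivatives of functions built from ramps *)

Section time_regular.
Context {R : realType} {N : nat}.
Local Notation E := 'rV[R]_N.
Local Notation mu := (@lebesgue_rV R N).
Local Notation MR := (measurableTypeR R).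
Local Notation leb := (@lebesgue_measure R).
Local Notation muT := (lebesgue_rV N \x @lebesgue_measure R)%E.
Variables (T : R) (Omega : set E).
Hypotheses (T0 : 0 < T) (oO : open Omega) (bO : bounded_set Omega).
Local Notation I := (`]0%R, T[%classic : set MR).
Local Notation Q := (Omega `*` I).

Let measurable_Omega : measurable Omega.
Proof. exact: open_rV_measurable. Qed.

Lemma measurable_cylinder : measurable Q.
Proof. by apply: measurableX; [exact: measurable_Omega|exact: measurable_itv]. Qed.

Lemma finite_time_interval : (leb I < +oo)%E.
Proof. by have -> := @lebesgue_measure_itv R `]0%R, T[; rewrite /= lte_fin T0 -EFinD ltry. Qed.

Lemma finite_cylinder : (muT Q < +oo)%E.
Proof.
have := product_measure1E mu leb measurable_Omega (measurable_itv `]0%R, T[).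
move=> /= ->; rewrite lte_mul_pinfty//.
- rewrite ge0_fin_numE//; exact: bounded_open_finite_measure.
- exact: finite_time_interval.
Qed.

Lemma continuous_bounded_cylinder (f : E * R -> R) : continuous f ->
  exists C : R, forall z, Q z -> `|f z| <= C.
Proof.
move=> cf; have [M M0 HM] := bounded_set_box bO.
pose K : set (E * R) := [set v : E | forall i, v ord0 i \in `[- M, M]] `*` `[0, T].
have cK : compact K.
  apply: compact_setX; last exact: segment_compact.
  apply: (@rV_compact _ _ (fun=> `[- M, M]%classic)) => _.
  exact: segment_compact.
have /compact_bounded[C [_ HC]] : compact (f @` K).
  by apply: continuous_compact => //; exact: continuous_subspaceT.
exists (`|C| + 1) => -[x t] [/= Ox]; rewrite in_itv/= => /andP[t0 tT].
apply: HC; first by rewrite (le_lt_trans (ler_norm C))// ltrDl.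
exists (x, t) => //; split => /=.
  by move=> i; rewrite in_itv/= -ler_norml; exact: HM.
by rewrite in_itv/= !ltW.
Qed.

Lemma square_integrable_continuous (f : E * R -> R) : continuous f ->
  square_integrable muT Q f.
Proof.
move=> cf; have [C HC] := continuous_bounded_cylinder cf.
apply: (square_integrable_bounded measurable_cylinder finite_cylinder _ HC).
by apply: measurable_funTS; exact: continuous_rVR_measurable.
Qed.

(** What a comparison function v with time derivative g has to satisfy in
    Omega x ]0, T[, apart from its Sobolev regularity in space; v itself serves
    as its continuous representative. *)
Definition time_regular (v g : E -> R -> R) : Prop :=
  [/\ measurable_fun [set: E * MR] (fun z => v z.1 z.2),
      measurable_fun [set: E * MR] (fun z => g z.1 z.2),
      square_integrable muT Q (fun z => v z.1 z.2) /\
      square_integrable muT Q (fun z => g z.1 z.2),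
      weak_time_derivative Omega T v g &
      continuousL2 Omega T (fun t x => v x t)].

Section test.
Variable phi : E * R -> R.
Hypothesis tphi : test_function Omega T phi.

Lemma test_continuous : continuous phi.
Proof. by have [/(_ [::])[]] := tphi. Qed.

Lemma test_D_continuous : continuous ('D_(0, 1) phi : E * R -> R).
Proof. by have [/(_ [:: (0, 1)])[]] := tphi. Qed.

Lemma test_boundary x t : ~ (0 < t < T) -> phi (x, t) = 0.
Proof.
move=> nt; have [_ [K [_ KQ K0]]] := tphi; apply: K0 => /KQ[_].
by rewrite /= in_itv.
Qed.

(** The directional derivative along (0, 1) is the ordinary derivative of the
    section in t. *)
Lemma test_is_derive x t :
  is_derive t (1 : R) (fun t => phi (x, t)) ('D_(0, 1) phi (x, t)).
Proof.
have [/(_ [::])[_ /= D0] _] := tphi.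
have {D0} := D0 (x, t) (0, 1).
have E1 : (fun h : R => h^-1 *: ((phi \o shift (x, t)) (h *: (0, 1)) - phi (x, t))) =
    (fun h : R => h^-1 *: (((fun t => phi (x, t)) \o shift t) (h *: 1) - phi (x, t))).
  apply/funext => h /=; congr (_ *: (phi _ - _)).
  transitivity ((h *: 0 + x, h *: (1 : R) + t) : E * R) => //.
  by rewrite scaler0 add0r.
rewrite /derivable E1 => D0.
by split; rewrite // /derive E1.
Qed.

End test.

Lemma weak_derivative_integrable (v : E -> R -> R) (psi : E * R -> R) :
  continuous psi -> square_integrable muT Q (fun z => v z.1 z.2) ->
  muT.-integrable Q (fun z => (v z.1 z.2 * psi z)%:E).
Proof.
move=> cpsi Lv; apply: square_integrableM => //; first exact: measurable_cylinder.
exact: square_integrable_continuous.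
Qed.

Lemma time_regularD v g v' g' : time_regular v g -> time_regular v' g' ->
  time_regular (fun x t => v x t + v' x t) (fun x t => g x t + g' x t).
Proof.
move=> [mv mg [Lv Lg] wd [c1 c2]] [mv' mg' [Lv' Lg'] wd' [c1' c2']].
have mQ := measurable_cylinder.
have ms (f : E -> R -> R) t : measurable_fun [set: E * MR] (fun z => f z.1 z.2) ->
    measurable_fun Omega (f^~ t).
  by move=> mf; apply: measurable_funTS; exact: (measurableT_comp mf (pair2_measurable t)).
split.
- exact: measurable_funD.
- exact: measurable_funD.
- by split; exact: square_integrableD.
- move=> phi tphi.
  have cphi := test_continuous tphi; have cD := test_D_continuous tphi.
  under eq_integral do rewrite mulrDl EFinD.
  under [in RHS]eq_integral do rewrite mulrDl EFinD.
  rewrite !integralD//; do ?exact: weak_derivative_integrable.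
  rewrite wd// wd'//.
  rewrite oppeD//; apply: fin_num_adde_defr.
  by apply: integrable_fin_num => //; exact: weak_derivative_integrable.
- have mO := measurable_Omega.
  split=> [t Tt|t0 Tt0].
    apply: square_integrable_L2 => //; apply: square_integrableD => //.
    - by apply: L2_square_integrable; [exact: ms|exact: c1].
    - by apply: L2_square_integrable; [exact: ms|exact: c1'].
  have H : (2%:E * sqnormL2 mu Omega (fun x => v x t - v x t0)%R +
      2%:E * sqnormL2 mu Omega (fun x => v' x t - v' x t0)%R)%E
      @[t --> within `[0, T] (nbhs t0)] --> (0 : \bar R)%E.
    rewrite [X in _ --> X](_ : _ = 2%:E * 0 + 2%:E * 0)%E; last by rewrite !mule0 adde0.
    apply: cvgeD; first by rewrite !mule0.
    - by apply: cvgeZl => //; exact: c2.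
    - by apply: cvgeZl => //; exact: c2'.
  apply: squeeze_cvge H; [|exact: cvg_cst].
  apply: nearW => t; rewrite sqnormL2_ge0/=.
  rewrite (_ : (fun x => _) = fun x => (v x t - v x t0) + (v' x t - v' x t0)).
    by apply: sqnormL2D_le => //; apply: measurable_funB; exact: ms.
  by apply/funext => x; ring.
Qed.

Lemma time_regularZ k v g : time_regular v g ->
  time_regular (fun x t => k * v x t) (fun x t => k * g x t).
Proof.
move=> [mv mg [Lv Lg] wd [c1 c2]].
have mQ := measurable_cylinder; have mO := measurable_Omega.
have ms (f : E -> R -> R) t : measurable_fun [set: E * MR] (fun z => f z.1 z.2) ->
    measurable_fun Omega (f^~ t).
  by move=> mf; apply: measurable_funTS; exact: (measurableT_comp mf (pair2_measurable t)).
split.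
- exact: measurable_funM.
- exact: measurable_funM.
- by split; exact: square_integrableZ.
- move=> phi tphi.
  have cphi := test_continuous tphi; have cD := test_D_continuous tphi.
  under eq_integral do rewrite -mulrA EFinM.
  under [in RHS]eq_integral do rewrite -mulrA EFinM.
  rewrite !integralZl//; do ?exact: weak_derivative_integrable.
  by rewrite wd// muleN.
- split=> [t Tt|t0 Tt0].
    apply: square_integrable_L2 => //; apply: square_integrableZ => //.
    by apply: L2_square_integrable; [exact: ms|exact: c1].
  have H : ((k ^+ 2)%:E * sqnormL2 mu Omega (fun x => v x t - v x t0)%R)%E
      @[t --> within `[0, T] (nbhs t0)] --> (0 : \bar R)%E.
    rewrite -[X in _ --> X](mule0 (k ^+ 2)%:E).
    by apply: cvgeZl => //; exact: c2.
  apply: cvg_trans H; apply: near_eq_cvg; apply: nearW => t.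
  rewrite -sqnormL2Z//; last by apply: measurable_funB; exact: ms.
  by congr sqnormL2; apply/funext => x; ring.
Qed.

Lemma time_regular_sum n (f h : 'I_n.+1 -> E -> R -> R) :
  (forall i, time_regular (f i) (h i)) ->
  time_regular (fun x t => \sum_(i < n.+1) f i x t) (fun x t => \sum_(i < n.+1) h i x t).
Proof.
elim: n f h => [|n IH] f h H.
  rewrite (_ : (fun _ => _) = f ord0); last first.
    by apply/funext => x; apply/funext => t; rewrite big_ord1.
  rewrite (_ : (fun x t => \sum_(i < 1) h i x t) = h ord0); first exact: H.
  by apply/funext => x; apply/funext => t; rewrite big_ord1.
under eq_fun do under eq_fun do rewrite big_ord_recr/=.
rewrite [X in time_regular _ X](_ : _ = fun x t =>
  \sum_(i < n.+1) h (widen_ord (leqnSn n.+1) i) x t + h ord_max x t); last first.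
  by apply/funext => x; apply/funext => t; rewrite big_ord_recr.
apply: time_regularD; last exact: H.
by apply: (IH (fun i => f (widen_ord (leqnSn n.+1) i)) (fun i => h (widen_ord (leqnSn n.+1) i))).
Qed.

(** For eta(t) chi(x), Fubini reduces the weak derivative to integration by parts
    in t for eta against each section of the test function, which is the last
    hypothesis on eta. *)
Lemma time_regular_separated (eta deta : R -> R) (C : R) (chi : E -> R) :
  continuous eta -> measurable_fun [set: R] deta ->
  (forall t, t \in `[0, T] -> `|eta t| <= C /\ `|deta t| <= C) ->
  (forall psi dpsi : R -> R, (forall t, is_derive t (1 : R) psi (dpsi t)) ->
     continuous dpsi -> psi 0 = 0 -> psi T = 0 ->
     (\int[leb]_(t in `]0%R, T[) (eta t * dpsi t)%:E =
   - \int[leb]_(t in `]0%R, T[) (deta t * psi t)%:E)%E) ->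
  measurable_fun setT chi -> L2 mu Omega chi ->
  time_regular (fun x t => eta t * chi x) (fun x t => deta t * chi x).
Proof.
move=> ceta mdeta bnd parts mchi L2chi.
have mQ := measurable_cylinder; have mO := measurable_Omega.
have Lchi : square_integrable mu Omega chi.
  by apply: L2_square_integrable => //; exact: measurable_funTS.
have Lchi1 := @square_integrable_prod_fst _ _ _ _ _ mu leb _ _ mO (measurable_itv _)
  chi finite_time_interval Lchi.
have meta : measurable_fun [set: R] eta by exact: continuous_measurable_fun.
have msnd (f : R -> R) : measurable_fun [set: R] f ->
    measurable_fun [set: E * MR] (fun z => f z.2).
  by move=> mf; exact: (measurableT_comp mf measurable_snd).
have mfst : measurable_fun [set: E * MR] (fun z => chi z.1).
  exact: (measurableT_comp mchi measurable_fst).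
have bQ (z : E * MR) : Q z -> `|eta z.2| <= C /\ `|deta z.2| <= C.
  move=> [_ /=]; rewrite in_itv/= => /andP[t0 tT].
  by apply: bnd; rewrite in_itv/= !ltW.
have Leta : square_integrable muT Q (fun z => eta z.2 * chi z.1).
  apply: (@square_integrable_mul_bounded _ _ _ muT Q mQ _ _ C) => //.
    by apply: measurable_funTS; exact: msnd.
  by move=> z /bQ[].
have Ldeta : square_integrable muT Q (fun z => deta z.2 * chi z.1).
  apply: (@square_integrable_mul_bounded _ _ _ muT Q mQ _ _ C) => //.
    by apply: measurable_funTS; exact: msnd.
  by move=> z /bQ[].
split.
- by apply: measurable_funM => //; exact: msnd.
- by apply: measurable_funM => //; exact: msnd.
- by [].
- move=> phi tphi.
  have cphi := test_continuous tphi; have cD := test_D_continuous tphi.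
  have i1 := @weak_derivative_integrable (fun x t => eta t * chi x) _ cD Leta.
  have i2 := @weak_derivative_integrable (fun x t => deta t * chi x) _ cphi Ldeta.
  rewrite fubini_setX1//.
  have := integralZl mQ i2 (-1); rewrite EFinN mulN1e => <-.
  rewrite fubini_setX1//; last by have := integrableZl mQ (-1) i2.
  apply: eq_integral => x _ /=.
  have D x' t := test_is_derive tphi x' t.
  transitivity (\int[leb]_(t in `]0%R, T[) (eta t * (chi x * 'D_(0, 1) phi (x, t)))%:E)%E.
    by apply: eq_integral => t _; rewrite mulrA.
  rewrite (parts (fun t => chi x * phi (x, t))).
  - rewrite -mulN1e -[in LHS]EFinN -integralZl//.
      by apply: eq_integral => t _; rewrite -!EFinM; congr EFin; ring.
    have cpx : continuous (fun t => phi (x, t)).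
      move=> t; apply: differentiable_continuous; apply/derivable1_diffP.
      by have [] := D x t.
    have [C' HC'] : exists C' : R, forall t, t \in `[0, T] -> `|phi (x, t)| <= C'.
      have /compact_bounded[c [_ Hc]] : compact ((fun t => phi (x, t)) @` `[0, T]).
        apply: continuous_compact; last exact: segment_compact.
        exact: continuous_subspaceT.
      exists (`|c| + 1) => t tT; apply: Hc.
        by rewrite (le_lt_trans (ler_norm c))// ltrDl.
      by exists t.
    have mI : measurable `]0%R, T[%classic by exact: measurable_itv.
    apply: square_integrableM => //.
    - apply: (@square_integrable_bounded _ _ _ leb _ mI _ C).
      + exact: finite_time_interval.
      + exact: measurable_funTS.
      + by move=> t; rewrite /= in_itv/= => /andP[t0 tT]; apply: (bnd _ _).2; rewrite in_itv/= !ltW.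
    - apply: (@square_integrable_bounded _ _ _ leb _ mI _ (`|chi x| * C')).
      + exact: finite_time_interval.
      + apply: measurable_funTS; apply: measurable_funM => //; exact: continuous_measurable_fun.
      + move=> t; rewrite /= in_itv/= => /andP[t0 tT]; rewrite normrM ler_wpM2l// HC'//.
        by rewrite in_itv/= !ltW.
  - move=> t; apply: cvgM; first exact: cvg_cst.
    apply: (@continuous_comp _ _ _ (fun t => (x, t)) ('D_(0, 1) phi)); last exact: cD.
    exact: (@cvg_pair _ _ _ (nbhs t) (nbhs x) (nbhs t) _ _ _ (fun=> x) id (cvg_cst x) cvg_id).
  - by rewrite (test_boundary tphi) ?mulr0// ltxx.
  - by rewrite (test_boundary tphi) ?mulr0// ltxx andbF.
- split=> [t Tt|t0 Tt0].
    by apply: square_integrable_L2 => //; exact: square_integrableZ.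
  have H : (((eta t - eta t0) ^+ 2)%:E * sqnormL2 mu Omega chi)%E
      @[t --> within `[0, T] (nbhs t0)] --> (0 : \bar R)%E.
    rewrite -[X in _ --> X](mul0e (sqnormL2 mu Omega chi)).
    rewrite -(fineK (_ : sqnormL2 mu Omega chi \is a fin_num)); last first.
      by rewrite ge0_fin_numE ?sqnormL2_ge0//; case: L2chi.
    apply: cvgeZr => //; apply/fine_cvgP; split; first exact: nearW.
    rewrite [X in _ --> X](_ : _ = (eta t0 - eta t0) ^+ 2); last by rewrite subrr expr0n.
    have cd : eta t - eta t0 @[t --> within `[0, T] (nbhs t0)] --> eta t0 - eta t0.
      apply: cvgB; last exact: cvg_cst.
      by apply: cvg_within_filter; exact: ceta.
    by apply: cvgM; exact: cd.
  apply: cvg_trans H; apply: near_eq_cvg; apply: nearW => t.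
  rewrite -sqnormL2Z//; last exact: measurable_funTS.
  by congr sqnormL2; apply/funext => x; ring.
Qed.

Lemma time_regular_cst (chi : E -> R) :
  measurable_fun setT chi -> L2 mu Omega chi ->
  time_regular (fun x _ => chi x) (fun _ _ => 0).
Proof.
move=> mchi L2chi.
have : time_regular (fun x t => (fun=> 1) t * chi x) (fun x t => (fun=> 0) t * chi x).
  apply: (@time_regular_separated _ _ 1) => //.
  - by move=> t; exact: cvg_cst.
  - by move=> t _; rewrite normr1 normr0.
  - move=> psi dpsi D cD p0 pT.
    under eq_integral do rewrite mul1r.
    rewrite (integral_derivative0 T0 D)//.
    by rewrite integral0_eq ?oppe0// => t _; rewrite mul0r.
rewrite (_ : (fun x t => 1 * chi x) = (fun x _ => chi x)); last first.
  by apply/funext => x; apply/funext => t; rewrite mul1r.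
rewrite (_ : (fun x t => 0 * chi x) = (fun _ _ => 0))//.
by apply/funext => x; apply/funext => t; rewrite mul0r.
Qed.

Lemma time_regular_ramp (b : R) (chi : E -> R) : 0 <= b ->
  measurable_fun setT chi -> L2 mu Omega chi ->
  time_regular (fun x t => ramp b t * chi x) (fun x t => (b < t)%R%:R * chi x).
Proof.
move=> b0 mchi L2chi; apply: (@time_regular_separated _ _ (Num.max 1 T)) => //.
- exact: continuous_ramp.
- rewrite (_ : (fun x => _) = \1_(`]b, +oo[%classic : set R)).
    exact: measurable_indic.
  by apply/funext => t; rewrite indicE mem_setE in_itv/= andbT.
- move=> t; rewrite in_itv/= => /andP[t0 tT]; split.
    by rewrite ger0_norm ?ramp_ge0// le_max (@ramp_le _ T)// ?orbT// ltW.
  by rewrite ger0_norm// le_max; case: (b < t); rewrite ?lexx ?ler01.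
- by move=> psi dpsi D cD p0 pT; exact: ramp_by_parts.
Qed.

End time_regular.

(** * A jointly measurable energy density *)

Section measurable_parameter.
Context d1 d2 d3 (T1 : measurableType d1) (T2 : measurableType d2)
  (T3 : measurableType d3) (R : realType).
Variable m1 : {sigma_finite_measure set T1 -> \bar R}.
Variable m2 : {sigma_finite_measure set T2 -> \bar R}.
Local Open Scope ereal_scope.

(** Two successive applications of the Tonelli theorem, after the parameter t has
    been grouped with the first variable. *)
Lemma measurable_integral_product (f : (T1 * T2) * T3 -> \bar R) :
  measurable_fun setT f -> (forall y, 0 <= f y) ->
  measurable_fun setT (fun t => \int[m1 \x m2]_z f (z, t)).
Proof.
move=> mf f0.
pose g (y : (T1 * T3) * T2) := f ((y.1.1, y.2), y.1.2).
have mg : measurable_fun setT g.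
  apply: (measurableT_comp mf); apply: measurable_fun_pair; last first.
    by apply: measurableT_comp; [exact: measurable_snd|exact: measurable_fst].
  apply: measurable_fun_pair; last exact: measurable_snd.
  by apply: measurableT_comp; [exact: measurable_fst|exact: measurable_fst].
have mF := measurable_fun_fubini_tonelli_F (m2 := m2) g mg (fun y => f0 _).
have F0 y : 0 <= fubini_F m2 g y by apply: integral_ge0 => z _; exact: f0.
have := measurable_fun_fubini_tonelli_G (m1 := m1) _ mF F0.
rewrite (_ : fubini_G _ _ = fun t => \int[m1 \x m2]_z f (z, t))//.
apply/funext => t; rewrite fubini_tonelli1//.
exact: (measurableT_comp mf (pair2_measurable t)).
Qed.

End measurable_parameter.

Section caratheodory.
Context d (T : measurableType d) (R : realType).
Local Notation MR := (measurableTypeR R).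

Definition grid_point (i : int * nat) : R := i.1%:~R / i.2.+1%:R.

Definition floor_grid (k : nat) (xi : R) : R := grid_point (Num.floor (k.+1%:R * xi), k).

Lemma cvg_floor_grid (xi : R) : floor_grid k xi @[k --> \oo] --> xi.
Proof.
apply: (@squeeze_cvgr _ _ _ _ (fun k => xi - k.+1%:R^-1) (cst xi)); last exact: cvg_cst.
  apply: nearW => k; rewrite /floor_grid /grid_point/=.
  have k0 : (0 : R) < k.+1%:R by rewrite ltr0n.
  have := floor_itv (k.+1%:R * xi); rewrite intrD => /andP[h1 h2].
  apply/andP; split.
    rewrite ler_pdivlMr// mulrBl mulVf ?gt_eqF// mulrC; lra.
  by rewrite ler_pdivrMr// [leRHS]mulrC.
rewrite -[X in _ --> X]subr0; apply: cvgB; [exact: cvg_cst|exact: cvg_harmonic].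
Qed.

(** By continuity, G(z, xi) is the limit of its values at the grid points
    floor((k + 1) xi) / (k + 1), and on each piece where the grid point is
    constant the approximation is measurable in z. Only countably many
    values of xi are involved. *)
Lemma caratheodory_measurable (G : T -> R -> R) :
  (forall i, measurable_fun [set: T] (fun z => G z (grid_point i))) ->
  (forall z, continuous (G z)) ->
  measurable_fun [set: T * MR] (fun y => G y.1 y.2).
Proof.
move=> mG cG.
apply: (@measurable_fun_cvg _ _ _ _ (fun k y => G y.1 (floor_grid k y.2))); last first.
  move=> y _; apply: (@cvg_comp _ _ _ _ (G y.1)); first exact: cvg_floor_grid.
  exact: cG.
move=> k _ B mB; rewrite setTI.
rewrite (_ : _ @^-1` _ = \bigcup_(m : int)
   ((fun y : T * MR => G y.1 (grid_point (m, k))) @^-1` B `&`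
    (fun y : T * MR => k.+1%:R * y.2) @^-1` `[m%:~R, (m + 1)%:~R[)); last first.
  apply/seteqP; split => [y By|y [m _ [By]]].
    by exists (Num.floor (k.+1%:R * y.2)) => //; split => //=; rewrite in_itv/=; exact: floor_itv.
  by rewrite /= in_itv/= => /floor_def h; rewrite /floor_grid h.
apply: countable_bigcupT_measurable; first exact: countableP.
move=> m; apply: measurableI; rewrite -[X in measurable X]setTI.
  have : measurable_fun [set: T * MR] (fun y => G y.1 (grid_point (m, k))).
    exact: (measurableT_comp (mG (m, k)) measurable_fst).
  by apply.
have : measurable_fun [set: T * MR] (fun y => k.+1%:R * y.2).
  by apply: measurable_funM => //; exact: measurable_snd.
by apply => //; exact: measurable_itv.
Qed.

End caratheodory.

Section energy_density.
Context {R : realType} {N : nat}.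
Local Notation E := 'rV[R]_N.
Local Notation mu := (@lebesgue_rV R N).
Local Notation mu2 := (lebesgue_rV N \x lebesgue_rV N)%E.
Local Notation MR := (measurableTypeR R).

(** Strict convexity is only kept at midpoints and for almost every z: this is
    what the equality case consumes. *)
Record energy_density (G : E * E -> R -> R) : Prop := EnergyDensity {
  density_ge0 : forall z xi, 0 <= G z xi;
  density_measurable : measurable_fun [set: (E * E) * MR] (fun y => G y.1 y.2);
  density_convex : forall z xi eta t, 0 <= t -> t <= 1 ->
    G z (t * xi + (1 - t) * eta) <= t * G z xi + (1 - t) * G z eta;
  density_strict : {ae mu2, forall z, forall xi eta, xi != eta ->
    G z ((xi + eta) / 2) < (G z xi + G z eta) / 2} }.

Lemma strictly_convex_le (f : R -> R) : strictly_convex f ->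
  forall xi eta t, 0 <= t -> t <= 1 ->
    f (t * xi + (1 - t) * eta) <= t * f xi + (1 - t) * f eta.
Proof.
move=> sf xi eta t; rewrite le_eqVlt => /predU1P[<-|t0].
  by rewrite !mul0r !subr0 !mul1r !add0r.
rewrite le_eqVlt => /predU1P[->|t1].
  by rewrite !subrr !mul0r !mul1r !addr0.
have [->|ne] := eqVneq xi eta.
  by rewrite -!mulrDl addrC subrK !mul1r.
exact/ltW/sf.
Qed.

(** Off a single null set M, the values of H at the countably many grid points
    agree with Borel functions of (x, y), and x differs from y. The density is
    H(x, y, xi) / |x - y|^N off M, and 0 on M; the energy does not change, and
    measurability in (x, y) at the grid points suffices by continuity in xi. *)
Lemma energy_density_of (H : E -> E -> R -> R) : (0 < N)%N ->
  (forall xi : R, ae_measurable mu2 setT (fun z => H z.1 z.2 xi)) ->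
  (forall x y, continuous (H x y)) ->
  (forall x y xi, x != y -> 0 <= H x y xi) ->
  (forall x y, strictly_convex (H x y)) ->
  exists2 G, energy_density G &
    forall psi, energy H psi = (\int[mu2]_z (G z (psi z.1 - psi z.2))%:E)%E.
Proof.
move=> N0 mH cH H0 sH.
pose q (n : nat) : R := if unpickle n is Some i then grid_point R i else 0.
have [g hg] := choice (fun n => let: ex_intro2 g mg eg := mH (q n) in
   ex_intro (fun g => measurable_fun setT g /\ (\forall z \ae mu2, setT z -> H z.1 z.2 (q n) = g z))
     g (conj mg eg)).
have : {ae mu2, forall z : E * E, (z.1 != z.2) /\ forall n, H z.1 z.2 (q n) = g n z}.
  have h : {ae mu2, forall z, forall n, H z.1 z.2 (q n) = g n z}.
    by apply: ae_foralln => n; have [_] := hg n; apply: filterS => z; exact.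
  by apply: filterS2 (ae_off_diagonal N0) h => z; split.
move=> [M [mM M0 sM]].
have good z : ~ M z -> z.1 != z.2 /\ forall n, H z.1 z.2 (q n) = g n z.
  by move=> nM; apply: contrapT => nz; apply: nM; exact: sM.
(* The real power makes the weight measurable by composition. *)
pose w (z : E * E) : R := (enorm (z.1 - z.2) `^ N%:R)^-1.
have w0 z : 0 <= w z by rewrite invr_ge0 powR_ge0.
have wE (z : E * E) : (enorm (z.1 - z.2) ^+ N)^-1 = w z.
  by rewrite /w powR_mulrn// enorm_ge0.
have wgt0 z : ~ M z -> 0 < w z.
  move=> /good[zz _]; rewrite invr_gt0 powR_gt0// sqrtr_gt0 lt_neqAle eq_sym.
  have S0 (i : 'I_N) : true -> 0 <= (z.1 - z.2) ord0 i ^+ 2 by rewrite sqr_ge0.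
  rewrite sumr_ge0// andbT psumr_neq0//.
  apply/hasP; apply: contrapT => nh; move/eqP : zz; apply; apply/rowP => i.
  apply/eqP; rewrite -subr_eq0; apply: contrapT => /negP ne; apply: nh.
  exists i; first exact: mem_index_enum.
  by rewrite /= !mxE exprn_even_gt0.
pose G (z : E * E) xi := \1_(~` M) z * (w z * H z.1 z.2 xi).
have G_M z xi : M z -> G z xi = 0.
  by move=> Mz; rewrite /G indicE memNset ?mul0r//= => /(_ Mz).
have G_nM z xi : ~ M z -> G z xi = w z * H z.1 z.2 xi.
  by move=> nM; rewrite /G indicE mem_set//= mul1r.
exists G.
  split.
  - move=> z xi; have [Mz|nM] := pselect (M z); first by rewrite G_M.
    by rewrite G_nM// mulr_ge0// H0//; have [] := good z nM.
  - apply: caratheodory_measurable.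
      move=> i; pose n := pickle i.
      have qn : q n = grid_point R i by rewrite /q /n pickleK.
      rewrite (_ : (fun z => _) = fun z => \1_(~` M) z * (w z * g n z)).
        apply: measurable_funM; first by apply: measurable_indic; exact: measurableC.
        apply: measurable_funM; last by have [] := hg n.
        by apply: measurable_powR_inv; exact: measurable_enormB.
      apply/funext => z; have [Mz|nM] := pselect (M z).
        by rewrite G_M// indicE memNset ?mul0r//= => /(_ Mz).
      by rewrite G_nM// indicE mem_set//= mul1r -qn; have [_ ->] := good z nM.
    move=> z xi; apply: cvgM; first exact: cvg_cst.
    by apply: cvgM; [exact: cvg_cst|exact: cH].
  - move=> z xi eta t t0 t1.
    have [Mz|nM] := pselect (M z); first by rewrite !G_M// !mulr0 addr0.
    rewrite !G_nM// mulrCA [X in _ <= _ + X]mulrCA -mulrDr ler_wpM2l//.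
    exact: strictly_convex_le.
  - exists M; split => // z /= h; apply: contrapT => nM; apply: h => xi eta ne.
    rewrite !G_nM// -mulrDr -mulrA ltr_pM2l ?wgt0//.
    have := sH z.1 z.2 xi eta (2^-1) ne.
    rewrite invr_gt0 ltr0n => /(_ isT).
    have h2 : (2^-1 : R) < 1 by lra.
    move=> /(_ h2); rewrite (_ : 1 - 2^-1 = 2^-1 :> R); last by lra.
    by rewrite -!mulrDr mulrC [X in _ < X -> _]mulrC.
move=> psi; apply: ae_eq_integral_nonmeasurable; exists M; split => // z /= h.
apply: contrapT => nM; apply: h => _; rewrite G_nM// mulrC; congr (_ * _)%:E.
by rewrite wE.
Qed.

Section with_density.
Variable G : E * E -> R -> R.
Hypothesis dG : energy_density G.

Definition density_energy (psi : E -> R) : \bar R :=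
  (\int[mu2]_z (G z (psi z.1 - psi z.2))%:E)%E.

Lemma density_energy_ge0 psi : (0 <= density_energy psi)%E.
Proof. by apply: integral_ge0 => z _; rewrite lee_fin density_ge0. Qed.

(** A null set in R^N yields a null set in R^N x R^N for either variable. *)
Lemma density_energy_ae_eq psi phi : {ae mu, forall x, psi x = phi x} ->
  density_energy psi = density_energy phi.
Proof.
move=> /ae_mu2_fst h; apply: ae_eq_integral_nonmeasurable.
by apply: filterS h => z [-> ->] _.
Qed.

Lemma measurable_density_comp d (T : measurableType d) (h : T -> E * E) (f : T -> R) :
  measurable_fun setT h -> measurable_fun setT f ->
  measurable_fun setT (fun a => G (h a) (f a)).
Proof.
move=> mh mf; have := measurableT_comp (density_measurable dG) (_ : measurable_fun setT (fun a => (h a, f a) : (E * E) * MR)).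
apply; exact: measurable_fun_pair.
Qed.

Lemma measurable_difference (psi : E -> R) : measurable_fun setT psi ->
  measurable_fun [set: E * E] (fun z => psi z.1 - psi z.2).
Proof.
move=> mf; apply: measurable_funB.
- exact: (measurableT_comp mf measurable_fst).
- exact: (measurableT_comp mf measurable_snd).
Qed.

Lemma density_energy_convex (psi phi : E -> R) t : 0 <= t -> t <= 1 ->
  measurable_fun setT psi -> measurable_fun setT phi ->
  (density_energy (fun x => t * psi x + (1 - t) * phi x)%R <=
   t%:E * density_energy psi + (1 - t)%:E * density_energy phi)%E.
Proof.
move=> t0 t1 mpsi mphi.
have mG (f : E -> R) : measurable_fun setT f ->
    measurable_fun setT (fun z : E * E => (G z (f z.1 - f z.2))%:E).
  move=> mf; apply/measurable_EFinP; apply: measurable_density_comp => //.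
  exact: measurable_difference.
rewrite /density_energy -!ge0_integralZl//; do ?[exact: mG
  | by move=> z _; rewrite lee_fin density_ge0 | by rewrite lee_fin subr_ge0].
rewrite -ge0_integralD//; last 4 first.
- by move=> z _; rewrite mule_ge0// lee_fin density_ge0.
- by apply: measurable_funeM; exact: mG.
- by move=> z _; rewrite mule_ge0// lee_fin ?subr_ge0// density_ge0.
- by apply: measurable_funeM; exact: mG.
apply: le_integral_nonmeasurable => z _; first by rewrite lee_fin density_ge0.
rewrite -!EFinM -EFinD lee_fin.
rewrite (_ : _ - _ = t * (psi z.1 - psi z.2) + (1 - t) * (phi z.1 - phi z.2)); last by ring.
exact: density_convex.
Qed.

Lemma measurable_density_path (f : E -> R -> R) :
  measurable_fun [set: E * MR] (fun z => f z.1 z.2) ->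
  measurable_fun [set: (E * E) * MR] (fun y => (G y.1 (f y.1.1 y.2 - f y.1.2 y.2))%:E).
Proof.
move=> mf; apply/measurable_EFinP; apply: measurable_density_comp.
  exact: measurable_fst.
have m1 : measurable_fun [set: (E * E) * MR] (fun y => (y.1.1, y.2) : E * MR).
  apply: measurable_fun_pair; last exact: measurable_snd.
  by apply: measurableT_comp; [exact: measurable_fst|exact: measurable_fst].
have m2 : measurable_fun [set: (E * E) * MR] (fun y => (y.1.2, y.2) : E * MR).
  apply: measurable_fun_pair; last exact: measurable_snd.
  by apply: measurableT_comp; [exact: measurable_snd|exact: measurable_fst].
apply: measurable_funB.
- exact: (measurableT_comp mf m1).
- exact: (measurableT_comp mf m2).
Qed.

Lemma measurable_density_energy (f : E -> R -> R) :
  measurable_fun [set: E * MR] (fun z => f z.1 z.2) ->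
  measurable_fun [set: MR] (fun t => density_energy (f^~ t)).
Proof.
move=> /measurable_density_path mf.
have := @measurable_integral_product _ _ _ _ _ _ _ mu mu _ mf.
by apply => y; rewrite lee_fin; exact: density_ge0.
Qed.

End with_density.
End energy_density.

(** * Representatives in L^2 and integrals over time intervals *)

Section L2_ae.
Context d (T : measurableType d) (R : realType).
Variables (mu : {measure set T -> \bar R}) (D : set T).
Hypothesis mD : measurable D.

Lemma L2_representative (f : T -> R) : L2 mu D f ->
  exists2 g, square_integrable mu D g & \forall x \ae mu, D x -> f x = g x.
Proof.
move=> [[g mg fg] f2]; exists g => //; apply: L2_square_integrable => //.
split; first exact: measurable_ae_measurable.
by rewrite -(ae_eq_sqnormL2 fg).
Qed.

Lemma sqnormL2D_le_ae (f g : T -> R) : ae_measurable mu D f -> ae_measurable mu D g ->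
  (sqnormL2 mu D (fun x => f x + g x)%R <=
   2%:E * sqnormL2 mu D f + 2%:E * sqnormL2 mu D g)%E.
Proof.
move=> [f' mf ff] [g' mg gg]; rewrite (ae_eq_sqnormL2 ff) (ae_eq_sqnormL2 gg).
rewrite (@ae_eq_sqnormL2 _ _ _ _ _ _ (fun x => f' x + g' x)); last first.
  by apply: filterS2 ff gg => x fx gx Dx; rewrite fx// gx.
exact: sqnormL2D_le.
Qed.

Lemma L2_ae_eq (f g : T -> R) : (\forall x \ae mu, D x -> f x = g x) ->
  L2 mu D f -> L2 mu D g.
Proof.
move=> fg [[h mh fh] f2]; split; last by rewrite -(ae_eq_sqnormL2 fg).
by exists h => //; apply: filterS2 fg fh => x E1 E2 Dx; rewrite -E1// E2.
Qed.

Lemma L2D (f g : T -> R) : L2 mu D f -> L2 mu D g -> L2 mu D (fun x => f x + g x).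
Proof.
move=> [mf f2] [mg g2]; split; first exact: ae_measurableD.
by apply: le_lt_trans (sqnormL2D_le_ae mf mg) _; apply: lte_add_pinfty; apply: lte_mul_pinfty.
Qed.

Lemma L2Z k (f : T -> R) : L2 mu D f -> L2 mu D (fun x => k * f x).
Proof.
move=> /L2_representative[g Lg fg].
apply: (@L2_ae_eq (fun x => k * g x)).
  by apply: filterS fg => x E Dx; rewrite E.
by apply: square_integrable_L2 => //; exact: square_integrableZ.
Qed.

End L2_ae.

Section time_intervals.
Context {R : realType}.
Local Notation leb := (@lebesgue_measure R).

(** The common endpoint is a null set. *)
Lemma integral_interval_split (f : R -> \bar R) (a b c : R) : a < b -> b <= c ->
  measurable_fun `]a, c[ f ->
  (\int[leb]_(t in `]a, c[) f t =
   \int[leb]_(t in `]a, b[) f t + \int[leb]_(t in `]b, c[) f t)%E.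
Proof.
move=> ab; rewrite le_eqVlt => /predU1P[<-|bc] mf.
  by rewrite set_itvoo0 integral_set0 adde0.
have sub : `]a, b[ `<=` `]a, c[.
  by apply: subset_itvl; rewrite bnd_simp ltW.
have sub' : `[b, c[ `<=` `]a, c[.
  by move=> t /=; rewrite !in_itv/= => /andP[bt ->]; rewrite (lt_le_trans ab bt).
have -> : `]a, c[%classic = (`]a, b[ `|` `[b, c[ : set R).
  apply/seteqP; split => [t|t [/sub|/sub']]//.
  rewrite /= !in_itv/= => /andP[-> ->]; have [tb|bt] := ltP t b; [by left|by right].
rewrite integral_setU//.
- congr (_ + _)%E; apply: (@integral_itv_bndoo _ b c _ true true).
  apply: measurable_funS mf => //; apply: subset_trans sub' => t /=.
  by rewrite !in_itv/= => /andP[/ltW -> ->].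
- apply: measurable_funS mf => //.
  by move=> t [/sub|/sub'].
- rewrite disj_set2E; apply/eqP/seteqP; split => // t [/=].
  by rewrite !in_itv/= => /andP[_ tb] /andP[bt _]; move: tb; rewrite ltNge bt.
Qed.

Lemma integral_grid_split (f : R -> \bar R) (tau : R) (n : nat) : 0 < tau ->
  measurable_fun `]0, n%:R * tau[ f ->
  (forall i, (i < n)%N ->
    (\int[leb]_(t in `](i%:R * tau)%R, (i.+1%:R * tau)%R[) f t \is a fin_num)%E) ->
  (\int[leb]_(t in `]0%R, (n%:R * tau)%R[) f t =
   \sum_(i < n) \int[leb]_(t in `](i%:R * tau)%R, (i.+1%:R * tau)%R[) f t)%E.
Proof.
move=> tau0; elim: n => [|n IH] mf ffin.
  by rewrite mul0r set_itvoo0 integral_set0 big_ord0.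
rewrite big_ord_recr/=; case: n IH mf ffin => [|n] IH mf ffin.
  by rewrite big_ord0 add0e mul0r.
rewrite -IH.
- apply: integral_interval_split => //; first by rewrite mulr_gt0.
  by rewrite ler_wpM2r ?ler_nat// ltW.
- apply: measurable_funS mf => //; apply: subset_itvl; rewrite bnd_simp.
  by rewrite ler_wpM2r ?ler_nat// ltW.
- by move=> i ik; apply: ffin; rewrite ltnS ltnW.
Qed.

Lemma lebesgue_measure_oo (a b : R) : a < b -> leb `]a, b[ = (b - a)%:E.
Proof. by move=> ab; rewrite lebesgue_measure_itv/= lte_fin ab EFinB. Qed.

Lemma integral_linear_interpolant (a b : R) : a < b ->
  (\int[leb]_(t in `]a, b[) ((t - a) / (b - a))%:E = ((b - a) / 2)%:E)%E.
Proof.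
move=> ab; have ab0 : b - a != 0 by rewrite subr_eq0 gt_eqF.
have cf : continuous (fun t : R => (t - a) / (b - a)).
  move=> t; apply: cvgM; last exact: cvg_cst.
  by apply: cvgB; [exact: cvg_id|exact: cvg_cst].
rewrite -(@integral_itv_bndoo _ a b _ true false); last first.
  by apply/measurable_EFinP/measurable_funTS; exact: continuous_measurable_fun.
pose F (t : R) := (t - a) ^+ 2 / (2 * (b - a)).
have dF (t : R) : is_derive t (1 : R) F ((t - a) / (b - a)).
  rewrite /F; apply: is_derive_eq.
  transitivity ((2 * (b - a))^-1 * ((t - a) * (1 - 0) + (t - a) * (1 - 0))).
    by rewrite scaler0 add0r.
  by field.
have cF : continuous F.
  move=> t; apply: differentiable_continuous; apply/derivable1_diffP.
  by have [] := dF t.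
rewrite (@continuous_FTC2 _ (fun t => (t - a) / (b - a)) F)//.
- by rewrite -EFinB /F subrr expr0n/= mul0r subr0; congr EFin; field.
- exact: continuous_subspaceT.
- split => [t _||]; first by have [] := dF t.
  - by apply: cvg_at_right_filter; exact: cF.
  - by apply: cvg_at_left_filter; exact: cF.
- by move=> t _; rewrite derive1E; apply: derive_val.
Qed.

(** The Cauchy-Schwarz inequality against the constant equal to the mean. *)
Lemma square_le_mean_square (f : R -> R) (a b : R) : a < b ->
  square_integrable leb `]a, b[ f ->
  ((b - a)^-1 * \int[leb]_(t in `]a, b[) f t) ^+ 2 <=
  (b - a)^-1 * \int[leb]_(t in `]a, b[) (f t ^+ 2).
Proof.
move=> ab Lf; have ab0 : 0 < b - a by rewrite subr_gt0.
have mI : measurable (`]a, b[%classic : set (measurableTypeR R)) by exact: measurable_itv.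
have fI : (leb `]a, b[ < +oo)%E by rewrite lebesgue_measure_oo// ltry.
set c := (b - a)^-1 * _.
have L1 : square_integrable leb `]a, b[ (fun=> c) by exact: square_integrable_cst.
have := inner_product_subsq mI Lf L1.
have -> : inner_product leb `]a, b[ f (fun=> c) = c * \int[leb]_(t in `]a, b[) f t.
  rewrite inner_productC /inner_product RintegralZl//.
  have L11 : square_integrable leb `]a, b[ (fun=> 1) by exact: square_integrable_cst.
  have := square_integrableM mI Lf L11.
  by apply: eq_integrable => // x _; rewrite mulr1.
have -> : inner_product leb `]a, b[ (fun=> c) (fun=> c) = c ^+ 2 * (b - a).
  rewrite /inner_product Rintegral_cst// -expr2; congr (_ * _).
  exact: (congr1 fine (lebesgue_measure_oo ab)).
have -> : inner_product leb `]a, b[ f f = \int[leb]_(t in `]a, b[) (f t ^+ 2).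
  by apply: eq_Rintegral => x _; rewrite expr2.
have -> : \int[leb]_(t in `]a, b[) f t = (b - a) * c.
  by rewrite /c mulrA mulfV ?mul1r// gt_eqF.
rewrite ler_pdivlMl// => h; nra.
Qed.

End time_intervals.

Section continuousL2_bounded.
Context {R : realType} {N : nat}.
Local Notation E := 'rV[R]_N.
Local Notation mu := (@lebesgue_rV R N).
Variables (T : R) (Omega : set E).
Hypothesis mO : measurable Omega.

(** A neighbourhood of each time has a common bound, and [0, T] is compact. *)
Lemma continuousL2_bounded (w : R -> E -> R) : continuousL2 Omega T w ->
  exists M : R, forall t, t \in `[0, T] -> (sqnormL2 mu Omega (w t) <= M%:E)%E.
Proof.
move=> [c1 c2].
have /compact_near_coveringP/near_covering_withinP cov := @segment_compact R 0 T.
(* Bounds large enough near each time, with +oo as the filter of bounds. *)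
have [|] := cov _ (+oo%R : set_system R)
   (fun M t => (sqnormL2 mu Omega (w t) <= M%:E)%E) _ _; last first.
- move=> M [_ HM]; exists (M + 1) => t tT.
  by apply: HM => //; rewrite ltrDl.
- move=> t0 Tt0.
  have [_ f0] := c1 t0 Tt0.
  pose s0 := fine (sqnormL2 mu Omega (w t0)).
  have s0E : sqnormL2 mu Omega (w t0) = s0%:E.
    by rewrite fineK// ge0_fin_numE// sqnormL2_ge0.
  have H : \forall t \near within `[0, T] (nbhs t0),
     (sqnormL2 mu Omega (fun x => w t x - w t0 x)%R < 1)%E.
    by apply: (c2 t0 Tt0 [set y | (y < 1)%E]); apply: open_ereal_lt'; rewrite lte_fin.
  exists ([set t | `[0, T]%classic t -> (sqnormL2 mu Omega (fun x => w t x - w t0 x)%R < 1)%E],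
          [set M | 2 + 2 * s0 < M]).
    split; first exact: H.
    by exists (2 + 2 * s0); split; [exact: num_real|].
  move=> [t M] [/= Ht HM] tT.
  have m1 := (c1 t tT).1; have m0 := (c1 t0 Tt0).1.
  rewrite (_ : w t = fun x => (w t x - w t0 x) + w t0 x); last first.
    by apply/funext => x; rewrite subrK.
  have mB : ae_measurable mu Omega (fun x => w t x - w t0 x).
    have := ae_measurableD m1 (ae_measurableZ (-1) m0).
    by under [X in ae_measurable _ _ X -> _]eq_fun do rewrite mulN1r.
  apply: le_trans (sqnormL2D_le_ae mO mB m0) _.
  rewrite s0E; apply: (@le_trans _ _ (2 + 2 * s0)%:E); last by rewrite lee_fin ltW.
  rewrite (EFinD 2 (2 * s0)); apply: leeD; last by rewrite EFinM.
  by rewrite -[leRHS]mule1; apply: lee_wpmul2l => //; exact: ltW (Ht tT).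
Qed.

End continuousL2_bounded.

(** * Time averages and good sampling times *)

(** The raw function [lebesgue_measure] does not unify with the measure structure
    in the generic instances. *)
#[local] Instance lebesgue_ae_filter (R : realType) :
  Filter (almost_everywhere (@lebesgue_measure R)).
Proof. exact: ae_filter_ringOfSetsType. Qed.

#[local] Instance lebesgue_ae_nbhs_filter (R : realType) :
  Filter (nbhs (almost_everywhere (@lebesgue_measure R))).
Proof. exact: lebesgue_ae_filter. Qed.

Section averages.
Context {R : realType} {N : nat}.
Local Notation E := 'rV[R]_N.
Local Notation mu := (@lebesgue_rV R N).
Local Notation MR := (measurableTypeR R).
Local Notation leb := (@lebesgue_measure R).
Local Notation muT := (lebesgue_rV N \x @lebesgue_measure R)%E.
Variables (Omega : set E) (mO : measurable Omega) (fO : (mu Omega < +oo)%E).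
Variables (a b : R) (ab : a < b).
Local Notation J := (`]a, b[%classic : set MR).
Local Notation Q := (Omega `*` J).
Variable w : E -> R -> R.
Hypothesis mw : measurable_fun [set: E * MR] (fun z => w z.1 z.2).
Hypothesis Lw : square_integrable muT Q (fun z => w z.1 z.2).

Let ab0 : 0 < b - a. Proof. by rewrite subr_gt0. Qed.

Let mJ : measurable J. Proof. exact: measurable_itv. Qed.

Let mQ : measurable Q. Proof. exact: measurableX. Qed.

Let fJ : (leb J < +oo)%E.
Proof. by have -> := lebesgue_measure_oo ab; rewrite ltry. Qed.

Definition time_mean (x : E) : R := (b - a)^-1 * \int[leb]_(t in `]a, b[) w x t.

Lemma ae_section_square_integrable :
  {ae mu, forall x, Omega x -> square_integrable leb J (w x)}.
Proof.
have [_ w2] := Lw.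
have [_] := integrable_setX_fubini1 mO mJ w2.
apply: filterS => x h Ox; split; last exact: h.
by apply: measurable_funTS; exact: (measurableT_comp mw (pair1_measurable x)).
Qed.

Let Lcst c : square_integrable leb J (fun=> c).
Proof. exact: square_integrable_cst. Qed.

Let L2_integrable (f : R -> R) : square_integrable leb J f ->
  leb.-integrable J (fun t => (f t)%:E).
Proof.
move=> Lf; have := square_integrableM mJ Lf (Lcst 1).
by apply: eq_integrable => // t _; rewrite mulr1.
Qed.

Lemma w_mul_integrable (psi : E -> R) : square_integrable mu Omega psi ->
  muT.-integrable Q (fun z => (w z.1 z.2 * psi z.1)%:E).
Proof.
by move=> Lpsi; apply: square_integrableM => //; exact: square_integrable_prod_fst.
Qed.

(** Jensen's inequality for almost every x, and Tonelli. *)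
Lemma time_mean_square_integrable : square_integrable mu Omega time_mean.
Proof.
have iw := w_mul_integrable (square_integrable_cst mO 1 fO).
have [i1 _] := integrable_setX_fubini1 mO mJ iw.
have mm : measurable_fun Omega time_mean.
  apply: measurable_funM => //; rewrite /Rintegral.
  apply: (measurableT_comp (fine_measurable (@measurableT _ (\bar R)))).
  apply: eq_measurable_fun (measurable_int _ i1) => x _.
  by apply: eq_integral => t _; rewrite mulr1.
split => //.
have [_ w2] := Lw.
have [i2 _] := integrable_setX_fubini1 mO mJ w2.
apply/integrableP; split; first by apply/measurable_EFinP; exact: measurable_funX.
apply: (@le_lt_trans _ _
  (\int[mu]_(x in Omega) (((b - a)^-1)%:E * \int[leb]_(t in `]a, b[) ((w x t) ^+ 2)%:E))%E).
  apply: ae_le_integral_nonmeasurable => //.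
    move=> x _; rewrite mule_ge0 ?lee_fin ?invr_ge0 ?(ltW ab0)//.
    by apply: integral_ge0 => t _; rewrite lee_fin sqr_ge0.
  apply: filterS ae_section_square_integrable => x h Ox.
  have Lx := h Ox.
  have := square_le_mean_square ab Lx.
  rewrite gee0_abs ?lee_fin ?sqr_ge0// -lee_fin => /le_trans; apply.
  rewrite EFinM lee_wpmul2l ?lee_fin ?invr_ge0 ?(ltW ab0)//.
  rewrite /Rintegral fineK//; apply: integrable_fin_num => //.
  by case: Lx.
rewrite ge0_integralZl//.
- have E1 : (\int[mu]_(x in Omega) \int[leb]_(t in J) (w x t ^+ 2)%:E =
      \int[muT]_(z in Q) (w z.1 z.2 ^+ 2)%:E)%E.
    rewrite tonelli_setX1//; first exact: measurable_int w2.
    by move=> z _; rewrite lee_fin sqr_ge0.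
  rewrite E1; apply: lte_mul_pinfty => //; first by rewrite lee_fin invr_ge0 ltW.
  case/integrableP : w2 => _; apply: le_lt_trans.
  apply: le_integral_nonmeasurable => z _; first by rewrite lee_fin sqr_ge0.
  by rewrite gee0_abs// lee_fin sqr_ge0.
- exact: measurable_int i2.
- by move=> x _; apply: integral_ge0 => t _; rewrite lee_fin sqr_ge0.
- by rewrite lee_fin invr_ge0 ltW.
Qed.

Lemma integral_mul_time_mean (psi : E -> R) : square_integrable mu Omega psi ->
  (\int[muT]_(z in Q) (w z.1 z.2 * psi z.1)%:E =
   ((b - a) * inner_product mu Omega time_mean psi)%:E)%E.
Proof.
move=> Lpsi; have iw := w_mul_integrable Lpsi.
have Lm := time_mean_square_integrable.
rewrite fubini_setX1// EFinM EFin_inner_product//.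
rewrite -integralZl//; last exact: square_integrableM.
apply: ae_eq_integral_nonmeasurable.
apply: filterS ae_section_square_integrable => x h Ox /=.
have Lx := L2_integrable (h Ox).
under eq_integral do rewrite mulrC EFinM.
rewrite integralZl//.
have -> : (\int[leb]_(t in `]a, b[) (w x t)%:E = ((b - a) * time_mean x)%:E)%E.
  rewrite /time_mean mulrA mulfV ?mul1r ?gt_eqF// /Rintegral fineK//.
  exact: integrable_fin_num.
by rewrite -!EFinM; congr EFin; ring.
Qed.

Lemma integral_inner_product (psi : E -> R) : square_integrable mu Omega psi ->
  (\int[leb]_(t in J) \int[mu]_(x in Omega) (w x t * psi x)%:E =
   ((b - a) * inner_product mu Omega time_mean psi)%:E)%E.
Proof.
move=> Lpsi; rewrite -integral_mul_time_mean// fubini_setX2//.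
exact: w_mul_integrable.
Qed.

Lemma integrable_inner_product (psi : E -> R) : square_integrable mu Omega psi ->
  leb.-integrable J (fun t => \int[mu]_(x in Omega) (w x t * psi x)%:E)%E.
Proof.
by move=> Lpsi; have := integrable_setX_fubini2 mO mJ (w_mul_integrable Lpsi).
Qed.

(** The mean value principle for the single function
    <w(t), psi> + (b - a) e(t). Averaging two quantities jointly is the point:
    separate choices would give different times. *)
Lemma good_sample_exists (psi : E -> R) (e : R -> \bar R) (eps : R) (P : R -> Prop) :
  square_integrable mu Omega psi ->
  measurable_fun J e -> (forall t, 0 <= e t)%E ->
  (\int[leb]_(t in J) e t = eps%:E)%E ->
  {ae leb, forall t, J t -> P t} ->
  (forall t, P t -> square_integrable mu Omega (w^~ t)) ->
  exists t, [/\ J t, P t, e t \is a fin_num &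
    inner_product mu Omega (w^~ t) psi + (b - a) * fine (e t) <=
    inner_product mu Omega time_mean psi + eps].
Proof.
move=> Lpsi me e0 ie aeP PL.
have ifp := integrable_inner_product Lpsi.
have ie' : leb.-integrable J e.
  apply/integrableP; split => //.
  under eq_integral do rewrite gee0_abs//.
  by rewrite ie ltry.
have iem : leb.-integrable J (fun t => (b - a)%:E * e t)%E by exact: integrableZl.
pose f t := (\int[mu]_(x in Omega) (w x t * psi x)%:E + (b - a)%:E * e t)%E.
have lJ : leb J = (b - a)%:E by exact: (lebesgue_measure_oo ab).
have iff : leb.-integrable J f by exact: integrableD.
have [t [Jt [Pt et] ft]] : exists t, [/\ J t, P t /\ (e t < +oo)%E &
    (f t <= (inner_product mu Omega time_mean psi + eps)%:E)%E].
  apply: (@ae_ereal_le_exists _ _ _ leb) => //.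
  - by rewrite [ltRHS]lJ lte_fin.
  - rewrite integralD// integral_inner_product// integralZl// ie.
    rewrite [X in (_ <= _ * X)%E](_ : _ = (b - a)%:E); last exact: lJ.
    by rewrite -!EFinM -EFinD lee_fin [leRHS]mulrC mulrDr lexx.
  - have h : {ae leb, forall t, J t -> (e t < +oo)%E}.
      by apply: integrable_ae_lty => //; rewrite ie ltry.
    by apply: filterS2 aeP h => t h1 h2 Jt; split; [exact: h1|exact: h2].
exists t; split => //; first by rewrite ge0_fin_numE.
have efin : e t \is a fin_num by rewrite ge0_fin_numE.
move: ft; rewrite /f -(fineK efin) -EFin_inner_product//; last exact: PL.
Qed.

End averages.

Section representative.
Context {R : realType} {N : nat}.
Local Notation E := 'rV[R]_N.
Local Notation mu := (@lebesgue_rV R N).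
Local Notation MR := (measurableTypeR R).
Local Notation leb := (@lebesgue_measure R).
Local Notation muT := (lebesgue_rV N \x @lebesgue_measure R)%E.
Variables (s p T : R) (Omega : set E).
Hypotheses (p1 : 1 < p) (T0 : 0 < T) (oO : open Omega).
Local Notation I := (`]0%R, T[%classic : set MR).
Local Notation Q := (Omega `*` I).

(** A representative v of u to which the Fubini theorems apply as they stand; u
    itself is only measurable up to null sets. *)
Definition regular_representative (u0 : E -> R) (u v : E -> R -> R) : Prop :=
  [/\ measurable_fun [set: E * MR] (fun z => v z.1 z.2),
      {ae leb, forall t, t \in `]0, T[ -> {ae mu, forall x, u x t = v x t}},
      {ae muT, forall z, z.2 \in `]0, T[ -> u z.1 z.2 = v z.1 z.2},
      square_integrable muT Q (fun z => v z.1 z.2) &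
      {ae leb, forall t, t \in `]0, T[ ->
         Wsp0 s p Omega (fun x => v x t - u0 x) /\ square_integrable mu Omega (v^~ t)}].

(** Square-integrability over Omega x ]0, T[ comes from the bound on the norms of
    the continuous representative. *)
Lemma regular_representative_exists (u0 u0' : E -> R) (u : E -> R -> R) (wu : R -> E -> R) :
  {ae mu, forall x, u0 x = u0' x} ->
  LpX s p T (Wsp s p) u ->
  LpX s p T (Wsp0 s p Omega) (fun x t => u x t - u0 x) ->
  continuous_repr Omega T u wu ->
  exists v, regular_representative u0' u v.
Proof.
move=> u00 [[g mg ug] _ _ _] [_ uW0 _ _] [cwu wuu].
have mO := open_rV_measurable oO.
have mI : measurable I by exact: measurable_itv.
have mTI : measurable ([set: E] `*` I) by exact: measurableX.
pose v (x : E) (t : R) : R := (g \_ ([set: E] `*` I)) (x, t).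
have mv : measurable_fun [set: E * MR] (fun z => v z.1 z.2).
  rewrite (_ : (fun z => _) = g \_ ([set: E] `*` I)); last by apply/funext => -[].
  exact/(measurable_restrictT _ _).1.
have aeuv : {ae muT, forall z, z.2 \in `]0, T[ -> u z.1 z.2 = v z.1 z.2}.
  apply: filterS ug => -[x t]/= h tT; rewrite /v patchE mem_set//; exact: h.
have aeuvt : {ae leb, forall t, t \in `]0, T[ -> {ae mu, forall x, u x t = v x t}}.
  by apply: filterS (ae_prod_section2 aeuv) => t h tT; apply: filterS h => x; exact.
have mvt t : measurable_fun setT (v^~ t).
  exact: (measurableT_comp mv (pair2_measurable t)).
have [M HM] := continuousL2_bounded mO cwu.
have wuv : {ae leb, forall t, t \in `]0, T[ ->
    (\forall x \ae mu, Omega x -> wu t x = v x t)}.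
  apply: filterS2 aeuvt wuu => t h1 h2 tT.
  by apply: filterS2 (h1 tT) (h2 tT) => x <-.
have oc t : t \in `]0, T[ -> t \in `[0, T].
  by rewrite !in_itv/= => /andP[/ltW -> /ltW ->].
have L2v : {ae leb, forall t, t \in `]0, T[ -> square_integrable mu Omega (v^~ t) /\
     (sqnormL2 mu Omega (v^~ t) <= M%:E)%E}.
  apply: filterS wuv => t h tT; split.
    apply: L2_square_integrable => //; first exact: measurable_funTS.
    by apply: (L2_ae_eq (h tT)); apply: cwu.1; exact: oc.
  by rewrite -(ae_eq_sqnormL2 (h tT)); apply: HM; exact: oc.
exists v; split => //.
- split; first exact: measurable_funTS.
  have mv2 : measurable_fun Q (fun z => (v z.1 z.2 ^+ 2)%:E).
    by apply: measurable_funTS; apply/measurable_EFinP; exact: measurable_funX.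
  apply/integrableP; split => //.
  under eq_integral do rewrite gee0_abs ?lee_fin ?sqr_ge0//.
  rewrite tonelli_setX2//; last by move=> z _; rewrite lee_fin sqr_ge0.
  apply: (@le_lt_trans _ _ (\int[leb]_(t in `]0%R, T[) (Num.max 0 M)%:E)%E).
    apply: ae_le_integral_nonmeasurable.
    - by move=> t _; apply: integral_ge0 => x _; rewrite lee_fin sqr_ge0.
    - by move=> t _; rewrite lee_fin le_max lexx.
    - apply: filterS L2v => t h tT; apply: le_trans (h tT).2 _.
      by rewrite lee_fin le_max lexx orbT.
  rewrite integral_cst//; apply: lte_mul_pinfty => //.
  - by rewrite lee_fin le_max lexx.
  - exact: finite_time_interval.
- apply: filterS3 aeuvt uW0 L2v => t h1 h2 h3 tT; split; last exact: (h3 tT).1.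
  apply: (@Wsp0_ae_eq _ _ s p _ _ (fun x => u x t - u0 x)); [exact: p1| |exact: h2].
  by apply: filterS2 (h1 tT) u00 => x -> ->.
Qed.

End representative.

(** * Piecewise linear interpolants in time *)

Section time_grid.
Context {R : realType}.
Variable tau : R.

Lemma grid_succ i : i.+1%:R * tau = i%:R * tau + tau.
Proof. by rewrite -natr1 mulrDl mul1r. Qed.

Lemma grid_step_len i : i.+1%:R * tau - i%:R * tau = tau.
Proof. by rewrite grid_succ [_ + tau]addrC addrK. Qed.

Hypothesis tau0 : 0 < tau.

Lemma grid_step_lt i : i%:R * tau < i.+1%:R * tau.
Proof. by rewrite grid_succ ltrDl. Qed.

Lemma grid_slab_subset n i : (i < n)%N ->
  `]i%:R * tau, i.+1%:R * tau[%classic `<=` `]0, n%:R * tau[%classic.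
Proof.
move=> i_n t; rewrite /= !in_itv/= => /andP[it ti]; apply/andP; split.
  by apply: le_lt_trans it; rewrite mulr_ge0// ltW.
by apply: (lt_le_trans ti); rewrite ler_wpM2r ?ler_nat// ltW.
Qed.

End time_grid.

Section interpolant_pointwise.
Context {R : realType} {X : Type}.
Variables (n : nat) (tau : R) (V : nat -> X -> R).
Hypothesis tau0 : 0 < tau.

(** It is 0 before the i-th slab of length tau, 1 after it, and linear in
    between; written with ramps, it inherits their weak derivative. *)
Definition grid_weight (i : nat) (t : R) : R :=
  (ramp (i%:R * tau) t - ramp (i.+1%:R * tau) t) / tau.

Definition interpolant (x : X) (t : R) : R :=
  V 0%N x + \sum_(i < n) grid_weight i t * (V i.+1 x - V i x).

Definition interpolant_dt (x : X) (t : R) : R :=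
  \sum_(i < n) ((i%:R * tau < t)%R%:R - (i.+1%:R * tau < t)%R%:R) / tau
               * (V i.+1 x - V i x).

Lemma grid_weight0 i t : t <= i%:R * tau -> grid_weight i t = 0.
Proof.
move=> ti; rewrite /grid_weight /ramp !max_l ?subrr ?mul0r// subr_le0//.
exact: le_trans ti (ltW (grid_step_lt tau0 i)).
Qed.

Lemma grid_weight1 i t : i.+1%:R * tau <= t -> grid_weight i t = 1.
Proof.
move=> it; rewrite /grid_weight /ramp !max_r ?subr_ge0//; last exact: le_trans (ltW (grid_step_lt tau0 i)) it.
by rewrite grid_succ; field; rewrite gt_eqF.
Qed.

Lemma grid_weight_mid i t : i%:R * tau <= t -> t <= i.+1%:R * tau ->
  grid_weight i t = (t - i%:R * tau) / tau.
Proof.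
move=> it ti; rewrite /grid_weight /ramp max_r ?subr_ge0// max_l ?subr_le0//.
by rewrite subr0.
Qed.

(** In the j-th slab the weights below j are 1, those above j are 0, and the sum
    of increments telescopes. *)
Lemma interpolantE j t x : (j < n)%N -> j%:R * tau <= t -> t <= j.+1%:R * tau ->
  let theta := (t - j%:R * tau) / tau in
  interpolant x t = theta * V j.+1 x + (1 - theta) * V j x.
Proof.
move=> jn jt tj theta; rewrite /interpolant.
have partial m : \sum_(i < m) grid_weight i t * (V i.+1 x - V i x) =
    if (m <= j)%N then V m x - V 0%N x
    else V j x - V 0%N x + theta * (V j.+1 x - V j x).
  elim: m => [|m IH]; first by rewrite big_ord0 leq0n subrr.
  rewrite big_ord_recr/= IH; case: (ltngtP m j) => [mj|jm|mj].
  - rewrite grid_weight1; first by ring.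
    by apply: le_trans jt; rewrite ler_wpM2r ?ler_nat// ltW.
  - rewrite grid_weight0; first by ring.
    by apply: le_trans tj _; rewrite ler_wpM2r ?ler_nat// ltW.
  - by rewrite mj grid_weight_mid.
rewrite partial leqNgt jn/=; ring.
Qed.

Lemma interpolant_0 x : interpolant x 0 = V 0%N x.
Proof.
rewrite /interpolant big1 ?addr0// => i _.
by rewrite grid_weight0 ?mul0r// mulr_ge0// ltW.
Qed.

Lemma interpolant_dtE j t x : (j < n)%N -> j%:R * tau < t -> t < j.+1%:R * tau ->
  interpolant_dt x t = tau^-1 * (V j.+1 x - V j x).
Proof.
move=> jn jt tj; rewrite /interpolant_dt (bigD1 (Ordinal jn))//= big1 ?addr0.
  by rewrite jt ltNge (ltW tj)/= subr0 div1r.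
move=> i ij; have {}ij : (i : nat) != j by apply: contra ij => /eqP ij; apply/eqP/val_inj.
have [ilj|jli] : (i < j)%N \/ (j < i)%N by apply/orP; rewrite -neq_ltn.
- rewrite !(le_lt_trans _ jt) ?subrr ?mul0r// ler_wpM2r ?ler_nat ?(ltW tau0)//.
  exact: ltnW.
- rewrite !ltNge !(le_trans (ltW tj)) ?subrr ?mul0r// ler_wpM2r ?ler_nat ?(ltW tau0)//.
  by rewrite ltnS ltnW.
Qed.

End interpolant_pointwise.

Lemma interpolant_last (R : realType) (X : Type) (m : nat) (tau : R) (V : nat -> X -> R) x :
  0 < tau -> interpolant m.+1 tau V x (m.+1%:R * tau) = V m.+1 x.
Proof.
move=> tau0; rewrite (@interpolantE _ _ m.+1 tau V tau0 m)//.
- have -> : (m.+1%:R * tau - m%:R * tau) / tau = 1.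
    by rewrite -mulrBl mulfK ?gt_eqF// -natrB// subSnn.
  by rewrite subrr mul0r addr0 mul1r.
- by rewrite ler_wpM2r ?ler_nat// ltW.
Qed.

Section interpolant_comparison.
Context {R : realType} {N : nat}.
Local Notation E := 'rV[R]_N.
Local Notation mu := (@lebesgue_rV R N).
Local Notation MR := (measurableTypeR R).
Local Notation leb := (@lebesgue_measure R).
Local Notation muT := (lebesgue_rV N \x @lebesgue_measure R)%E.
Variables (s p tau : R) (Omega : set E) (m : nat).
Hypotheses (p1 : 1 < p) (tau0 : 0 < tau).
Hypotheses (oO : open Omega) (bO : bounded_set Omega).
Local Opaque Wsp_norm Wsp_seminorm.
Let n := m.+1.
Let T := n%:R * tau.
Variable V : nat -> E -> R.
Hypothesis mV : forall i, measurable_fun setT (V i).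
Local Notation v := (interpolant n tau V).
Local Notation g := (interpolant_dt n tau V).

Let T0 : 0 < T. Proof. by rewrite mulr_gt0// ltr0n. Qed.

Let grid0 i : 0 <= i%:R * tau. Proof. by rewrite mulr_ge0// ltW. Qed.

(** Stated for a general space Y because it is used for the interpolant in W^{s,p}
    and for its difference with u0 in W^{s,p}_0(Omega). *)
Lemma grid_bounded_path (Y : set (E -> R)) (c0 : E -> R) (c : nat -> E -> R) :
  Y `<=` Wsp s p -> (forall f h, Y f -> Y h -> Y (fun x => f x + h x)) ->
  (forall k f, Y f -> Y (fun x => k * f x)) ->
  Y c0 -> (forall i, (i < n)%N -> Y (c i)) ->
  bounded_path s p T Y (fun x t => c0 x + \sum_(i < n) grid_weight tau i t * c i x).
Proof.
move=> YW YD YZ Yc0 Yc.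
apply: bounded_pathD => //; first exact: bounded_path_cst.
apply: (@bounded_path_sum _ _ _ _ _ p1 T0 Y YW YD YZ m
   (fun i x t => grid_weight tau i t * c i x)) => i.
rewrite (_ : (fun x t => _) = fun x t => tau^-1 * (ramp (i%:R * tau) t * c i x) +
    (- tau^-1) * (ramp (i.+1%:R * tau) t * c i x)); last first.
  by apply/funext => x; apply/funext => t; rewrite /grid_weight; ring.
have Yci : Y (c i) by apply: Yc; exact: ltn_ord.
by apply: bounded_pathD => //; apply: bounded_pathZ => //; exact: bounded_path_ramp.
Qed.

Lemma interpolant_time_regular :
  (forall i, (i <= n)%N -> L2 mu Omega (V i)) ->
  time_regular T Omega v g.
Proof.
move=> L2V; have mO := open_rV_measurable oO.
rewrite (_ : g = fun x t => 0 + \sum_(i < n) ((i%:R * tau < t)%R%:R - (i.+1%:R * tau < t)%R%:R) / tau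
               * (V i.+1 x - V i x)); last first.
  by apply/funext => x; apply/funext => t; rewrite add0r.
apply: time_regularD => //.
  by apply: time_regular_cst => //; exact: L2V.
apply: (@time_regular_sum _ _ _ _ T0 oO bO m (fun i x t => grid_weight tau i t * (V i.+1 x - V i x))
   (fun i x t => ((i%:R * tau < t)%R%:R - (i.+1%:R * tau < t)%R%:R) / tau
               * (V i.+1 x - V i x))) => i.
pose c x := V i.+1 x - V i x.
rewrite (_ : (fun x t => grid_weight _ _ _ * _) = fun x t => tau^-1 * (ramp (i%:R * tau) t * c x) +
    (- tau^-1) * (ramp (i.+1%:R * tau) t * c x)); last first.
  by apply/funext => x; apply/funext => t; rewrite /grid_weight /c; ring.
rewrite [X in time_regular _ _ _ X](_ : _ = fun x t => tau^-1 * ((i%:R * tau < t)%R%:R * c x) +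
    (- tau^-1) * ((i.+1%:R * tau < t)%R%:R * c x)); last first.
  by apply/funext => x; apply/funext => t; rewrite /c; ring.
have mc : measurable_fun setT c by exact: measurable_funB.
have L2c : L2 mu Omega c.
  have h1 := L2V i.+1 (ltn_ord i). have h2 := L2V i (ltnW (ltn_ord i)).
  have := L2D mO h1 (L2Z mO (-1) h2).
  by congr L2; apply/funext => x; rewrite mulN1r.
by apply: time_regularD => //; apply: time_regularZ => //; exact: time_regular_ramp.
Qed.

Lemma interpolant_comparison_function (u0 : E -> R) :
  {ae mu, forall x, u0 x = V 0%N x} -> Wsp s p u0 ->
  (forall i, (i < n)%N -> Wsp0 s p Omega (fun x => V i.+1 x - V 0%N x)) ->
  (forall i, (i <= n)%N -> L2 mu Omega (V i)) ->
  comparison_function s p Omega T u0 v g (fun t x => v x t).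
Proof.
move=> uV Wu0 WV L2V.
have [_ _ [_ Lg] wd cL2] := interpolant_time_regular L2V.
have WV0 : Wsp s p (V 0%N) by exact: (Wsp_ae_eq p1 uV).
have W0z : Wsp0 s p Omega (fun x => V 0%N x - V 0%N x).
  split.
    by have := WspZ p1 0 WV0; congr (Wsp _ _); apply/funext => x; rewrite mul0r subrr.
  by apply: aeW => x _; rewrite subrr.
have WVc i : (i < n)%N -> Wsp0 s p Omega (fun x => V i.+1 x - V i x).
  move=> i_n; have h2 : Wsp0 s p Omega (fun x => V i x - V 0%N x).
    by case: i i_n => [//|i] i_n; apply: WV; exact: ltnW.
  have := Wsp0D p1 (WV i i_n) (Wsp0Z p1 (-1) h2).
  by congr (Wsp0 _ _ _); apply/funext => x; ring.
have Wsp0_sub : Wsp0 s p Omega `<=` Wsp s p by move=> f [].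
split.
- have B1 := @grid_bounded_path (Wsp s p) (V 0%N) (fun i x => V i.+1 x - V i x)
    (@subset_refl _ _) (fun f h => @WspD _ _ s p p1 f h) (fun k f => @WspZ _ _ s p p1 k f) WV0
    (fun i h => (WVc i h).1).
  exact: (bounded_path_LpX p1 T0 B1).
- have W0u : Wsp0 s p Omega (fun x => V 0%N x - u0 x).
    by apply: (Wsp0_ae_eq p1 _ W0z); apply: filterS uV => x ->.
  have B2 := @grid_bounded_path (Wsp0 s p Omega) (fun x => V 0%N x - u0 x)
    (fun i x => V i.+1 x - V i x)
    Wsp0_sub (fun f h => @Wsp0D _ _ s p p1 Omega f h) (fun k f => @Wsp0Z _ _ s p p1 Omega k f) W0u
    WVc.
  rewrite (_ : (fun x t => _) = fun x t => (V 0%N x - u0 x) +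
     \sum_(i < n) grid_weight tau i t * (V i.+1 x - V i x)); last first.
    by apply/funext => x; apply/funext => t; rewrite /interpolant addrAC.
  exact: (bounded_path_LpX p1 T0 B2).
- exact: wd.
- exact: (square_integrable_L2 (measurable_cylinder T oO) Lg).
- split; first exact: cL2.
  by apply: aeW => t _; apply: aeW.
Qed.

End interpolant_comparison.

(** * Energy and time term of an interpolant *)

Section interpolant_integrals.
Context {R : realType} {N : nat}.
Local Notation E := 'rV[R]_N.
Local Notation mu := (@lebesgue_rV R N).
Local Notation MR := (measurableTypeR R).
Local Notation leb := (@lebesgue_measure R).
Local Notation muT := (lebesgue_rV N \x @lebesgue_measure R)%E.
Variables (tau : R) (Omega : set E) (m : nat).
Hypotheses (tau0 : 0 < tau) (oO : open Omega) (bO : bounded_set Omega).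
Let n := m.+1.
Let T := n%:R * tau.
Variable V : nat -> E -> R.
Hypothesis mV : forall i, measurable_fun setT (V i).
Hypothesis L2V : forall i, (i <= n)%N -> L2 mu Omega (V i).
Local Notation v := (interpolant n tau V).
Local Notation g := (interpolant_dt n tau V).
Local Notation "<| f , h |>" := (inner_product mu Omega f h).

Let T0 : 0 < T. Proof. by rewrite mulr_gt0// ltr0n. Qed.

Let mO : measurable Omega. Proof. exact: open_rV_measurable. Qed.

Let fO : (mu Omega < +oo)%E. Proof. exact: bounded_open_finite_measure. Qed.

Lemma interpolant_linear_square_integrable (j : nat) :
  square_integrable leb `](j%:R * tau), (j.+1%:R * tau)[ (fun t => (t - j%:R * tau) / tau).
Proof.
have mJ : measurable (`](j%:R * tau), (j.+1%:R * tau)[%classic : set MR) by exact: measurable_itv.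
have fJ : (leb `](j%:R * tau)%R, (j.+1%:R * tau)%R[ < +oo)%E.
  by have -> := lebesgue_measure_oo (grid_step_lt tau0 j); rewrite ltry.
have cth : continuous (fun t : R => (t - j%:R * tau) / tau).
  move=> t; apply: cvgM; last exact: cvg_cst.
  by apply: cvgB; [exact: cvg_id|exact: cvg_cst].
apply: (@square_integrable_bounded _ _ _ leb _ mJ _ 1 fJ).
  by apply: measurable_funTS; exact: continuous_measurable_fun.
move=> t; rewrite /= in_itv/= => /andP[jt tj].
rewrite ger0_norm ?divr_ge0 ?subr_ge0 ?ltW//.
by rewrite ltr_pdivrMr// mul1r ltrBlDr addrC -grid_succ.
Qed.

Lemma interpolant_linear_integrable (j : nat) (c d : R) :
  leb.-integrable `](j%:R * tau), (j.+1%:R * tau)[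
    (fun t => ((t - j%:R * tau) / tau * c + (1 - (t - j%:R * tau) / tau) * d)%:E).
Proof.
have mJ : measurable (`](j%:R * tau), (j.+1%:R * tau)[%classic : set MR) by exact: measurable_itv.
have fJ : (leb `](j%:R * tau)%R, (j.+1%:R * tau)%R[ < +oo)%E.
  by have -> := lebesgue_measure_oo (grid_step_lt tau0 j); rewrite ltry.
have Lth := interpolant_linear_square_integrable j.
have L1 k := square_integrable_cst mJ k fJ.
have := square_integrableM mJ (square_integrableD mJ (square_integrableZ mJ (c - d) Lth) (L1 d)) (L1 1).
by apply: eq_integrable => // t _; congr EFin; ring.
Qed.

Lemma interpolant_integral_linear (j : nat) (c d : R) :
  (\int[leb]_(t in `](j%:R * tau)%R, (j.+1%:R * tau)%R[)
     ((t - j%:R * tau) / tau * c + (1 - (t - j%:R * tau) / tau) * d)%:E =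
   (tau * (d + c) / 2)%:E)%E.
Proof.
pose J : set MR := `](j%:R * tau), (j.+1%:R * tau)[%classic.
have mJ : measurable J by exact: measurable_itv.
have lJ : leb J = tau%:E by have := lebesgue_measure_oo (grid_step_lt tau0 j); rewrite grid_step_len.
have icst k : leb.-integrable J (fun=> k%:E).
  have := interpolant_linear_integrable j k k.
  by apply: eq_integrable => // t _; congr EFin; ring.
have ith : leb.-integrable J (fun t => ((t - j%:R * tau) / tau)%:E).
  have := interpolant_linear_integrable j 1 0.
  by apply: eq_integrable => // t _; congr EFin; ring.
have I1 := integral_linear_interpolant (grid_step_lt tau0 j).
rewrite grid_step_len in I1.
transitivity (\int[leb]_(t in J) ((c - d)%:E * ((t - j%:R * tau) / tau)%:E + d%:E))%E.
  by apply: eq_integral => t _; rewrite -EFinM -EFinD; congr EFin; ring.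
rewrite integralD//; last exact: integrableZl.
rewrite integralZl// I1 integral_cst//.
rewrite [X in (_ + _ * X)%E](_ : _ = tau%:E)//.
by rewrite -!EFinM -EFinD; congr EFin; field.
Qed.

(** In each slab, convexity bounds the energy by the affine function of time with
    the same values at the nodes, whose integral is given by the trapezoidal
    rule. *)
Lemma interpolant_energy_le (G : E * E -> R -> R) : energy_density G ->
  (forall i, (i <= n)%N -> density_energy G (V i) \is a fin_num) ->
  (\int[leb]_(t in `]0%R, T[) density_energy G (v^~ t) <=
   (\sum_(i < n) tau * (fine (density_energy G (V i)) + fine (density_energy G (V i.+1))) / 2)%:E)%E.
Proof.
move=> dG efin.
have mv : measurable_fun [set: E * MR] (fun z => v z.1 z.2).
  by have [] := interpolant_time_regular tau0 oO bO mV L2V.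
have me : measurable_fun setT (fun t => density_energy G (v^~ t)).
  exact: measurable_density_energy.
have e0 psi : (0 <= density_energy G psi)%E by exact: density_energy_ge0.
have piece i : (i < n)%N ->
  (\int[leb]_(t in `](i%:R * tau)%R, (i.+1%:R * tau)%R[) density_energy G (v^~ t) <=
   (tau * (fine (density_energy G (V i)) + fine (density_energy G (V i.+1))) / 2)%:E)%E.
  move=> i_n; rewrite -(interpolant_integral_linear i).
  apply: le_integral_nonmeasurable => // t; rewrite /= in_itv/= => /andP[it ti].
  have th0 : 0 <= (t - i%:R * tau) / tau by rewrite divr_ge0 ?subr_ge0 ?ltW.
  have th1 : (t - i%:R * tau) / tau <= 1.
    by rewrite ler_pdivrMr// mul1r lerBlDr addrC -grid_succ ltW.
  rewrite (_ : (fun x => _) = fun x => (t - i%:R * tau) / tau * V i.+1 x +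
      (1 - (t - i%:R * tau) / tau) * V i x); last first.
    by apply/funext => x; rewrite (@interpolantE _ _ n tau V tau0 i)// ltW.
  apply: (le_trans (density_energy_convex dG th0 th1 (mV _) (mV _))).
  rewrite -(fineK (efin i.+1 i_n)) -(fineK (efin i (ltnW i_n))).
  by rewrite -!EFinM -EFinD lee_fin !fineK ?efin// ltnW.
rewrite (@integral_grid_split _ _ tau n)//.
- rewrite -sumEFin; apply: lee_sum => i _; exact: piece.
- exact: measurable_funTS.
- move=> i i_n; rewrite ge0_fin_numE; last by apply: integral_ge0 => t _.
  by apply: le_lt_trans (piece i i_n) _; rewrite ltry.
Qed.

Variable w : E -> R -> R.
Hypothesis mw : measurable_fun [set: E * MR] (fun z => w z.1 z.2).
Hypothesis Lw : square_integrable muT (Omega `*` `]0%R, T[%classic) (fun z => w z.1 z.2).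
Hypothesis Lwt : {ae leb, forall t, t \in `]0, T[ -> square_integrable mu Omega (w^~ t)}.

Lemma square_integrable_slab i : (i < n)%N ->
  square_integrable muT (Omega `*` `](i%:R * tau), (i.+1%:R * tau)[%classic)
    (fun z => w z.1 z.2).
Proof.
move=> i_n; have [_ w2] := Lw; split; first exact: measurable_funTS.
apply: integrableS w2.
- by apply: measurableX => //; exact: measurable_itv.
- by apply: measurableX => //; exact: measurable_itv.
- by move=> z [Oz Jz]; split => //; apply: (grid_slab_subset tau0 i_n).
Qed.

(** In the i-th slab the derivative is the constant (V_(i+1) - V_i) / tau. Its
    product with the affine interpolant integrates to the increment of half the
    squared norm; its product with w only sees the average of w over the
    slab. *)
Lemma integral_interpolant_dt :
  (\int[muT]_(z in Omega `*` `]0%R, T[) (g z.1 z.2 * (v z.1 z.2 - w z.1 z.2))%:E =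
   (\sum_(i < n) (<|V i.+1, V i.+1|> / 2 - <|V i, V i|> / 2
                   - <|fun x => V i.+1 x - V i x, time_mean (i%:R * tau) (i.+1%:R * tau) w|>))%:E)%E.
Proof.
have [mv mg [Lv Lg] _ _] := interpolant_time_regular tau0 oO bO mV L2V.
have mI : measurable (`]0%R, T[%classic : set MR) by exact: measurable_itv.
have mQ := measurable_cylinder T oO.
have LV i : (i <= n)%N -> square_integrable mu Omega (V i).
  by move=> i_n; apply: L2_square_integrable => //; [exact: measurable_funTS|exact: L2V].
have ii : muT.-integrable (Omega `*` `]0%R, T[%classic)
    (fun z => (g z.1 z.2 * (v z.1 z.2 - w z.1 z.2))%:E).
  by apply: square_integrableM => //; exact: square_integrableB.
rewrite fubini_setX2//.
have ih := integrable_setX_fubini2 mO mI ii.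
have piece i : (i < n)%N ->
  (\int[leb]_(t in `](i%:R * tau)%R, (i.+1%:R * tau)%R[)
     \int[mu]_(x in Omega) (g x t * (v x t - w x t))%:E =
   (<|V i.+1, V i.+1|> / 2 - <|V i, V i|> / 2
     - <|fun x => V i.+1 x - V i x, time_mean (i%:R * tau) (i.+1%:R * tau) w|>)%:E)%E.
  move=> i_n.
  pose J : set MR := `](i%:R * tau), (i.+1%:R * tau)[%classic.
  have mJ : measurable J by exact: measurable_itv.
  pose c x := V i.+1 x - V i x.
  have L1 := LV i.+1 i_n. have L0 := LV i (ltnW i_n).
  have Lc : square_integrable mu Omega c by exact: square_integrableB.
  have Lwi := square_integrable_slab i_n.
  have iwc := integrable_inner_product mO (grid_step_lt tau0 i) Lwi Lc.
  have Iwc := integral_inner_product mO fO (grid_step_lt tau0 i) mw Lwi Lc.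
  have LPhi := time_mean_square_integrable mO fO (grid_step_lt tau0 i) mw Lwi.
  rewrite grid_step_len in Iwc.
  transitivity (\int[leb]_(t in J) (tau^-1%:E *
     (((t - i%:R * tau) / tau * <|V i.+1, c|> + (1 - (t - i%:R * tau) / tau) * <|V i, c|>)%:E
      - \int[mu]_(x in Omega) (w x t * c x)%:E)))%E.
    apply: ae_eq_integral_nonmeasurable.
    apply: filterS Lwt => t Lt Jt.
    have {}Lt : square_integrable mu Omega (w^~ t) by apply: Lt; exact: (grid_slab_subset tau0 i_n Jt).
    move: Jt; rewrite /J/= in_itv/= => /andP[it ti].
    set th := (t - i%:R * tau) / tau.
    have Lth : square_integrable mu Omega (fun x => th * V i.+1 x + (1 - th) * V i x).
      by apply: square_integrableD => //; exact: square_integrableZ.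
    rewrite -(EFin_inner_product mO Lt Lc).
    transitivity ((tau^-1 * <|c, fun x => (th * V i.+1 x + (1 - th) * V i x) - w x t|>)%:E).
      rewrite -inner_productZl//; last exact: square_integrableB.
      rewrite EFin_inner_product//; last 2 first.
      - exact: square_integrableZ.
      - exact: square_integrableB.
      apply: eq_integral => x _.
      by rewrite (interpolant_dtE V tau0 x i_n it ti) (interpolantE V tau0 x i_n (ltW it) (ltW ti)).
    rewrite inner_productBr// [<|c, w^~ t|>]inner_productC.
    rewrite [<|c, fun x => th * _ + _|>]inner_productC inner_productDl//; do ?exact: square_integrableZ.
    by rewrite !inner_productZl.
  have ilin := interpolant_linear_integrable i <|V i.+1, c|> <|V i, c|>.
  rewrite integralZl//; last exact: integrableB.
  rewrite integralB// interpolant_integral_linear Iwc.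
  rewrite -EFinB -EFinM; congr EFin.
  rewrite [<|c, time_mean _ _ _|>]inner_productC.
  have -> : <|V i.+1, c|> = <|V i.+1, V i.+1|> - <|V i.+1, V i|> by rewrite inner_productBr.
  have -> : <|V i, c|> = <|V i, V i.+1|> - <|V i, V i|> by rewrite inner_productBr.
  rewrite [<|V i, V i.+1|>]inner_productC; field.
  by rewrite gt_eqF.
rewrite (@integral_grid_split _ _ tau n)//.
- by rewrite -sumEFin; apply: eq_bigr => i _; rewrite piece.
- exact: measurable_int ih.
- by move=> i i_n; rewrite piece.
Qed.

End interpolant_integrals.

(** * The variational inequality for sampled interpolants *)

Definition variational_inequality (R : realType) (N : nat) (s p : R) (Omega : set 'rV[R]_N)
    (T : R) (H : 'rV[R]_N -> 'rV[R]_N -> R -> R) (u0 : 'rV[R]_N -> R)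
    (u : 'rV[R]_N -> R -> R) (wu : R -> 'rV[R]_N -> R) : Prop :=
  forall v dtv wv, comparison_function s p Omega T u0 v dtv wv ->
    (\int[@lebesgue_measure R]_(t in `]0%R, T[) energy H (u^~ t) <=
     \int[@lebesgue_measure R]_(t in `]0%R, T[) energy H (v^~ t)
     + \int[lebesgue_rV N \x @lebesgue_measure R]_(z in Omega `*` `]0%R, T[)
         (dtv z.1 z.2 * (v z.1 z.2 - u z.1 z.2))%:E
     + 2^-1%:E * sqnormL2 (lebesgue_rV N) Omega (fun x => wv 0%R x - u0 x)%R
     - 2^-1%:E * sqnormL2 (lebesgue_rV N) Omega (fun x => wv T x - wu T x)%R)%E.

Section sampled_interpolant.
Context {R : realType} {N : nat}.
Local Notation E := 'rV[R]_N.
Local Notation mu := (@lebesgue_rV R N).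
Local Notation MR := (measurableTypeR R).
Local Notation leb := (@lebesgue_measure R).
Local Notation muT := (lebesgue_rV N \x @lebesgue_measure R)%E.
Variables (s p tau : R) (Omega : set E) (m : nat).
Hypotheses (p1 : 1 < p) (tau0 : 0 < tau).
Hypotheses (oO : open Omega) (bO : bounded_set Omega).
Local Opaque Wsp_norm Wsp_seminorm.
Let n := m.+1.
Let T := n%:R * tau.
Variable G : E * E -> R -> R.
Hypothesis dG : energy_density G.
Variable u0 : E -> R.
Hypotheses (mu0 : measurable_fun setT u0) (L2u0 : L2 mu Omega u0).
Local Notation "<| f , h |>" := (inner_product mu Omega f h).

Let T0 : 0 < T. Proof. by rewrite mulr_gt0// ltr0n. Qed.

Let mO : measurable Omega. Proof. exact: open_rV_measurable. Qed.

Let fO : (mu Omega < +oo)%E. Proof. exact: bounded_open_finite_measure. Qed.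

Definition interpolation_nodes (V : nat -> E -> R) : Prop :=
  [/\ V 0%N = u0,
      forall i, measurable_fun setT (V i),
      forall i, (i < n)%N -> Wsp0 s p Omega (fun x => V i.+1 x - u0 x),
      forall i, (i <= n)%N -> L2 mu Omega (V i) &
      forall i, (i <= n)%N -> density_energy G (V i) \is a fin_num].

(** The right-hand side of the variational inequality for the interpolant of V
    and a solution w with final trace c, except that the energy of the
    interpolant is replaced by its trapezoidal upper bound. *)
Definition discrete_functional (V : nat -> E -> R) (w : E -> R -> R) (c : E -> R) : R :=
  \sum_(i < n) tau * (fine (density_energy G (V i)) + fine (density_energy G (V i.+1))) / 2
  + \sum_(i < n) (<|V i.+1, V i.+1|> / 2 - <|V i, V i|> / 2
                   - <|fun x => V i.+1 x - V i x, time_mean (i%:R * tau) (i.+1%:R * tau) w|>)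
  - <|fun x => V n x - c x, fun x => V n x - c x|> / 2.

(** One good sampling time per slab, tested against the increment of the averages
    of w, where c takes the place of the average after the last slab. *)
Lemma sampled_nodes_exist (w : E -> R -> R) (c : E -> R) :
  measurable_fun [set: E * MR] (fun z => w z.1 z.2) ->
  square_integrable muT (Omega `*` `]0%R, T[%classic) (fun z => w z.1 z.2) ->
  {ae leb, forall t, t \in `]0, T[ ->
     Wsp0 s p Omega (fun x => w x t - u0 x) /\ square_integrable mu Omega (w^~ t)} ->
  square_integrable mu Omega c ->
  (density_energy G u0 < +oo)%E ->
  (\int[leb]_(t in `]0%R, T[) density_energy G (w^~ t) < +oo)%E ->
  exists2 V, interpolation_nodes V &
    discrete_functional V w c <=
    tau / 2 * fine (density_energy G u0)
    + fine (\int[leb]_(t in `]0%R, T[) density_energy G (w^~ t))%E.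
Proof.
move=> mw Lw Pw Lc e0fin ewfin.
pose e t := density_energy G (w^~ t).
have ege psi : (0 <= density_energy G psi)%E by exact: density_energy_ge0.
have me : measurable_fun [set: MR] e by exact: measurable_density_energy.
have mIv i : measurable (`](i%:R * tau), (i.+1%:R * tau)[%classic : set MR).
  exact: measurable_itv.
have mI : measurable (`]0%R, T[%classic : set MR) by exact: measurable_itv.
pose epsE i := (\int[leb]_(t in `](i%:R * tau)%R, (i.+1%:R * tau)%R[) e t)%E.
have epsfin i : (i < n)%N -> epsE i \is a fin_num.
  move=> i_n; rewrite ge0_fin_numE; last by apply: integral_ge0 => t _; exact: ege.
  apply: le_lt_trans ewfin; apply: ge0_subset_integral => //.
  - exact: measurable_funTS.
  - by move=> t _; exact: ege.
  - exact: (grid_slab_subset tau0 i_n).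
(* The last increment compares the final trace with the last average. *)
pose Phi i := if (i < n)%N then time_mean (i%:R * tau) (i.+1%:R * tau) w else c.
have LPhi i : square_integrable mu Omega (Phi i).
  rewrite /Phi; case: ifPn => // i_n.
  have Lwi := square_integrable_slab tau0 oO mw Lw i_n.
  exact: (time_mean_square_integrable mO fO (grid_step_lt tau0 i) mw Lwi).
pose P t := Wsp0 s p Omega (fun x => w x t - u0 x) /\ square_integrable mu Omega (w^~ t).
have /choice[t ht] : forall i, exists t, (i < n)%N ->
    [/\ P t, e t \is a fin_num &
    <|w^~ t, fun x => Phi i.+1 x - Phi i x|> + tau * fine (e t) <=
    <|Phi i, fun x => Phi i.+1 x - Phi i x|> + fine (epsE i)].
  move=> i; case: (boolP (i < n)%N) => [i_n|_]; last by exists 0.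
  have Lwi := square_integrable_slab tau0 oO mw Lw i_n.
  have aeP : {ae leb, forall t, `](i%:R * tau), (i.+1%:R * tau)[%classic t -> P t}.
    by apply: filterS Pw => t h Jt; apply: h; exact: (grid_slab_subset tau0 i_n Jt).
  have Ldiff : square_integrable mu Omega (fun x => Phi i.+1 x - Phi i x).
    exact: square_integrableB.
  have Heps : (\int[leb]_(t in `](i%:R * tau)%R, (i.+1%:R * tau)%R[) e t = (fine (epsE i))%:E)%E.
    exact: (esym (fineK (epsfin i i_n))).
  have e0 t : (0 <= e t)%E by exact: ege.
  have PL t : P t -> square_integrable mu Omega (w^~ t) by case.
  have [t [_ Pt et h]] := good_sample_exists mO fO (grid_step_lt tau0 i) mw Lwi Ldiff
     (measurable_funTS me) e0 Heps aeP PL.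
  by exists t => _; split => //; move: h; rewrite grid_step_len /Phi i_n.
(* Node 0 is u0, so node i.+1 is the sample from slab i. *)
pose V i x := if i is j.+1 then w x (t j) else u0 x.
have LV i : (i <= n)%N -> square_integrable mu Omega (V i).
  case: i => [_|i i_n]; last by have [[]] := ht i i_n.
  by apply: L2_square_integrable => //; exact: measurable_funTS.
exists V.
  split => //.
  - by case=> [//|i]; exact: (measurableT_comp mw (pair2_measurable (t i))).
  - by move=> i i_n; have [[]] := ht i i_n.
  - by move=> i i_n; apply: square_integrable_L2 => //; exact: LV.
  - case=> [_|i i_n]; first by rewrite ge0_fin_numE.
    by have [] := ht i i_n.
have Vstep i : (i < n)%N -> <|V i.+1, fun x => Phi i.+1 x - Phi i x|>
    + tau * fine (density_energy G (V i.+1)) <=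
    <|Phi i, fun x => Phi i.+1 x - Phi i x|> + fine (epsE i).
  by move=> i_n; have [] := ht i i_n.
have := telescoping_energy_estimate mO LV (fun i _ => LPhi i) Vstep (ltW tau0)
  (fun i => fine_ge0 (ege (V i))).
have PhiE (i : 'I_n) : Phi i = time_mean (i%:R * tau) (i.+1%:R * tau) w.
  by rewrite /Phi ltn_ord.
have -> : Phi n = c by rewrite /Phi ltnn.
under [X in _ + X - _ <= _]eq_bigr do rewrite PhiE.
move=> /le_trans; apply; rewrite lerD2l.
rewrite (@integral_grid_split _ _ tau n)//.
- rewrite (_ : (\sum_(i < n) _)%E = (\sum_(i < n) fine (epsE i))%:E)//.
  by rewrite -sumEFin; apply: eq_bigr => i _; rewrite fineK// epsfin.
- exact: measurable_funTS.
Qed.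

(** The initial term vanishes since the first node is u0, and the final term is
    exact since the interpolant equals the last node at time T. *)
Lemma variational_inequality_interpolant (H : E -> E -> R -> R) (u0' : E -> R)
    (u v : E -> R -> R) (wu : R -> E -> R) (c : E -> R) (V : nat -> E -> R) :
  (forall psi, energy H psi = density_energy G psi) ->
  {ae mu, forall x, u0' x = u0 x} -> Wsp s p u0' ->
  regular_representative s p T Omega u0 u v ->
  square_integrable mu Omega c -> {ae mu, forall x, Omega x -> wu T x = c x} ->
  interpolation_nodes V ->
  variational_inequality s p Omega T H u0' u wu ->
  (\int[leb]_(t in `]0%R, T[) density_energy G (v^~ t) <= (discrete_functional V v c)%:E)%E.
Proof.
move=> HG uu0 Wu0 [mv uvt uv Lv Pv] Lc wc [V0 mV WV L2V eV] hu.
have uV : {ae mu, forall x, u0' x = V 0%N x} by rewrite V0.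
have WV0 i : (i < n)%N -> Wsp0 s p Omega (fun x => V i.+1 x - V 0%N x) by rewrite V0; exact: WV.
have cf := interpolant_comparison_function p1 tau0 oO bO mV uV Wu0 WV0 L2V.
have LVn : square_integrable mu Omega (V n).
  by apply: L2_square_integrable => //; [exact: measurable_funTS|exact: L2V].
have := hu _ _ _ cf.
have -> : (\int[leb]_(t in `]0%R, T[) energy H (u^~ t) =
    \int[leb]_(t in `]0%R, T[) density_energy G (v^~ t))%E.
  apply: ae_eq_integral_nonmeasurable; apply: filterS uvt => t h tT.
  by rewrite HG; apply: density_energy_ae_eq; exact: h.
under [X in (_ <= X + _ + _ - _)%E -> _]eq_integral do rewrite HG.
have -> : (\int[muT]_(z in Omega `*` `]0%R, T[)
    (interpolant_dt n tau V z.1 z.2 * (interpolant n tau V z.1 z.2 - u z.1 z.2))%:E =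
  \int[muT]_(z in Omega `*` `]0%R, T[)
    (interpolant_dt n tau V z.1 z.2 * (interpolant n tau V z.1 z.2 - v z.1 z.2))%:E)%E.
  apply: ae_eq_integral_nonmeasurable.
  apply: (@filterS _ _ (ae_filter_ringOfSetsType _) _ _ _ uv) => z h [_ zT].
  by rewrite h.
have Lvt : {ae leb, forall t, t \in `]0, T[ -> square_integrable mu Omega (v^~ t)}.
  by apply: filterS Pv => t h tT; case: (h tT).
rewrite (integral_interpolant_dt tau0 oO bO mV L2V mv Lv Lvt).
have -> : sqnormL2 mu Omega (fun x => interpolant n tau V x 0 - u0' x) = 0%E.
  rewrite (@ae_eq_sqnormL2 _ _ _ _ _ _ (fun=> 0)).
    by rewrite /sqnormL2 integral0_eq// => x _; rewrite expr0n.
  by apply: filterS uV => x -> _; rewrite interpolant_0// subrr.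
rewrite mule0 adde0.
rewrite (@ae_eq_sqnormL2 _ _ _ _ _ _ (fun x => V n x - c x)); last first.
  by apply: filterS wc => x h Ox; rewrite h// interpolant_last.
rewrite sqnormL2E//; last exact: square_integrableB.
move=> /le_trans; apply.
rewrite /discrete_functional EFinB EFinD; apply: leeB; last first.
  by rewrite -EFinM lee_fin mulrC.
apply: leeD; last exact: lexx.
exact: (interpolant_energy_le tau0 oO bO mV L2V dG).
Qed.

End sampled_interpolant.

(** * The midpoint of two solutions *)

Lemma inner_product_midpoint_le d (T : measurableType d) (R : realType)
    (mu : {measure set T -> \bar R}) (D : set T) (f g : T -> R) : measurable D ->
  square_integrable mu D f -> square_integrable mu D g ->
  inner_product mu D (fun x => 2^-1 * (f x + g x)) (fun x => 2^-1 * (f x + g x)) <=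
  (inner_product mu D f f + inner_product mu D g g) / 2.
Proof.
move=> mD Lf Lg.
have Lfg := square_integrableD mD Lf Lg.
have Lh := square_integrableZ mD 2^-1 Lfg.
have := inner_product_ge0 mu D (fun x => f x - g x).
rewrite inner_productBl//; last exact: square_integrableB.
rewrite !inner_productBr// inner_productZl//.
rewrite [inner_product mu D (fun x => f x + g x) _]inner_productC.
rewrite inner_productZl// inner_productDl//.
rewrite ![inner_product mu D _ (fun x => f x + g x)]inner_productC !inner_productDl//.
rewrite [inner_product mu D g f]inner_productC => h; lra.
Qed.

(** The Archimedean property, in the form that lets the step tend to 0. *)
Lemma le0_of_le_divn (R : realType) (d C : R) : 0 <= C ->
  (forall m, d <= C / m.+1%:R) -> d <= 0.
Proof.
move=> C0 bound; rewrite leNgt; apply/negP => d0.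
have := archi_boundP (divr_ge0 C0 (ltW d0)).
set k := Num.bound _ => hk.
have := bound k; rewrite ler_pdivlMr// => hb.
move: hk; rewrite ltr_pdivrMr// => hk.
have : k%:R <= k.+1%:R :> R by rewrite ler_nat.
by rewrite -(ler_pM2r d0) => h; move: hb; rewrite mulrC; lra.
Qed.

Lemma midpoint_bound (R : realType) (a1 a2 d1 d2 d t e i : R) :
  a1 <= d1 -> a2 <= d2 -> (d1 + d2) / 2 <= d -> d <= t / 2 * e + i ->
  a1 + a2 - 2 * i <= t * e.
Proof. by move=> *; lra. Qed.

Lemma discrete_functional_arith (R : realType) (e q s1 s2 d1 d2 d : R) :
  d <= (d1 + d2) / 2 ->
  (e + (q - s1) - d1 / 2 + (e + (q - s2) - d2 / 2)) / 2 <= e + (q - (s1 + s2) / 2) - d / 2.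
Proof. by move=> h; lra. Qed.

Section midpoint.
Context {R : realType} {N : nat}.
Local Notation E := 'rV[R]_N.
Local Notation mu := (@lebesgue_rV R N).
Local Notation MR := (measurableTypeR R).
Local Notation leb := (@lebesgue_measure R).
Local Notation muT := (lebesgue_rV N \x @lebesgue_measure R)%E.
Variables (s p T : R) (Omega : set E).
Hypotheses (p1 : 1 < p) (T0 : 0 < T).
Hypotheses (oO : open Omega) (bO : bounded_set Omega).
Local Opaque Wsp_norm Wsp_seminorm.
Variable G : E * E -> R -> R.
Hypothesis dG : energy_density G.
Local Notation "<| f , h |>" := (inner_product mu Omega f h).

Let mO : measurable Omega. Proof. exact: open_rV_measurable. Qed.

Let fO : (mu Omega < +oo)%E. Proof. exact: bounded_open_finite_measure. Qed.

Definition midpoint (w1 w2 : E -> R -> R) (x : E) (t : R) : R :=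
  2^-1 * (w1 x t + w2 x t).

Lemma time_mean_midpoint (a b : R) (w1 w2 : E -> R -> R) (psi : E -> R) : a < b ->
  measurable_fun [set: E * MR] (fun z => w1 z.1 z.2) ->
  measurable_fun [set: E * MR] (fun z => w2 z.1 z.2) ->
  square_integrable muT (Omega `*` `]a, b[%classic) (fun z => w1 z.1 z.2) ->
  square_integrable muT (Omega `*` `]a, b[%classic) (fun z => w2 z.1 z.2) ->
  square_integrable mu Omega psi ->
  <|time_mean a b (midpoint w1 w2), psi|> =
  (<|time_mean a b w1, psi|> + <|time_mean a b w2, psi|>) / 2.
Proof.
move=> ab mw1 mw2 Lw1 Lw2 Lpsi.
have mQ : measurable (Omega `*` `]a, b[%classic : set (E * MR)).
  by apply: measurableX => //; exact: measurable_itv.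
have mw : measurable_fun [set: E * MR] (fun z => midpoint w1 w2 z.1 z.2).
  by apply: measurable_funM => //; exact: measurable_funD.
have Lw : square_integrable muT (Omega `*` `]a, b[%classic) (fun z => midpoint w1 w2 z.1 z.2).
  by apply: square_integrableZ => //; exact: square_integrableD.
have i1 := w_mul_integrable mO ab Lw1 Lpsi.
have i2 := w_mul_integrable mO ab Lw2 Lpsi.
have H := integral_mul_time_mean mO fO ab mw Lw Lpsi.
have H1 := integral_mul_time_mean mO fO ab mw1 Lw1 Lpsi.
have H2 := integral_mul_time_mean mO fO ab mw2 Lw2 Lpsi.
have ab0 : b - a != 0 by rewrite subr_eq0 gt_eqF.
apply: (mulfI ab0); apply: EFin_inj; rewrite -H.
transitivity (\int[muT]_(z in Omega `*` `]a, b[)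
  (2^-1%:E * ((w1 z.1 z.2 * psi z.1)%:E + (w2 z.1 z.2 * psi z.1)%:E)))%E.
  by apply: eq_integral => z _; rewrite -EFinD -EFinM; congr EFin; rewrite /midpoint; ring.
rewrite integralZl//; last exact: integrableD.
by rewrite integralD// H1 H2 -EFinD -EFinM; congr EFin; field.
Qed.

Lemma density_energy_midpoint (f g : E -> R) :
  measurable_fun setT f -> measurable_fun setT g ->
  (density_energy G (fun x => 2^-1 * (f x + g x))%R <=
   2^-1%:E * (density_energy G f + density_energy G g))%E.
Proof.
move=> mf mg.
have h0 : 0 <= 2^-1 :> R by rewrite invr_ge0.
have h1 : 2^-1 <= 1 :> R by lra.
have := density_energy_convex dG h0 h1 mf mg.
have -> : 1 - 2^-1 = 2^-1 :> R by field.
have -> : (2^-1%:E * (density_energy G f + density_energy G g) =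
    2^-1%:E * density_energy G f + 2^-1%:E * density_energy G g)%E.
  by apply: ge0_muleDr; exact: density_energy_ge0.
have -> : (fun x => 2^-1 * (f x + g x)) = (fun x => 2^-1 * f x + 2^-1 * g x).
  by apply/funext => x; rewrite mulrDr.
by [].
Qed.

(** The functional is affine in w, and concave in c through the final square. *)
Lemma discrete_functional_midpoint (u0 : E -> R) (tau : R) (m : nat) (V : nat -> E -> R)
    (w1 w2 : E -> R -> R) (c1 c2 : E -> R) : 0 < tau ->
  measurable_fun [set: E * MR] (fun z => w1 z.1 z.2) ->
  measurable_fun [set: E * MR] (fun z => w2 z.1 z.2) ->
  square_integrable muT (Omega `*` `]0, (m.+1%:R * tau)[%classic) (fun z => w1 z.1 z.2) ->
  square_integrable muT (Omega `*` `]0, (m.+1%:R * tau)[%classic) (fun z => w2 z.1 z.2) ->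
  square_integrable mu Omega c1 -> square_integrable mu Omega c2 ->
  interpolation_nodes s p Omega m G u0 V ->
  (discrete_functional tau Omega m G V w1 c1 + discrete_functional tau Omega m G V w2 c2) / 2 <=
  discrete_functional tau Omega m G V (midpoint w1 w2) (fun x => 2^-1 * (c1 x + c2 x)).
Proof.
move=> tau0 mw1 mw2 Lw1 Lw2 Lc1 Lc2 [V0 mV _ L2V _].
have LV i : (i <= m.+1)%N -> square_integrable mu Omega (V i).
  by move=> i_n; apply: L2_square_integrable => //; [exact: measurable_funTS|exact: L2V].
have tE (i : 'I_m.+1) :
  <|fun x => V i.+1 x - V i x, time_mean (i%:R * tau) (i.+1%:R * tau) (midpoint w1 w2)|> =
  (<|fun x => V i.+1 x - V i x, time_mean (i%:R * tau) (i.+1%:R * tau) w1|> +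
   <|fun x => V i.+1 x - V i x, time_mean (i%:R * tau) (i.+1%:R * tau) w2|>) / 2.
  rewrite inner_productC time_mean_midpoint//.
  - by congr ((_ + _) / _); exact: inner_productC.
  - by rewrite ltr_pM2r// ltr_nat.
  - exact: (square_integrable_slab tau0 oO mw1 Lw1 (ltn_ord i)).
  - exact: (square_integrable_slab tau0 oO mw2 Lw2 (ltn_ord i)).
  - apply: square_integrableB => //; apply: LV; [exact: ltn_ord|exact: ltnW].
have LVc1 := square_integrableB mO (LV m.+1 (leqnn _)) Lc1.
have LVc2 := square_integrableB mO (LV m.+1 (leqnn _)) Lc2.
have := inner_product_midpoint_le mO LVc1 LVc2.
rewrite /discrete_functional.
have -> : (fun x => V m.+1 x - 2^-1 * (c1 x + c2 x)) =
  (fun x => 2^-1 * (V m.+1 x - c1 x + (V m.+1 x - c2 x))).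
  by apply/funext => x; field.
under [X in _ <= _ + X - _]eq_bigr do rewrite tE.
rewrite !sumrB -!mulr_suml big_split/= => h; exact: discrete_functional_arith h.
Qed.

(** The integrals are finite by comparison with the constant path u0. Then the two
    inequalities are averaged at nodes sampled from the midpoint itself, and the
    number of slabs tends to infinity. *)
Lemma midpoint_energy_ge (H : E -> E -> R -> R) (u0' u0 : E -> R)
    (u1 u2 v1 v2 : E -> R -> R) (wu1 wu2 : R -> E -> R) (c1 c2 : E -> R) :
  (forall psi, energy H psi = density_energy G psi) ->
  {ae mu, forall x, u0' x = u0 x} -> Wsp s p u0' ->
  measurable_fun setT u0 -> L2 mu Omega u0 -> (density_energy G u0 < +oo)%E ->
  regular_representative s p T Omega u0 u1 v1 ->
  regular_representative s p T Omega u0 u2 v2 ->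
  square_integrable mu Omega c1 -> {ae mu, forall x, Omega x -> wu1 T x = c1 x} ->
  square_integrable mu Omega c2 -> {ae mu, forall x, Omega x -> wu2 T x = c2 x} ->
  variational_inequality s p Omega T H u0' u1 wu1 ->
  variational_inequality s p Omega T H u0' u2 wu2 ->
  [/\ \int[leb]_(t in `]0%R, T[) density_energy G (v1^~ t) < +oo,
      \int[leb]_(t in `]0%R, T[) density_energy G (v2^~ t) < +oo &
      \int[leb]_(t in `]0%R, T[) density_energy G (v1^~ t) +
      \int[leb]_(t in `]0%R, T[) density_energy G (v2^~ t) <=
      2%:E * \int[leb]_(t in `]0%R, T[) density_energy G ((midpoint v1 v2)^~ t)]%E.
Proof.
move=> HG uu0 Wu0 mu0 L2u0 eu0 r1 r2 Lc1 wc1 Lc2 wc2 hu1 hu2.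
have mI : measurable (`]0%R, T[%classic : set MR) by exact: measurable_itv.
have ege psi : (0 <= density_energy G psi)%E by exact: density_energy_ge0.
have Wu0' : Wsp s p u0 by exact: (Wsp_ae_eq p1 uu0).
have ub (u v : E -> R -> R) (wu : R -> E -> R) (c : E -> R) : regular_representative s p T Omega u0 u v ->
  square_integrable mu Omega c -> {ae mu, forall x, Omega x -> wu T x = c x} ->
  variational_inequality s p Omega T H u0' u wu ->
  forall tau m V, 0 < tau -> T = m.+1%:R * tau -> interpolation_nodes s p Omega m G u0 V ->
  (\int[leb]_(t in `]0%R, T[) density_energy G (v^~ t) <=
    (discrete_functional tau Omega m G V v c)%:E)%E.
  move=> r Lc wc hu tau m V tau0 TE nV; move: r wc hu; rewrite TE => r wc hu.
  exact: (variational_inequality_interpolant p1 tau0 oO bO dG HG uu0 Wu0 r Lc wc nV hu).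
(* One slab with both nodes equal to u0. *)
have nodes0 : interpolation_nodes s p Omega 0 G u0 (fun=> u0).
  split; [by []|by move=> _; exact: mu0| |by move=> i _; exact: L2u0|]; last first.
    by move=> i _; rewrite (ge0_fin_numE (ege u0)); exact: eu0.
  move=> i _; split.
    by have := WspZ p1 0 Wu0'; congr (Wsp _ _); apply/funext => x; rewrite mul0r subrr.
  by apply: aeW => x _; rewrite subrr.
have T1 : T = 1%:R * T by rewrite mul1r.
have f1 : (\int[leb]_(t in `]0%R, T[) density_energy G (v1^~ t) < +oo)%E.
  by apply: le_lt_trans (ub _ _ _ _ r1 Lc1 wc1 hu1 T 0%N _ T0 T1 nodes0) _; rewrite ltry.
have f2 : (\int[leb]_(t in `]0%R, T[) density_energy G (v2^~ t) < +oo)%E.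
  by apply: le_lt_trans (ub _ _ _ _ r2 Lc2 wc2 hu2 T 0%N _ T0 T1 nodes0) _; rewrite ltry.
split => //.
have [mv1 _ _ Lv1 P1] := r1; have [mv2 _ _ Lv2 P2] := r2.
have mvt1 t : measurable_fun setT (v1^~ t) by exact: (measurableT_comp mv1 (pair2_measurable t)).
have mvt2 t : measurable_fun setT (v2^~ t) by exact: (measurableT_comp mv2 (pair2_measurable t)).
pose w := midpoint v1 v2.
have mw : measurable_fun [set: E * MR] (fun z => w z.1 z.2).
  by apply: measurable_funM => //; exact: measurable_funD.
have mQ := measurable_cylinder T oO.
have Lw : square_integrable muT (Omega `*` `]0, T[%classic) (fun z => w z.1 z.2).
  by apply: square_integrableZ => //; exact: square_integrableD.
have Pw : {ae leb, forall t, t \in `]0, T[ ->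
     Wsp0 s p Omega (fun x => w x t - u0 x) /\ square_integrable mu Omega (w^~ t)}.
  apply: filterS2 P1 P2 => t h1 h2 tT.
  have [W1 L1] := h1 tT; have [W2 L2] := h2 tT; split; last first.
    by apply: square_integrableZ => //; exact: square_integrableD.
  have := Wsp0Z p1 2^-1 (Wsp0D p1 W1 W2).
  by congr (Wsp0 _ _ _); apply/funext => x; rewrite /w /midpoint; field.
have ew : (\int[leb]_(t in `]0%R, T[) density_energy G (w^~ t) < +oo)%E.
  apply: (@le_lt_trans _ _ (\int[leb]_(t in `]0%R, T[)
     (2^-1%:E * (density_energy G (v1^~ t) + density_energy G (v2^~ t))))%E).
    apply: le_integral_nonmeasurable => t _ //; exact: density_energy_midpoint.
  have me1 : measurable_fun (`]0%R, T[%classic : set MR) (fun t => density_energy G (v1^~ t)).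
    by apply: measurable_funTS; exact: measurable_density_energy.
  have me2 : measurable_fun (`]0%R, T[%classic : set MR) (fun t => density_energy G (v2^~ t)).
    by apply: measurable_funTS; exact: measurable_density_energy.
  rewrite ge0_integralZl//.
  - rewrite ge0_integralD//; apply: lte_mul_pinfty => //; exact: lte_add_pinfty.
  - exact: emeasurable_funD.
  - by move=> t _; rewrite adde_ge0.
pose c x := 2^-1 * (c1 x + c2 x).
have Lc : square_integrable mu Omega c.
  by apply: square_integrableZ => //; exact: square_integrableD.
have i0 (f : R -> \bar R) : (forall t, 0 <= f t)%E -> (0 <= \int[leb]_(t in `]0%R, T[) f t)%E.
  by move=> f0; apply: integral_ge0 => t _; exact: f0.
have nodes tau m : 0 < tau -> T = m.+1%:R * tau ->
    exists2 V, interpolation_nodes s p Omega m G u0 V &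
      discrete_functional tau Omega m G V w c <= tau / 2 * fine (density_energy G u0) +
      fine (\int[leb]_(t in `]0%R, T[) density_energy G (w^~ t))%E.
  move=> tau0 TE; move: Lw Pw ew; rewrite TE => Lw' Pw' ew'.
  exact: (sampled_nodes_exist tau0 oO bO dG mu0 L2u0 mw Lw' Pw' Lc eu0 ew').
set I1 := (\int[leb]_(t in `]0%R, T[) density_energy G (v1^~ t))%E in f1 *.
set I2 := (\int[leb]_(t in `]0%R, T[) density_energy G (v2^~ t))%E in f2 *.
have F1 : I1 \is a fin_num by rewrite ge0_fin_numE// i0.
have F2 : I2 \is a fin_num by rewrite ge0_fin_numE// i0.
set Iw := (\int[leb]_(t in `]0%R, T[) density_energy G (w^~ t))%E in ew *.
have Fw : Iw \is a fin_num by rewrite ge0_fin_numE// i0.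
rewrite -(fineK F1) -(fineK F2) -/w -/Iw -(fineK Fw) -EFinD -EFinM lee_fin.
set e0 := fine (density_energy G u0).
have bound m : fine I1 + fine I2 - 2 * fine Iw <= T * e0 / m.+1%:R.
  pose tau := T / m.+1%:R.
  have tau0 : 0 < tau by rewrite divr_gt0.
  have TE : T = m.+1%:R * tau by rewrite mulrC divfK.
  have [V nV hV] := nodes tau m tau0 TE; rewrite -/Iw -/e0 in hV.
  have h1 := ub _ _ _ _ r1 Lc1 wc1 hu1 tau m V tau0 TE nV.
  have h2 := ub _ _ _ _ r2 Lc2 wc2 hu2 tau m V tau0 TE nV.
  rewrite -/I1 -(fineK F1) lee_fin in h1; rewrite -/I2 -(fineK F2) lee_fin in h2.
  have h3 : (discrete_functional tau Omega m G V v1 c1 + discrete_functional tau Omega m G V v2 c2) / 2 <=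
     discrete_functional tau Omega m G V w c.
    by move: Lv1 Lv2; rewrite {1 2}TE => Lv1' Lv2'; exact: (discrete_functional_midpoint tau0 mv1 mv2 Lv1' Lv2' Lc1 Lc2 nV).
  have -> : T * e0 / m.+1%:R = tau * e0 by rewrite /tau mulrAC.
  exact: (midpoint_bound h1 h2 h3 hV).
rewrite -subr_le0; apply: (le0_of_le_divn _ bound).
by rewrite mulr_ge0 ?(ltW T0)// fine_ge0.
Qed.

End midpoint.

(** * The equality case *)

Section equality_case.
Context {R : realType} {N : nat}.
Local Notation E := 'rV[R]_N.
Local Notation mu := (@lebesgue_rV R N).
Local Notation mu2 := (lebesgue_rV N \x lebesgue_rV N)%E.
Local Notation MR := (measurableTypeR R).
Local Notation leb := (@lebesgue_measure R).
Local Notation muT := (lebesgue_rV N \x @lebesgue_measure R)%E.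

(** Some point outside Omega is good both for the constancy and for the vanishing
    of f, because such points form a set of full measure there. *)
Lemma ae_eq0_of_ae_constant (Omega : set E) (f : E -> R) : (0 < N)%N -> bounded_set Omega ->
  {ae mu2, forall z : E * E, f z.1 = f z.2} ->
  {ae mu, forall x, ~ Omega x -> f x = 0} -> {ae mu, forall x, f x = 0}.
Proof.
move=> N0 bO /ae_prod_section2 cf f0.
have [y Oy [cy y0]] := ae_exists_outside_bounded N0 bO (filterI cf f0).
by apply: filterS cy => x /= ->; exact: y0.
Qed.

Variable G : E * E -> R -> R.
Hypothesis dG : energy_density G.

(** Equal integrals in the convexity inequality force pointwise equality almost
    everywhere, which strict convexity only allows at equal arguments. *)
Lemma density_energy_midpoint_eq (f g : E -> R) :
  measurable_fun setT f -> measurable_fun setT g ->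
  (density_energy G f < +oo)%E -> (density_energy G g < +oo)%E ->
  density_energy G (fun x => 2^-1 * (f x + g x)) =
    (2^-1%:E * (density_energy G f + density_energy G g))%E ->
  {ae mu2, forall z : E * E, f z.1 - g z.1 = f z.2 - g z.2}.
Proof.
move=> mf mg ef eg efg.
have md (h : E -> R) : measurable_fun setT h ->
    measurable_fun [set: E * E] (fun z => G z (h z.1 - h z.2)).
  by move=> mh; apply: measurable_density_comp => //; exact: measurable_difference.
have mh : measurable_fun setT (fun x => 2^-1 * (f x + g x)).
  by apply: measurable_funM => //; exact: measurable_funD.
have I1 : (\int[mu2]_z (2^-1 * (G z (f z.1 - f z.2) + G z (g z.1 - g z.2)))%:E =
    2^-1%:E * (density_energy G f + density_energy G g))%E.
  under eq_integral do rewrite EFinM EFinD.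
  rewrite ge0_integralZl//.
  - rewrite ge0_integralD//.
    + by move=> z _; rewrite lee_fin; exact: density_ge0.
    + by apply/measurable_EFinP; exact: md.
    + by move=> z _; rewrite lee_fin; exact: density_ge0.
    + by apply/measurable_EFinP; exact: md.
  - by apply: emeasurable_funD; apply/measurable_EFinP; exact: md.
  - by move=> z _; rewrite adde_ge0// lee_fin; exact: density_ge0.
have : \forall z \ae mu2, setT z ->
   (G z (2^-1 * (f z.1 + g z.1) - 2^-1 * (f z.2 + g z.2)))%:E =
   (2^-1 * (G z (f z.1 - f z.2) + G z (g z.1 - g z.2)))%:E.
  apply: ae_eq_of_integral_le.
  - exact: measurableT.
  - by apply/measurable_EFinP; exact: md mh.
  - apply/measurable_EFinP; apply: measurable_funM => //; apply: measurable_funD; exact: md.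
  - by move=> z _; rewrite lee_fin; exact: density_ge0.
  - move=> z _; rewrite lee_fin.
    have := density_convex dG z (f z.1 - f z.2) (g z.1 - g z.2) (_ : 0 <= 2^-1) (_ : 2^-1 <= 1).
    have -> : 1 - 2^-1 = 2^-1 :> R by field.
    rewrite -!mulrDr => h; apply: le_trans (h _ _) => //; last by lra.
    by rewrite le_eqVlt; apply/orP; left; apply/eqP; congr (G z _); ring.
  - by rewrite I1; apply: lte_mul_pinfty => //; exact: lte_add_pinfty.
  - by rewrite I1 -efg.
apply: (@filterS2 _ _ (ae_filter_ringOfSetsType _) _ _ _ _ (density_strict dG)) => z sz Ez.
have {}Ez := EFin_inj (Ez I).
have [e|ne] := eqVneq (f z.1 - f z.2) (g z.1 - g z.2); first by lra.
have := sz _ _ ne.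
have -> : (f z.1 - f z.2 + (g z.1 - g z.2)) / 2 =
   2^-1 * (f z.1 + g z.1) - 2^-1 * (f z.2 + g z.2) by ring.
by rewrite Ez mulrC ltxx.
Qed.

(** The reverse inequality holds at each time by convexity, so equality holds at
    almost every time. *)
Lemma midpoint_energy_eq (T : R) (v1 v2 : E -> R -> R) :
  measurable_fun [set: E * MR] (fun z => v1 z.1 z.2) ->
  measurable_fun [set: E * MR] (fun z => v2 z.1 z.2) ->
  (\int[leb]_(t in `]0%R, T[) density_energy G (v1^~ t) < +oo)%E ->
  (\int[leb]_(t in `]0%R, T[) density_energy G (v2^~ t) < +oo)%E ->
  (\int[leb]_(t in `]0%R, T[) density_energy G (v1^~ t) +
   \int[leb]_(t in `]0%R, T[) density_energy G (v2^~ t) <=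
   2%:E * \int[leb]_(t in `]0%R, T[) density_energy G ((midpoint v1 v2)^~ t))%E ->
  {ae leb, forall t, t \in `]0, T[ ->
    {ae mu2, forall z : E * E, v1 z.1 t - v2 z.1 t = v1 z.2 t - v2 z.2 t}}.
Proof.
move=> mv1 mv2 f1 f2 hw.
have mI : measurable (`]0%R, T[%classic : set MR) by exact: measurable_itv.
have ege psi : (0 <= density_energy G psi)%E by exact: density_energy_ge0.
have mvt1 t : measurable_fun setT (v1^~ t) by exact: (measurableT_comp mv1 (pair2_measurable t)).
have mvt2 t : measurable_fun setT (v2^~ t) by exact: (measurableT_comp mv2 (pair2_measurable t)).
have mw : measurable_fun [set: E * MR] (fun z => midpoint v1 v2 z.1 z.2).
  by apply: measurable_funM => //; exact: measurable_funD.
have me v : measurable_fun [set: E * MR] (fun z => v z.1 z.2) ->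
    measurable_fun (`]0%R, T[%classic : set MR) (fun t => density_energy G (v^~ t)).
  by move=> mv; apply: measurable_funTS; exact: measurable_density_energy.
have I1 : (\int[leb]_(t in `]0%R, T[)
     (2^-1%:E * (density_energy G (v1^~ t) + density_energy G (v2^~ t))) =
   2^-1%:E * (\int[leb]_(t in `]0%R, T[) density_energy G (v1^~ t) +
   \int[leb]_(t in `]0%R, T[) density_energy G (v2^~ t)))%E.
  rewrite ge0_integralZl//.
  - by rewrite ge0_integralD//; exact: me.
  - by apply: emeasurable_funD; exact: me.
  - by move=> t _; rewrite adde_ge0.
have E1 : \forall t \ae leb, `]0, T[%classic t -> density_energy G ((midpoint v1 v2)^~ t) =
    (2^-1%:E * (density_energy G (v1^~ t) + density_energy G (v2^~ t)))%E.
  apply: ae_eq_of_integral_le => //.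
  - exact: me.
  - by apply: measurable_funeM; apply: emeasurable_funD; exact: me.
  - by move=> t _; exact: (density_energy_midpoint dG).
  - by rewrite I1; apply: lte_mul_pinfty => //; exact: lte_add_pinfty.
  - by rewrite I1 lee_pdivrMl.
have F1 : \forall t \ae leb, `]0, T[%classic t -> (density_energy G (v1^~ t) < +oo)%E.
  by apply: integrable_ae_lty => //; exact: me.
have F2 : \forall t \ae leb, `]0, T[%classic t -> (density_energy G (v2^~ t) < +oo)%E.
  by apply: integrable_ae_lty => //; exact: me.
apply: filterS3 E1 F1 F2 => t e1 l1 l2 tT.
exact: (density_energy_midpoint_eq (mvt1 t) (mvt2 t) (l1 tT) (l2 tT) (e1 tT)).
Qed.

(** The exceptional set in space-time is measurable because the representatives
    are, so it is enough that almost all its slices are null. *)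
Lemma regular_representatives_eq (s p T : R) (Omega : set E) (u0 : E -> R) (u1 u2 v1 v2 : E -> R -> R) :
  (0 < N)%N -> bounded_set Omega ->
  regular_representative s p T Omega u0 u1 v1 ->
  regular_representative s p T Omega u0 u2 v2 ->
  {ae leb, forall t, t \in `]0, T[ ->
    {ae mu2, forall z : E * E, v1 z.1 t - v2 z.1 t = v1 z.2 t - v2 z.2 t}} ->
  {ae muT, forall z, z.2 \in `]0, T[ -> u1 z.1 z.2 = u2 z.1 z.2}.
Proof.
move=> N0 bO [mv1 _ uv1 _ P1] [mv2 _ uv2 _ P2] dc.
have aev : {ae leb, forall t, t \in `]0, T[ -> {ae mu, forall x, v1 x t - v2 x t = 0}}.
  apply: filterS3 dc P1 P2 => t h1 h2 h3 tT.
  apply: (ae_eq0_of_ae_constant N0 bO (h1 tT)).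
  have [[_ Z1] _] := h2 tT; have [[_ Z2] _] := h3 tT.
  apply: filterS2 Z1 Z2 => x z1 z2 Ox; have := z1 Ox; have := z2 Ox; lra.
have : {ae muT, forall z, z.2 \in `]0, T[ -> v1 z.1 z.2 - v2 z.1 z.2 = 0}.
  pose M := [set z : E * MR | (z.2 \in `]0, T[) /\ (v1 z.1 z.2 - v2 z.1 z.2 != 0)].
  have mM : measurable M.
    rewrite (_ : M = (setT `*` `]0, T[%classic) `&`
      ((fun z : E * MR => v1 z.1 z.2 - v2 z.1 z.2) @^-1` ~` [set 0])).
      apply: measurableI.
        by apply: measurableX => //; exact: measurable_itv.
      rewrite -[X in measurable X]setTI; apply: measurable_funB => //.
      exact: measurableC.
    by apply/seteqP; split => [z [zT /eqP z0]|z [[_ zT] /eqP z0]].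
  exists M; split => //; last first.
    by move=> z /= nz; split; [|apply/eqP] => [|z0]; apply: contrapT => // h; apply: nz.
  apply: measurable_prod_null => //.
  apply: filterS aev => t h.
  have [tT|tT] := boolP (t \in `]0, T[); last first.
    rewrite (_ : ysection M t = set0) ?measure0//.
    by apply/seteqP; split => // x; rewrite /ysection/= inE => -[/= tT' _]; rewrite tT' in tT.
  have [A [mA A0 sA]] := h tT.
  apply/eqP; rewrite eq_le measure_ge0 andbT -A0.
  apply: le_measure; rewrite ?inE//; first exact: measurable_ysection.
  move=> x; rewrite /ysection/= inE => -[_ /= /eqP z0]; exact: sA.
apply: (@filterS3 _ _ (ae_filter_ringOfSetsType _) _ _ _ _ _ uv1 uv2) => z h1 h2 h3 zT.
by rewrite h1// h2//; apply/eqP; rewrite -subr_eq0 h3.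
Qed.

End equality_case.

(** * Uniqueness *)

Theorem theorem1p5 (R : realType) (N : nat) (hN : (0 < N)%N)
  (p : R) (hp : 1 < p) (s : R) (hs0 : 0 < s) (hs1 : s < 1) (A : R) (hA : 0 < A)
  (Omega : set 'rV[R]_N) (hOmega_open : open Omega)
  (hOmega_bounded : bounded_set Omega)
  (H : 'rV[R]_N -> 'rV[R]_N -> R -> R)
  (hH_meas : forall xi : R,
    ae_measurable (lebesgue_rV N \x lebesgue_rV N)%E setT
      (fun z => H z.1 z.2 xi))
  (hH_cont : forall x y : 'rV[R]_N, continuous (H x y))
  (hH_convex : forall x y : 'rV[R]_N, convex_function [set: R^o] (H x y))
  (hH_lower : forall (x y : 'rV[R]_N) (xi : R), x != y ->
    A * (`|xi| / enorm (x - y) `^ s) `^ p <= H x y xi)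
  (u0 : 'rV[R]_N -> R) (hu0 : Wsp s p u0)
  (hu0_L2 : L2 (lebesgue_rV N) Omega u0)
  (hu0_energy : (energy H u0 < +oo)%E)
  (hH_strict : forall x y : 'rV[R]_N, strictly_convex (H x y))
  (u1 u2 : 'rV[R]_N -> R -> R)
  (hu1 : variational_solution s p Omega H u0 u1)
  (hu2 : variational_solution s p Omega H u0 u2) :
  {ae (lebesgue_rV N \x @lebesgue_measure R)%E,
    forall z, 0 < z.2 -> u1 z.1 z.2 = u2 z.1 z.2}.
Proof.
have mO : measurable Omega by exact: open_rV_measurable.
have [G dG HG] : exists2 G, energy_density G & forall psi, energy H psi = density_energy G psi.
  apply: energy_density_of => // x y xi xy.
  by apply: le_trans (hH_lower x y xi xy); rewrite mulr_ge0 ?powR_ge0// ltW.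
have [[v0 mv0 uv0] _ _] := hu0.
have {}uv0 : {ae lebesgue_rV N, forall x, u0 x = v0 x} by apply: filterS uv0 => x; exact.
have L2v0 : L2 (lebesgue_rV N) Omega v0.
  by apply: L2_ae_eq hu0_L2; apply: filterS uv0 => x ->.
have ev0 : (density_energy G v0 < +oo)%E.
  by rewrite -(density_energy_ae_eq G uv0) -HG.
have unique_on T : 0 < T -> {ae (lebesgue_rV N \x @lebesgue_measure R)%E,
    forall z, z.2 \in `]0, T[ -> u1 z.1 z.2 = u2 z.1 z.2}.
  move=> T0.
  have [Lu1 Lu10 [w1 cw1 hv1]] := hu1 T T0.
  have [Lu2 Lu20 [w2 cw2 hv2]] := hu2 T T0.
  have [v1 r1] := regular_representative_exists hp T0 hOmega_open uv0 Lu1 Lu10 cw1.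
  have [v2 r2] := regular_representative_exists hp T0 hOmega_open uv0 Lu2 Lu20 cw2.
  have TT : T \in `[0, T] by rewrite in_itv/= lexx ltW.
  have [c1 Lc1 wc1] := L2_representative (cw1.1.1 T TT).
  have [c2 Lc2 wc2] := L2_representative (cw2.1.1 T TT).
  have [f1 f2 h] := midpoint_energy_ge hp T0 hOmega_open hOmega_bounded dG HG uv0 hu0 mv0 L2v0 ev0
    r1 r2 Lc1 wc1 Lc2 wc2 hv1 hv2.
  have [mv1 _ _ _ _] := r1; have [mv2 _ _ _ _] := r2.
  exact: (regular_representatives_eq hN hOmega_bounded r1 r2
    (midpoint_energy_eq dG mv1 mv2 f1 f2 h)).
have := ae_foralln (fun n => unique_on n.+1%:R (ltr0Sn _ n)).
apply: (@filterS _ _ (ae_filter_ringOfSetsType _)) => z h z0.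
apply: (h (Num.bound z.2)); rewrite in_itv/= z0/=.
apply: lt_le_trans (archi_boundP (ltW z0)) _.
by rewrite ler_nat.
Qed.
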